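(* Let $N\ge 1$, let $\Omega\subset\mathbb{R}^N$ be a bounded open domain with $C^1$ boundary and outward unit normal $\nu$, and let $g^\pm\in C^1(\overline\Omega)$ with $g^-(x)<g^+(x)$ for $x\in\overline\Omega$. Let $F\in C(\mathcal{S}(N+1)\times\mathbb{R}^{N+1}\times\mathbb{R}\times\overline\Omega\times[-1,1],\mathbb{R})$ and suppose there is a constant $\alpha>0$ such that, for every $(p,x,y)\in\mathbb{R}^{N+1}\times\overline\Omega\times[-1,1]$, $F(X,p,r,x,y)-\alpha r\le F(Y,p,s,x,y)-\alpha s$ whenever $X,Y\in\mathcal{S}(N+1)$, $r,s\in\mathbb{R}$, $X\ge Y$ and $r\le s$. Let $\gamma_1^\pm\in C(\overline\Omega\times[-1,1],\mathbb{R}^N)$, $\beta^\pm\in C(\overline\Omega\times[-1,1],\mathbb{R})$ and put $\gamma^+=(\gamma_1^+,1)$, $\gamma^-=(\gamma_1^-,-1)$. Assume that there are $\gamma_o\in C^1(\overline\Omega,\mathbb{R}^N)$, $\beta_o\in C^1(\overline\Omega,\mathbb{R})$ with $$\gamma_1^+(x,0)=-\gamma_1^-(x,0)=\gamma_o(x),\qquad \beta^+(x,0)=-\beta^-(x,0)=\beta_o(x)\qquad (x\in\overline\Omega),$$ and $k^\pm\in C(\overline\Omega,\mathbb{R}^N)$, $l^\pm\in C(\overline\Omega,\mathbb{R})$ such that, as $y\to0$, uniformly in $x\in\overline\Omega$, $$\gamma_1^\pm(x,y)=\pm\gamma_o(x)+k^\pm(x)y+o(|y|),\qquad \beta^\pm(x,y)=\pm\beta_o(x)+l^\pm(x)y+o(|y|).$$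 For $\varepsilon>0$ let $S_\varepsilon$ be the set of viscosity solutions of $$\begin{cases}F(D^2u,Du,u,x,y)=0&\text{in }\Omega_\varepsilon,\\ \gamma^+\cdot Du=\beta^+&\text{on }\partial_{\mathrm T}\Omega_\varepsilon,\\ \gamma^-\cdot Du=\beta^-&\text{on }\partial_{\mathrm B}\Omega_\varepsilon,\\ \nu\cdot D_xu=0&\text{on }\partial_{\mathrm L}\Omega_\varepsilon,\end{cases}$$ and define, for $x\in\overline\Omega$, the half relaxed limits $$u^+(x)=\lim_{r\to0^+}\sup\{u(\xi,\eta): u\in S_\varepsilon,\ (\xi,\eta)\in\overline{\Omega_\varepsilon},\ 0<\varepsilon<r,\ |\xi-x|<r\},$$ $$u^-(x)=\lim_{r\to0^+}\inf\{u(\xi,\eta): u\in S_\varepsilon,\ (\xi,\eta)\in\overline{\Omega_\varepsilon},\ 0<\varepsilon<r,\ |\xi-x|<r\}.$$ Then $u^+$ is a viscosity subsolution and $u^-$ is a viscosity supersolution of $$G(D^2u,Du,u,x)=0\ \text{ in }\Omega,\qquad \nu\cdot Du=0\ \text{ on }\partial\Omega,$$ where $G$ is the limit operator defined in the context.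
   Context: $\mathcal{S}(k)$ is the space of real symmetric $k\times k$ matrices with the semidefinite order. For compact $K\subset\mathbb{R}^j$, $C^i(K,\mathbb{R}^k)$ denotes restrictions to $K$ of $C^i$ functions on $\mathbb{R}^j$. For $\varepsilon>0$: $\Omega_\varepsilon=\{(x,y)\in\Omega\times\mathbb{R}: \varepsilon g^-(x)<y<\varepsilon g^+(x)\}$, $\partial_{\mathrm T}\Omega_\varepsilon=\{(x,y): x\in\overline\Omega,\ y=\varepsilon g^+(x)\}$, $\partial_{\mathrm B}\Omega_\varepsilon=\{(x,y): x\in\overline\Omega,\ y=\varepsilon g^-(x)\}$, $\partial_{\mathrm L}\Omega_\varepsilon=\{(x,y): x\in\partial\Omega,\ \varepsilon g^-(x)\le y\le\varepsilon g^+(x)\}$. Only small $\varepsilon$ matter, so that $\overline{\Omega_\varepsilon}\subset\overline\Omega\times[-1,1]$, $1-\varepsilon Dg^+\cdot\gamma_1^+>0$ on $\partial_{\mathrm T}\Omega_\varepsilon$ and $1+\varepsilon Dg^-\cdot\gamma_1^->0$ on $\partial_{\mathrm B}\Omega_\varepsilon$. Under the stated hypotheses, the elements of $S_\varepsilon$ are bounded uniformly for all small $\varepsilon$ and $S_\varepsilon\neq\emptyset$, so $u^\pm$ are bounded functions on $\overline\Omega$. Limit operator. Vectors are row vectors; $D\gamma_o$ is the matrix with $(i,j)$ entry $\partial(\gamma_o)_i/\partial x_j$; $D\beta_o$ is the row vector with entries $\partial\beta_o/\partial x_i$. Put $$b=\gamma_o(D\gamma_o)^{T}-\frac{g^+k^++g^-k^-}{g^+-g^-},\qquad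 c=-\gamma_o\cdot D\beta_o+\frac{g^+l^++g^-l^-}{g^+-g^-},$$ and for $(X,p,r,x)\in\mathcal{S}(N)\times\mathbb{R}^N\times\mathbb{R}\times\overline\Omega$ $$G(X,p,r,x)=F\big(A+B+C,\ (p,\beta_o(x)-\gamma_o(x)\cdot p),\ r,\ x,\ 0\big),$$ $$A=\begin{pmatrix}X&-X\gamma_o^{T}\\-\gamma_oX&\gamma_oX\gamma_o^{T}\end{pmatrix},\quad B=\begin{pmatrix}0&-(pD\gamma_o)^{T}\\-pD\gamma_o&b\cdot p\end{pmatrix},\quad C=\begin{pmatrix}0&(D\beta_o)^{T}\\ D\beta_o&c\end{pmatrix},$$ with all functions evaluated at $x$. Viscosity solutions on $\overline{\Omega_\varepsilon}$. A bounded function $u$ on $\overline{\Omega_\varepsilon}$ is a viscosity subsolution if, with $v$ its upper semicontinuous envelope on $\overline{\Omega_\varepsilon}$, whenever $\phi\in C^2(\overline{\Omega_\varepsilon})$ and $v-\phi$ attains its maximum over $\overline{\Omega_\varepsilon}$ at $\hat z$, at least one of the following holds: (a) $F(D^2\phi(\hat z),D\phi(\hat z),v(\hat z),\hat z)\le0$; (b) $\hat z=(\hat x,\hat y)\in\partial_{\mathrm L}\Omega_\varepsilon$ and $\nu(\hat x)\cdot D_x\phi(\hat z)\le0$; (c) $\hat z\in\partial_{\mathrm T}\Omega_\varepsilon$ and $\gamma^+(\hat z)\cdot D\phi(\hat z)\le\beta^+(\hat z)$; (d) $\hat z\in\partial_{\mathrm B}\Omega_\varepsilon$ and $\gamma^-(\hat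 z)\cdot D\phi(\hat z)\le\beta^-(\hat z)$. Viscosity supersolutions: replace maximum by minimum, $\le$ by $\ge$, upper by lower semicontinuous envelope. A viscosity solution is a bounded function that is both (continuity is not required). Viscosity sub/supersolutions of the limit problem. A bounded function $u$ on $\overline\Omega$ is a viscosity subsolution if, with $v$ its upper semicontinuous envelope on $\overline\Omega$, whenever $\phi\in C^2(\overline\Omega)$ and $v-\phi$ attains its maximum over $\overline\Omega$ at $\hat x$, one has $G(D^2\phi(\hat x),D\phi(\hat x),v(\hat x),\hat x)\le0$, or else $\hat x\in\partial\Omega$ and $\nu(\hat x)\cdot D\phi(\hat x)\le0$. Supersolutions are defined symmetrically (minimum, $\ge$, lower semicontinuous envelope). *)

(* Defs.v *)
From mathcomp Require Export all_boot all_order all_algebra.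
From mathcomp Require Export all_classical all_reals all_analysis.

Set Implicit Arguments.
Unset Strict Implicit.
Unset Printing Implicit Defensive.

Export Order.TTheory GRing.Theory Num.Theory.
Export numFieldNormedType.Exports.

#[global] Open Scope classical_set_scope.
#[global] Open Scope ring_scope.

Section Euclidean.
Context {R : realType}.

Definition dot n (u v : 'rV[R]_n) : R := (u *m v^T) 0 0.

(* The library norm on 'rV[R]_n is the max norm; this is the Euclidean one. *)
Definition enorm n (u : 'rV[R]_n) : R := Num.sqrt (dot u u).

(* [mxge X Y] is X >= Y in the semidefinite order. *)
Definition mxge n (X Y : 'M[R]_n) : Prop :=
  forall v : 'rV[R]_n, 0 <= dot (v *m (X - Y)) v.

Definition pderiv n (i : 'I_n) (f : 'rV[R]_n -> R) (x : 'rV[R]_n) : R :=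
  'D_(delta_mx 0 i) f x.

Definition grad n (f : 'rV[R]_n -> R) (x : 'rV[R]_n) : 'rV[R]_n :=
  \row_i pderiv i f x.

Definition hess n (f : 'rV[R]_n -> R) (x : 'rV[R]_n) : 'M[R]_n :=
  \matrix_(i, j) pderiv i (pderiv j f) x.

Definition Dmx m n (f : 'rV[R]_n -> 'rV[R]_m) (x : 'rV[R]_n) : 'M[R]_(m, n) :=
  \matrix_(i, j) pderiv j (fun z => f z 0 i) x.

(* An element of C^i(K), i = 1, 2, is the restriction to K of a C^i function
   on the whole space, so it is always given below by such a function.  The
   sets K that occur are closures of open sets, hence the derivatives on K do
   not depend on the function chosen. *)
Definition C1 n (f : 'rV[R]_n -> R) : Prop :=
  (forall x, differentiable f x) /\ forall i, continuous (pderiv i f).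

Definition C2 n (f : 'rV[R]_n -> R) : Prop :=
  (forall x, differentiable f x) /\ forall i, C1 (pderiv i f).

Definition C1vec m n (f : 'rV[R]_n -> 'rV[R]_m) : Prop :=
  forall i, C1 (fun x => f x 0 i).

Definition bdry n (A : set 'rV[R]_n) : set 'rV[R]_n := closure A `\` A°.

(* [psi] is a local C^1 defining function: near [x], the set is {psi < 0}. *)
Definition C1_defining n (Omega : set 'rV[R]_n) (x : 'rV[R]_n)
    (psi : 'rV[R]_n -> R) : Prop :=
  [/\ C1 psi, grad psi x != 0 & \forall z \near x, Omega z <-> psi z < 0].

Definition C1_boundary n (Omega : set 'rV[R]_n) : Prop :=
  forall x, bdry Omega x -> exists psi, C1_defining Omega x psi.

Definition outward_unit_normal n (Omega : set 'rV[R]_n)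
    (nu : 'rV[R]_n -> 'rV[R]_n) : Prop :=
  forall x, bdry Omega x -> exists2 psi, C1_defining Omega x psi &
    nu x = (enorm (grad psi x))^-1 *: grad psi x.

(* f x y = f0 x + y k(x) + o(|y|) as y -> 0, uniformly in x \in K *)
Definition unif_expansion n (V : normedModType R) (K : set 'rV[R]_n)
    (f : 'rV[R]_n -> R -> V) (f0 k : 'rV[R]_n -> V) : Prop :=
  forall e : R, 0 < e -> \forall y \near (0 : R), forall x, K x ->
    `|f x y - (f0 x + y *: k x)| <= e * `|y|.

End Euclidean.

Section Viscosity.
Context {R : realType}.

(* Semicontinuous envelopes on K; the neighbourhoods are not punctured. *)
Definition usc_env n (K : set 'rV[R]_n) (u : 'rV[R]_n -> R) (z : 'rV[R]_n) : R :=
  fine (limf_esup (fun w => (u w)%:E) (within K (nbhs z))).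

Definition lsc_env n (K : set 'rV[R]_n) (u : 'rV[R]_n -> R) (z : 'rV[R]_n) : R :=
  fine (limf_einf (fun w => (u w)%:E) (within K (nbhs z))).

(* [E X p r z] is the disjunction of the equation and of the boundary
   inequalities that apply at z, in terms of the second and first derivatives
   of the test function and the value of the envelope. *)
Definition visc_sub n (K : set 'rV[R]_n)
    (E : 'M[R]_n -> 'rV[R]_n -> R -> 'rV[R]_n -> Prop)
    (u : 'rV[R]_n -> R) : Prop :=
  [bounded u z | z in K] /\
  forall (phi : 'rV[R]_n -> R) (z : 'rV[R]_n), C2 phi -> K z ->
    (forall w, K w -> usc_env K u w - phi w <= usc_env K u z - phi z) ->
    E (hess phi z) (grad phi z) (usc_env K u z) z.

Definition visc_super n (K : set 'rV[R]_n)
    (E : 'M[R]_n -> 'rV[R]_n -> R -> 'rV[R]_n -> Prop)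
    (u : 'rV[R]_n -> R) : Prop :=
  [bounded u z | z in K] /\
  forall (phi : 'rV[R]_n -> R) (z : 'rV[R]_n), C2 phi -> K z ->
    (forall w, K w -> lsc_env K u z - phi z <= lsc_env K u w - phi w) ->
    E (hess phi z) (grad phi z) (lsc_env K u z) z.

End Viscosity.

Section ThinDomain.
Context {R : realType} {N : nat}.

(* A point (x, y) of R^N x R is the row vector [row_mx x y%:M]. *)
Definition xpart (z : 'rV[R]_(N + 1)) : 'rV[R]_N := lsubmx z.
Definition ypart (z : 'rV[R]_(N + 1)) : R := rsubmx z 0 0.

Definition thin (Omega : set 'rV[R]_N) (gp gm : 'rV[R]_N -> R) (eps : R) :
    set 'rV[R]_(N + 1) :=
  [set z | Omega (xpart z) /\
           eps * gm (xpart z) < ypart z < eps * gp (xpart z)].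

Definition thinT (Omega : set 'rV[R]_N) (gp : 'rV[R]_N -> R) (eps : R) :
    set 'rV[R]_(N + 1) :=
  [set z | closure Omega (xpart z) /\ ypart z = eps * gp (xpart z)].

Definition thinB (Omega : set 'rV[R]_N) (gm : 'rV[R]_N -> R) (eps : R) :
    set 'rV[R]_(N + 1) :=
  [set z | closure Omega (xpart z) /\ ypart z = eps * gm (xpart z)].

Definition thinL (Omega : set 'rV[R]_N) (gp gm : 'rV[R]_N -> R) (eps : R) :
    set 'rV[R]_(N + 1) :=
  [set z | bdry Omega (xpart z) /\
           eps * gm (xpart z) <= ypart z <= eps * gp (xpart z)].

Variables (Omega : set 'rV[R]_N) (nu : 'rV[R]_N -> 'rV[R]_N).
Variables (gp gm : 'rV[R]_N -> R).
Variable F : 'M[R]_(N + 1) -> 'rV[R]_(N + 1) -> R -> 'rV[R]_N -> R -> R.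
Variables (g1p g1m : 'rV[R]_N -> R -> 'rV[R]_N) (bp bm : 'rV[R]_N -> R -> R).

Definition gammap (z : 'rV[R]_(N + 1)) : 'rV[R]_(N + 1) :=
  row_mx (g1p (xpart z) (ypart z)) 1%:M.

Definition gammam (z : 'rV[R]_(N + 1)) : 'rV[R]_(N + 1) :=
  row_mx (g1m (xpart z) (ypart z)) (-1)%:M.

Definition thin_le (eps : R) (X : 'M[R]_(N + 1)) (p : 'rV[R]_(N + 1)) (r : R)
    (z : 'rV[R]_(N + 1)) : Prop :=
  [\/ F X p r (xpart z) (ypart z) <= 0,
      thinL Omega gp gm eps z /\ dot (nu (xpart z)) (xpart p) <= 0,
      thinT Omega gp eps z /\ dot (gammap z) p <= bp (xpart z) (ypart z) |
      thinB Omega gm eps z /\ dot (gammam z) p <= bm (xpart z) (ypart z)].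

Definition thin_ge (eps : R) (X : 'M[R]_(N + 1)) (p : 'rV[R]_(N + 1)) (r : R)
    (z : 'rV[R]_(N + 1)) : Prop :=
  [\/ F X p r (xpart z) (ypart z) >= 0,
      thinL Omega gp gm eps z /\ dot (nu (xpart z)) (xpart p) >= 0,
      thinT Omega gp eps z /\ dot (gammap z) p >= bp (xpart z) (ypart z) |
      thinB Omega gm eps z /\ dot (gammam z) p >= bm (xpart z) (ypart z)].

(* S_eps; only the values of its elements on the closure matter. *)
Definition thin_solutions (eps : R) : set ('rV[R]_(N + 1) -> R) :=
  [set u | visc_sub (closure (thin Omega gp gm eps)) (thin_le eps) u /\
           visc_super (closure (thin Omega gp gm eps)) (thin_ge eps) u].

Definition relaxed_values (x : 'rV[R]_N) (r : R) : set (\bar R) :=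
  [set t | exists eps u z,
    [/\ 0 < eps < r, thin_solutions eps u, closure (thin Omega gp gm eps) z,
        enorm (xpart z - x) < r & t = (u z)%:E]].

(* The half relaxed limits are extended real: a priori they may be infinite. *)
Definition upper_relaxed (x : 'rV[R]_N) : \bar R :=
  lim (ereal_sup (relaxed_values x r) @[r --> 0^'+]).

Definition lower_relaxed (x : 'rV[R]_N) : \bar R :=
  lim (ereal_inf (relaxed_values x r) @[r --> 0^'+]).

Variables (g0 : 'rV[R]_N -> 'rV[R]_N) (b0 : 'rV[R]_N -> R).
Variables (kp km : 'rV[R]_N -> 'rV[R]_N) (lp lm : 'rV[R]_N -> R).

Definition limit_b (x : 'rV[R]_N) : 'rV[R]_N :=
  g0 x *m (Dmx g0 x)^T
  - (gp x - gm x)^-1 *: (gp x *: kp x + gm x *: km x).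

Definition limit_c (x : 'rV[R]_N) : R :=
  - dot (g0 x) (grad b0 x) + (gp x * lp x + gm x * lm x) / (gp x - gm x).

Definition limit_A (X : 'M[R]_N) (x : 'rV[R]_N) : 'M[R]_(N + 1) :=
  block_mx X                  (- (X *m (g0 x)^T))
           (- (g0 x *m X))    (g0 x *m X *m (g0 x)^T).

Definition limit_B (p x : 'rV[R]_N) : 'M[R]_(N + 1) :=
  block_mx 0                    (- (p *m Dmx g0 x)^T)
           (- (p *m Dmx g0 x))  (dot (limit_b x) p)%:M.

Definition limit_C (x : 'rV[R]_N) : 'M[R]_(N + 1) :=
  block_mx 0            (grad b0 x)^T
           (grad b0 x)  (limit_c x)%:M.

Definition limit_G (X : 'M[R]_N) (p : 'rV[R]_N) (r : R) (x : 'rV[R]_N) : R :=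
  F (limit_A X x + limit_B p x + limit_C x)
    (row_mx p (b0 x - dot (g0 x) p)%:M) r x 0.

Definition limit_le (X : 'M[R]_N) (p : 'rV[R]_N) (r : R) (x : 'rV[R]_N) : Prop :=
  limit_G X p r x <= 0 \/ (bdry Omega x /\ dot (nu x) p <= 0).

Definition limit_ge (X : 'M[R]_N) (p : 'rV[R]_N) (r : R) (x : 'rV[R]_N) : Prop :=
  limit_G X p r x >= 0 \/ (bdry Omega x /\ dot (nu x) p >= 0).

End ThinDomain.

(* Main.v *)
Require Import Defs.
From mathcomp Require Import ring lra.

(** Perturbed test functions.  Write q = b0 - g0 . D phi.  At y = 0 both oblique
    conditions ask a function with horizontal gradient D phi to have the
    derivative q in y, so near the base a thin solution looks like
      phi (x) + y q (x) + m y^2 / 2,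
    whose Hessian at y = 0 has the blocks D^2 phi, D q and m.  The block D q is
    the off-diagonal block of A + B + C ([flux_grad]).  A further term e s y
    leaves the Hessian unchanged and enters the boundary conditions at order e,
    where the expansions of the data turn the reverse inequalities on the top
    and on the bottom into
      g+ (g0 . D q + k+ . D phi - l+ + m) + s > 0,
      g- (- g0 . D q + k- . D phi - l- - m) - s > 0.
    Some s satisfies both as soon as m exceeds the lower right entry of
    A + B + C ([slope_exists], [limit_yyE]): this is where the drift b and the
    constant c come from.

    Suppose that the upper relaxed limit minus phi is maximal at a point where
    the limit inequality fails.  With m slightly above that entry, the perturbed
    test function violates all four alternatives of the thin problem near the
    point when e is small ([tester_fails]), although thin solutions are
    subsolutions and their envelopes minus the test function have maxima there.
    One difficulty is that q is only of class C^1.  The product y q (x) is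
    replaced by y (q (xi) + D q (xi) . (x - xi)) + tau |x - xi|^2 and the maximum
    is taken over xi as well.  Comparison with xi = x shows |x - xi| = o(e), and
    then the linearization error is o(e) in the oblique conditions
    ([localization]).

    The relaxed limits are finite because thin solutions exist and are bounded
    uniformly in e.  The bounds come from comparison with barriers, a compact
    family of quadratic polynomials, each of which has to satisfy the boundary
    conditions only where it is minimal in the family ([barrier_strict]); this
    avoids any smoothing of the C^1 boundary and data.  Reflected barriers give
    a subsolution ([sub_exists]).  As solutions may be discontinuous, the
    supremum of all subsolutions is itself one, by Perron's method
    ([perron_solution]).

    Supersolutions are reduced to subsolutions by the reflection of u into -u
    ([flip], [visc_super_flip]). *)

Set Implicit Arguments.
Unset Strict Implicit.
Unset Printing Implicit Defensive.

(** * Euclidean products and entrywise convergence *)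

Section Dot.
Context {R : realType}.
Implicit Types n : nat.

Lemma dotE n (u v : 'rV[R]_n) : dot u v = \sum_i u 0 i * v 0 i.
Proof. by rewrite /dot mxE; apply: eq_bigr => i _; rewrite mxE. Qed.

Lemma dotC n (u v : 'rV[R]_n) : dot u v = dot v u.
Proof. by rewrite !dotE; apply: eq_bigr => i _; rewrite mulrC. Qed.

Lemma dotDl n (u v w : 'rV[R]_n) : dot (u + v) w = dot u w + dot v w.
Proof. by rewrite /dot mulmxDl mxE. Qed.

Lemma dotZl n (a : R) (u w : 'rV[R]_n) : dot (a *: u) w = a * dot u w.
Proof. by rewrite /dot -scalemxAl mxE. Qed.

Lemma dotNl n (u w : 'rV[R]_n) : dot (- u) w = - dot u w.
Proof. by rewrite /dot mulNmx mxE. Qed.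

Lemma dotDr n (u v w : 'rV[R]_n) : dot w (u + v) = dot w u + dot w v.
Proof. by rewrite dotC dotDl !(dotC w). Qed.

Lemma dotZr n (a : R) (u w : 'rV[R]_n) : dot w (a *: u) = a * dot w u.
Proof. by rewrite dotC dotZl dotC. Qed.

Lemma dotNr n (u w : 'rV[R]_n) : dot w (- u) = - dot w u.
Proof. by rewrite dotC dotNl dotC. Qed.

Lemma dotBl n (u v w : 'rV[R]_n) : dot (u - v) w = dot u w - dot v w.
Proof. by rewrite dotDl dotNl. Qed.

Lemma dotBr n (u v w : 'rV[R]_n) : dot w (u - v) = dot w u - dot w v.
Proof. by rewrite dotDr dotNr. Qed.

Lemma dot0l n (w : 'rV[R]_n) : dot 0 w = 0.
Proof. by rewrite /dot mul0mx mxE. Qed.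

Lemma dot0r n (w : 'rV[R]_n) : dot w 0 = 0.
Proof. by rewrite dotC dot0l. Qed.

Definition dot_lin := (dotDl, dotDr, dotNl, dotNr, dotZl, dotZr, dot0l, dot0r).

Lemma dot_mulmx m n (u : 'rV[R]_m) (A : 'M[R]_(m, n)) (v : 'rV[R]_n) :
  dot (u *m A) v = dot u (v *m A^T).
Proof. by rewrite /dot trmx_mul trmxK mulmxA. Qed.

Lemma dot_row_mx m (u v : 'rV[R]_m) (a b : R) :
  dot (row_mx u a%:M) (row_mx v b%:M) = dot u v + a * b.
Proof.
by rewrite /dot tr_row_mx mul_row_col mxE; congr (_ + _);
  rewrite mxE big_ord1 !mxE eqxx !mulr1n.
Qed.

Lemma dot_delta n (u : 'rV[R]_n) i : dot u (delta_mx 0 i) = u 0 i.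
Proof.
rewrite dotE (bigD1 i) //= big1 ?addr0 => [|j /negPf ji].
  by rewrite mxE !eqxx mulr1.
by rewrite mxE ji andbF mulr0.
Qed.

Lemma coord_le_norm m n (A : 'M[R]_(m, n)) i j : `|A i j| <= `|A|.
Proof.
by rewrite [leRHS]/Num.norm /= mx_normrE; apply/bigmax_geP; right; exists (i, j).
Qed.

Lemma norm_le_coord m n (A : 'M[R]_(m, n)) (c : R) : 0 <= c ->
  (forall i j, `|A i j| <= c) -> `|A| <= c.
Proof.
move=> c0 Ac; rewrite /Num.norm /= mx_normrE; apply/bigmax_leP; split => //.
Qed.

Lemma dot_ge0 n (u : 'rV[R]_n) : 0 <= dot u u.
Proof. by rewrite dotE; apply: sumr_ge0 => i _; rewrite -expr2 sqr_ge0. Qed.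

Lemma norm_sq_le_dot n (u : 'rV[R]_n) : `|u| ^+ 2 <= dot u u.
Proof.
suff: `|u| <= Num.sqrt (dot u u).
  by move=> h; rewrite -[leRHS]sqr_sqrtr ?dot_ge0// lerXn2r ?nnegrE ?sqrtr_ge0.
apply: norm_le_coord; rewrite ?sqrtr_ge0// => i j; rewrite (ord1 i).
rewrite -sqrtr_sqr ler_wsqrtr// dotE (bigD1 j)//= expr2 lerDl.
by apply: sumr_ge0 => k _; rewrite -expr2 sqr_ge0.
Qed.

Lemma dot_le_norm n (u v : 'rV[R]_n) : `|dot u v| <= n%:R * (`|u| * `|v|).
Proof.
rewrite dotE; apply: le_trans (ler_norm_sum _ _ _) _.
apply: (@le_trans _ _ (\sum_(i < n) `|u| * `|v|)).
  by apply: ler_sum => i _; rewrite normrM ler_pM// coord_le_norm.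
by rewrite sumr_const card_ord mulr_natl.
Qed.

Lemma dot_eq0 n (u : 'rV[R]_n) : dot u u = 0 -> u = 0.
Proof.
move=> u0; apply/eqP; rewrite -normr_eq0 -sqrf_eq0 eq_le sqr_ge0 andbT -u0.
exact: norm_sq_le_dot.
Qed.

Lemma dot_gt0 n (u : 'rV[R]_n) : u != 0 -> 0 < dot u u.
Proof.
by move=> u0; rewrite lt_def dot_ge0 andbT; apply: contra u0 => /eqP/dot_eq0 ->.
Qed.

Lemma enorm_ge0 n (u : 'rV[R]_n) : 0 <= enorm u.
Proof. exact: sqrtr_ge0. Qed.

Lemma enorm_sq n (u : 'rV[R]_n) : enorm u ^+ 2 = dot u u.
Proof. by rewrite sqr_sqrtr ?dot_ge0. Qed.

Lemma norm_le_enorm n (u : 'rV[R]_n) : `|u| <= enorm u.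
Proof.
by rewrite -(@ler_pXn2r _ 2) ?nnegrE ?enorm_ge0// enorm_sq norm_sq_le_dot.
Qed.

Lemma enorm_le_norm n (u : 'rV[R]_n) : enorm u <= n%:R * `|u|.
Proof.
rewrite -(@ler_pXn2r _ 2) ?nnegrE ?enorm_ge0 ?mulr_ge0//.
rewrite enorm_sq; apply: le_trans (ler_norm _) _.
apply: le_trans (dot_le_norm _ _) _.
rewrite exprMn expr2 -expr2 ler_wpM2r ?sqr_ge0//.
by rewrite -natrM ler_nat; case: n u => // k _; rewrite leq_pmulr.
Qed.

End Dot.

Section MatrixCvg.
Context {R : realType} {I : Type}.

Lemma cvg_mxP m n (G : set_system I) {FG : Filter G} (A : I -> 'M[R]_(m, n)) (B : 'M[R]_(m, n)) :
  (forall i j, A t i j @[t --> G] --> B i j) -> A @ G --> B.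
Proof.
move=> h; apply/cvgrPdist_le => e e0.
have : \forall t \near G, forall p : 'I_m * 'I_n, `|B p.1 p.2 - A t p.1 p.2| <= e.
  apply: filter_forall => -[i j] /=.
  by move/cvgrPdist_le : (h i j) => /(_ _ e0).
apply: filterS => t ht; apply: norm_le_coord; first exact: ltW.
by move=> i j; rewrite !mxE; exact: (ht (i, j)).
Qed.

Lemma cvg_coord m n (G : set_system I) {FG : Filter G} (A : I -> 'M[R]_(m, n)) (B : 'M[R]_(m, n)) i j :
  A @ G --> B -> A t i j @[t --> G] --> B i j.
Proof.
move=> /cvgrPdist_lt h; apply/cvgrPdist_lt => e /h; apply: filterS => t.
by apply: le_lt_trans; have := coord_le_norm (B - A t) i j; rewrite !mxE.
Qed.

Lemma cvg_sum_ord (G : set_system I) {FG : Filter G} n (f : 'I_n -> I -> R) (a : 'I_n -> R) :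
  (forall i, f i t @[t --> G] --> a i) ->
  \sum_i f i t @[t --> G] --> \sum_i a i.
Proof.
move=> h; apply: cvg_big => //; first by move=> /= x; apply: add_continuous.
Qed.

Lemma cvg_mulmx m n p (G : set_system I) {FG : Filter G}
    (A : I -> 'M[R]_(m, n)) (B : I -> 'M[R]_(n, p)) (A0 : 'M[R]_(m, n)) (B0 : 'M[R]_(n, p)) :
  A @ G --> A0 -> B @ G --> B0 -> A t *m B t @[t --> G] --> A0 *m B0.
Proof.
move=> hA hB; apply: cvg_mxP => i j; rewrite mxE.
under eq_fun do rewrite mxE.
by apply: cvg_sum_ord => k; apply: cvgM; exact: cvg_coord.
Qed.

Lemma cvg_trmx m n (G : set_system I) {FG : Filter G} (A : I -> 'M[R]_(m, n)) (A0 : 'M[R]_(m, n)) :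
  A @ G --> A0 -> (A t)^T @[t --> G] --> A0^T.
Proof.
move=> hA; apply: cvg_mxP => i j; rewrite mxE.
by under eq_fun do rewrite mxE; exact: cvg_coord.
Qed.

Lemma cvg_dot n (G : set_system I) {FG : Filter G} (u v : I -> 'rV[R]_n) (u0 v0 : 'rV[R]_n) :
  u @ G --> u0 -> v @ G --> v0 -> dot (u t) (v t) @[t --> G] --> dot u0 v0.
Proof.
by move=> hu hv; apply: cvg_coord; apply: cvg_mulmx => //; exact: cvg_trmx.
Qed.

Lemma cvg_row_mx m n p (G : set_system I) {FG : Filter G}
    (A : I -> 'M[R]_(m, n)) (B : I -> 'M[R]_(m, p)) (A0 : 'M[R]_(m, n)) (B0 : 'M[R]_(m, p)) :
  A @ G --> A0 -> B @ G --> B0 -> row_mx (A t) (B t) @[t --> G] --> row_mx A0 B0.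
Proof.
move=> hA hB; apply: cvg_mxP => i j; rewrite -(splitK j).
case: (fintype.split j) => k /=; rewrite ?row_mxEl ?row_mxEr.
  by under eq_fun do rewrite row_mxEl; exact: cvg_coord.
by under eq_fun do rewrite row_mxEr; exact: cvg_coord.
Qed.

Lemma cvg_col_mx m n p (G : set_system I) {FG : Filter G}
    (A : I -> 'M[R]_(m, n)) (B : I -> 'M[R]_(p, n)) (A0 : 'M[R]_(m, n)) (B0 : 'M[R]_(p, n)) :
  A @ G --> A0 -> B @ G --> B0 -> col_mx (A t) (B t) @[t --> G] --> col_mx A0 B0.
Proof.
move=> hA hB; apply: cvg_mxP => i j; rewrite -(splitK i).
case: (fintype.split i) => k /=; rewrite ?col_mxEu ?col_mxEd.
  by under eq_fun do rewrite col_mxEu; exact: cvg_coord.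
by under eq_fun do rewrite col_mxEd; exact: cvg_coord.
Qed.

Lemma cvg_block_mx m n p q (G : set_system I) {FG : Filter G}
    (A : I -> 'M[R]_(m, n)) (B : I -> 'M[R]_(m, p))
    (C : I -> 'M[R]_(q, n)) (D : I -> 'M[R]_(q, p))
    (A0 : 'M[R]_(m, n)) (B0 : 'M[R]_(m, p))
    (C0 : 'M[R]_(q, n)) (D0 : 'M[R]_(q, p)) :
  A @ G --> A0 -> B @ G --> B0 -> C @ G --> C0 -> D @ G --> D0 ->
  block_mx (A t) (B t) (C t) (D t) @[t --> G] --> block_mx A0 B0 C0 D0.
Proof.
by move=> hA hB hC hD; apply: cvg_col_mx; exact: cvg_row_mx.
Qed.

Lemma cvg_scalar_mx n (G : set_system I) {FG : Filter G} (a : I -> R) (a0 : R) :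
  a @ G --> a0 -> ((a t)%:M : 'M[R]_n) @[t --> G] --> (a0%:M : 'M[R]_n).
Proof.
move=> ha; apply: cvg_mxP => i j; rewrite mxE.
under eq_fun do rewrite mxE.
by case: (i == j); rewrite ?mulr1n// ?mulr0n; exact: cvg_cst.
Qed.

End MatrixCvg.

(** * Differential calculus on row vectors *)

Section Calculus.
Context {R : realType}.
Implicit Types n : nat.

Lemma gradE n (f : 'rV[R]_n -> R) (x : 'rV[R]_n) j : grad f x 0 j = pderiv j f x.
Proof. by rewrite mxE. Qed.

Lemma hessE n (f : 'rV[R]_n -> R) (x : 'rV[R]_n) i j :
  hess f x i j = pderiv i (pderiv j f) x.
Proof. by rewrite mxE. Qed.

Lemma row_delta n (v : 'rV[R]_n) : v = \sum_i v 0 i *: delta_mx 0 i.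
Proof. by rewrite -row_sum_delta. Qed.

Lemma derive_grad n (f : 'rV[R]_n -> R) (x v : 'rV[R]_n) :
  differentiable f x -> 'D_v f x = dot (grad f x) v.
Proof.
move=> df; rewrite deriveE// {1}(row_delta v) linear_sum dotE.
by apply: eq_bigr => i _; rewrite linearZ /= gradE /pderiv deriveE// mulrC.
Qed.

Lemma cvg_quot n (f : 'rV[R]_n -> R) (x v : 'rV[R]_n) : differentiable f x ->
  (f (x + t *: v) - f x) / t @[t --> 0^'] --> dot (grad f x) v.
Proof.
move=> df; rewrite -derive_grad//.
have h : derivable f x v := diff_derivable df.
rewrite /derive; apply: cvg_trans h; apply: near_eq_cvg; near=> t.
by rewrite /= [t *: v + x]addrC mulrC.
Unshelve. all: end_near. Qed.

Lemma cvg_quot_right n (f : 'rV[R]_n -> R) (x v : 'rV[R]_n) : differentiable f x ->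
  (f (x + t *: v) - f x) / t @[t --> 0^'+] --> dot (grad f x) v.
Proof.
by move=> df; apply: cvg_dnbhs_at_right; exact: cvg_quot.
Qed.

Lemma dot_inj n (u w : 'rV[R]_n) : (forall v, dot u v = dot w v) -> u = w.
Proof. by move=> h; apply/rowP => i; have := h (delta_mx 0 i); rewrite !dot_delta. Qed.

Lemma grad_unique n (f : 'rV[R]_n -> R) (x g : 'rV[R]_n) : differentiable f x ->
  (forall v, (f (x + t *: v) - f x) / t @[t --> 0^'+] --> dot g v) ->
  grad f x = g.
Proof.
move=> df h; apply: dot_inj => v; exact: (norm_cvg_unique (cvg_quot_right df) (h v)).
Qed.

Lemma dir_deriv_le n (f : 'rV[R]_n -> R) (x v : 'rV[R]_n) : differentiable f x ->
  (\forall t \near 0^'+, f (x + t *: v) <= f x) -> dot (grad f x) v <= 0.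
Proof.
move=> df h; rewrite leNgt; apply/negP => gt0.
have {gt0} : \forall t \near 0^'+, 0 < (f (x + t *: v) - f x) / t.
  by apply: cvgr_gt gt0; exact: cvg_quot_right.
move=> /(filterI h)/(filterI (nbhs_right_gt 0))/filter_ex[t [t0 [le0 gt1]]].
by move: gt1; rewrite pmulr_lgt0 ?invr_gt0// subr_gt0 ltNge le0.
Qed.

Lemma is_derive_line n (f : 'rV[R]_n -> R) (x v : 'rV[R]_n) (t : R) :
  differentiable f (x + t *: v) ->
  is_derive t (1 : R) (fun t => f (x + t *: v)) (dot (grad f (x + t *: v)) v).
Proof.
move=> df.
have E : (fun h : R => h^-1 *: (((fun t => f (x + t *: v)) \o shift t) (h *: 1) - f (x + t *: v))) =
  (fun h : R => h^-1 *: ((f \o shift (x + t *: v)) (h *: v) - f (x + t *: v))).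
  by apply/funext => h /=; congr (_ *: (f _ - _)); rewrite [h *: 1]mulr1 scalerDl addrCA.
apply: DeriveDef; rewrite /derivable /derive E; first exact: diff_derivable.
by rewrite -derive_grad.
Qed.

Lemma mvt_line n (f : 'rV[R]_n -> R) (x v : 'rV[R]_n) : (forall x, differentiable f x) ->
  exists t : R, [/\ 0 < t, t < 1 & f (x + v) - f x = dot (grad f (x + t *: v)) v].
Proof.
move=> df.
have [] := @MVT R (fun t => f (x + t *: v)) (fun t => dot (grad f (x + t *: v)) v) 0 1.
- exact: ltr01.
- by move=> t _; exact: is_derive_line.
- apply: derivable_within_continuous => t _.
  by have [] := is_derive_line (df (x + t *: v)).
move=> t; rewrite in_itv /= => /andP[t0 t1].
by rewrite scale1r scale0r addr0 subr0 mulr1 => ?; exists t.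
Qed.

Lemma C1_continuous n (f : 'rV[R]_n -> R) : C1 f -> continuous f.
Proof. by move=> [df _] x; exact: differentiable_continuous. Qed.

Lemma continuous_matrix m n (T : topologicalType) (A : 'I_m -> 'I_n -> T -> R) :
  (forall i j, continuous (A i j)) -> continuous (fun x => \matrix_(i, j) A i j x).
Proof.
move=> h x; apply: (@cvg_mxP _ _ _ _ (nbhs x)) => i j; rewrite mxE.
by under eq_fun do rewrite mxE; exact: h.
Qed.

Lemma C1_grad_continuous n (f : 'rV[R]_n -> R) : C1 f -> continuous (grad f).
Proof. by move=> [_ h]; apply: continuous_matrix => _ j; exact: h. Qed.

Lemma C2_C1 n (f : 'rV[R]_n -> R) : C2 f -> C1 f.
Proof. by move=> [df h]; split => // i; apply: C1_continuous. Qed.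

Lemma C2_hess_continuous n (f : 'rV[R]_n -> R) : C2 f -> continuous (hess f).
Proof. by move=> [_ h]; apply: continuous_matrix => i j; case: (h j) => _; apply. Qed.

Lemma norm_segment n (x y c : 'rV[R]_n) (t d : R) : 0 <= t <= 1 ->
  `|x - c| < d -> `|y - c| < d -> `|y + t *: (x - y) - c| < d.
Proof.
move=> /andP[t0 t1] xd yd.
have -> : y + t *: (x - y) - c = (1 - t) *: (y - c) + t *: (x - c).
  by apply/rowP => i; rewrite !mxE; ring.
apply: le_lt_trans (ler_normD _ _) _; rewrite !normrZ ger0_norm ?subr_ge0//.
rewrite (ger0_norm t0); have [->|/eqP tn] := eqVneq t 0.
  by rewrite subr0 mul0r addr0 mul1r.
by nra.
Qed.

(** By the mean value theorem and the continuity of the gradient. That both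
    points may move is what later allows the base point of a linearization
    to vary. *)
Lemma C1_strict_diff n (f : 'rV[R]_n -> R) (x0 : 'rV[R]_n) (e : R) : C1 f -> 0 < e ->
  exists2 d : R, 0 < d & forall x y, `|x - x0| < d -> `|y - x0| < d ->
    `|f x - f y - dot (grad f y) (x - y)| <= e * `|x - y|.
Proof.
move=> fC1 e0; have gc := C1_grad_continuous fC1 (x := x0).
pose e1 := e / (n%:R + 1) / 2.
have n1 : 0 < n%:R + 1 :> R by rewrite ltr_wpDl.
have e10 : 0 < e1 by rewrite !divr_gt0.
have [d /= d0 hd] : \forall d \near 0^'+, forall x, `|x - x0| < d -> `|grad f x - grad f x0| < e1.
  move/cvgrPdist_lt : gc => /(_ _ e10) /nbhs_normP[d /= d0 hd].
  near=> d' => x xd; rewrite distrC; apply: hd; rewrite /= distrC.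
  by apply: lt_trans xd _; near: d'; exact: nbhs_right_lt.
have /= {}hd := hd (d / 2) _ _; exists (d / 2); first by rewrite divr_gt0.
move=> x y xd yd; have [t [t0 t1 E]] := mvt_line y (x - y) fC1.1.
rewrite [y + _]addrC subrK in E; rewrite E -dotBl.
apply: le_trans (dot_le_norm _ _) _; rewrite mulrA ler_wpM2r//.
set c := y + _; have cd : `|c - x0| < d / 2 by apply: norm_segment => //; rewrite !ltW.
have d2 : ball_ [eta Num.norm] 0 d (d / 2).
  by rewrite /= sub0r normrN gtr0_norm ?divr_gt0// ltr_pdivrMr// ltr_pMr// ltr1n.
have d20 : 0 < d / 2 by rewrite divr_gt0.
have h1 := hd d2 d20 _ cd; have h2 := hd d2 d20 _ yd.
have : `|grad f c - grad f y| <= 2 * e1.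
  rewrite -(subrKA (grad f x0)); apply: le_trans (ler_normD _ _) _.
  by rewrite (distrC (grad f x0)) mulr_natl mulr2n; apply: lerD; exact: ltW.
move=> h; apply: le_trans (ler_wpM2l _ h) _ => //.
rewrite /e1 mulrCA mulrCA; rewrite [2 * _]mulrC divfK// mulrCA ler_piMr ?ltW//.
by rewrite ltr_pdivrMr// mul1r ltrDl.
Unshelve. all: end_near. Qed.

Lemma compact_closed_ball n (B : R) : compact [set x : 'rV[R]_n | `|x| <= B].
Proof.
apply: bounded_closed_compact.
  by exists B; split; rewrite ?num_real// => M BM x /= /le_trans; apply; exact: ltW.
by apply: closed_comp (@closed_le R B) => x _; exact: norm_continuous.
Qed.

Lemma C1_lipschitz n (f : 'rV[R]_n -> R) (B : R) : C1 f ->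
  exists2 L : R, 0 <= L & forall x y, `|x| <= B -> `|y| <= B ->
    `|f x - f y| <= L * `|x - y|.
Proof.
move=> fC1; have cK := @compact_closed_ball n B.
have : compact [set grad f x | x in [set x : 'rV[R]_n | `|x| <= B]].
  apply: continuous_compact cK; apply: continuous_subspaceT.
  exact: C1_grad_continuous.
move=> /compact_bounded[M [_ hM]].
exists (n%:R * (`|M| + 1)); first by rewrite mulr_ge0// addr_ge0.
move=> x y xB yB; have [t [t0 t1 E]] := mvt_line y (x - y) fC1.1.
rewrite [y + _]addrC subrK in E; rewrite E; apply: le_trans (dot_le_norm _ _) _.
rewrite mulrA ler_wpM2r// ler_wpM2l//; apply: hM.
  by rewrite (le_lt_trans (ler_norm _))// ltrDl.
exists (y + t *: (x - y)) => //=.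
have -> : y + t *: (x - y) = (1 - t) *: y + t *: x.
  by apply/rowP => i; rewrite !mxE; ring.
apply: le_trans (ler_normD _ _) _; rewrite !normrZ !gtr0_norm ?subr_gt0//; nra.
Qed.

(** Two applications of the mean value theorem. The second difference is
    symmetric in i and j, whence the symmetry of the Hessian. *)
Lemma second_difference n (f : 'rV[R]_n -> R) (x : 'rV[R]_n) (i j : 'I_n) (h : R) :
  C2 f -> 0 < h -> exists y, `|y - x| <= 2 * h /\
   pderiv i (pderiv j f) y =
   (f (x + h *: delta_mx 0 i + h *: delta_mx 0 j) - f (x + h *: delta_mx 0 i) -
   (f (x + h *: delta_mx 0 j) - f x)) / (h * h).
Proof.
move=> [df fC2] h0; set ei := delta_mx 0 i; set ej := delta_mx 0 j.
have dfi : forall y, differentiable (fun z => f (z + h *: ei)) y.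
  move=> y; apply: (differentiable_comp (f := fun z => z + h *: ei)) => //.
have dg : forall y, differentiable (fun z => f (z + h *: ei) - f z) y.
  by move=> y; apply: differentiableB.
have [t [t0 t1 E]] := mvt_line x (h *: ej) dg.
have [s [s0 s1 E2]] := mvt_line (x + t *: (h *: ej)) (h *: ei) (fC2 j).1.
have D y : dot (grad (fun z => f (z + h *: ei) - f z) y) ej =
    pderiv j f (y + h *: ei) - pderiv j f y.
  rewrite dot_delta gradE /pderiv deriveB; try exact: diff_derivable.
  congr (_ - _); rewrite /derive.
  by under eq_fun do rewrite /= -addrA.
exists (x + t *: (h *: ej) + s *: (h *: ei)); split.
  rewrite -(addrA x) [x + _]addrC addrK.
  have nd k : `|delta_mx 0 k : 'rV[R]_n| <= 1.
    apply: norm_le_coord => // a b; rewrite mxE; case: (_ && _); rewrite ?normr1 ?normr0//.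
  apply: le_trans (ler_normD _ _) _; rewrite !normrZ !gtr0_norm// mulr_natl mulr2n.
  have ah k (a : R) : 0 < a -> a < 1 -> a * (h * `|delta_mx 0 k : 'rV[R]_n|) <= h.
    move=> a0 a1; rewrite -[leRHS]mul1r -[X in _ <= _ * X]mulr1.
    by apply: ler_pM; rewrite ?mulr_ge0 ?(ltW a0) ?(ltW a1) ?(ltW h0)// ler_pM2l.
  by apply: lerD; apply: ah.
move: E; rewrite dotZr D (addrAC _ _ (h *: ei)).
rewrite E2 dotZr -/ei dot_delta gradE => E.
have hh : h * h != 0 by rewrite mulf_neq0// gt_eqF.
apply: (mulIf hh); rewrite divfK// -/ei.
move: E; move: (pderiv i _ _) => a.
move: (f _) (f _) (f _) (f _) => b1 b2 b3 b4; clear => E.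
rewrite mulrC -mulrA -E; ring.
Qed.

Lemma eq_of_near_values n (A B : 'rV[R]_n -> R) (x : 'rV[R]_n) :
  {for x, continuous A} -> {for x, continuous B} ->
  (forall h : R, 0 < h -> exists y w,
     [/\ `|y - x| <= 2 * h, `|w - x| <= 2 * h & A y = B w]) ->
  A x = B x.
Proof.
move=> cA cB hAB; apply/eqP; rewrite -subr_eq0 -normr_le0.
apply/ler_addgt0Pl => /= e e0; rewrite addr0.
have e20 : 0 < e / 2 by rewrite divr_gt0.
move/cvgrPdist_lt : cA => /(_ _ e20) hA; move/cvgrPdist_lt : cB => /(_ _ e20) hB.
have : \forall t \near x, `|A x - A t| < e / 2 /\ `|B x - B t| < e / 2.
  exact: filterI hA hB.
move=> /nbhs_normP[d /= d0 hd].
have h0 : 0 < d / 4 by rewrite divr_gt0.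
have [y [w [yd wd E]]] := hAB _ h0.
have close u : `|u - x| <= 2 * (d / 4) -> ball_ Num.norm x d u.
  by move=> ux; rewrite /= distrC; apply: le_lt_trans ux _; clear -d0; lra.
have [h1 _] := hd _ (close _ yd); have [_ h2] := hd _ (close _ wd).
rewrite -E distrC in h2; rewrite -(subrKA (A y)).
by apply: le_trans (ler_normD _ _) _; rewrite (splitr e) lerD// ltW.
Qed.

Lemma hess_sym n (f : 'rV[R]_n -> R) (x : 'rV[R]_n) : C2 f -> (hess f x)^T = hess f x.
Proof.
move=> fC2; apply/matrixP => j i; rewrite mxE !hessE.
apply: eq_of_near_values; [exact: (fC2.2 j).2|exact: (fC2.2 i).2|].
move=> h h0; have [y [yd Ey]] := second_difference x i j fC2 h0.
have [w [wd Ew]] := second_difference x j i fC2 h0.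
exists y, w; split; [exact: yd|exact: wd|rewrite Ey Ew; congr (_ / _)].
rewrite (addrAC x (h *: delta_mx 0 j)); move: (f _) (f _) (f _) (f _) => b1 b2 b3 b4.
by clear; ring.
Qed.

Lemma grad0_at_max n (f : 'rV[R]_n -> R) (z : 'rV[R]_n) : differentiable f z ->
  (\forall w \near z, f w <= f z) -> grad f z = 0.
Proof.
move=> df h; apply: dot_eq0; apply/eqP; rewrite eq_le dot_ge0 andbT.
apply: dir_deriv_le => //.
suff : (z + t *: grad f z) @[t --> 0^'+] --> z by move/(_ _ h).
rewrite -[X in _ --> X]addr0 -(scale0r (grad f z)).
apply: cvgD; first exact: cvg_cst.
by apply: cvgZr_tmp; exact: cvg_at_right_filter.
Qed.

(** Were the quadratic form positive along v, the directional derivative would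
    become positive along the ray from z, and f would exceed its maximum by
    the mean value theorem. *)
Lemma hess_le0_at_max n (f : 'rV[R]_n -> R) (z v : 'rV[R]_n) : C2 f ->
  (\forall w \near z, f w <= f z) -> dot (v *m hess f z) v <= 0.
Proof.
move=> fC2 h; have g0 := grad0_at_max (fC2.1 z) h.
rewrite leNgt; apply/negP => H0.
have : dot (grad f (z + t *: v)) v / t @[t --> 0^'+] --> dot (v *m hess f z) v.
  have -> : (fun t : R => dot (grad f (z + t *: v)) v / t) =
    (fun t => \sum_j ((pderiv j f (z + t *: v) - pderiv j f z) / t * v 0 j)).
    apply/funext => t; rewrite dotE mulr_suml; apply: eq_bigr => j _.
    have -> : pderiv j f z = 0 by rewrite -gradE g0 mxE.
    by rewrite gradE subr0 mulrAC.
  rewrite [dot (v *m _) v]dotE; apply: cvg_sum_ord => j; apply: cvgMr_tmp.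
  have -> : (v *m hess f z) 0 j = dot (grad (pderiv j f) z) v.
    by rewrite mxE dotE; apply: eq_bigr => i _; rewrite hessE gradE mulrC.
  by apply: cvg_quot_right; exact: (fC2.2 j).1.
move=> /cvgr_gt /(_ _ H0) [d /= d0 hd].
have : \forall t \near 0^'+, f (z + t *: v) <= f z.
  suff : (z + t *: v) @[t --> 0^'+] --> z by move/(_ _ h).
  rewrite -[X in _ --> X]addr0 -(scale0r v).
  apply: cvgD; first exact: cvg_cst.
  by apply: cvgZr_tmp; exact: cvg_at_right_filter.
move=> [d' /= d'0 hd'].
pose t := Num.min d d' / 2.
have t0 : 0 < t by rewrite divr_gt0// lt_min d0.
have td : t < d by rewrite /t ltr_pdivrMr// gt_min ltr_pMr// ltr1n.
have td' : t < d' by rewrite /t ltr_pdivrMr// gt_min orbC ltr_pMr// ltr1n.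
have {hd'} := hd' t _ t0; rewrite /= sub0r normrN gtr0_norm// => /(_ td').
have [s [s0 s1]] := mvt_line z (t *: v) fC2.1.
rewrite dotZr scalerA => E; apply/negP; rewrite -ltNge -subr_gt0 E mulr_gt0//.
have st0 : 0 < s * t by rewrite mulr_gt0.
have := hd (s * t) _ st0; rewrite /= sub0r normrN gtr0_norm// pmulr_lgt0 ?invr_gt0//.
by apply; apply: le_lt_trans td; rewrite ler_piMl// ltW.
Qed.

End Calculus.

(** * Second order jets *)

Section Jets.
Context {R : realType}.
Implicit Types n : nat.

(** The gradient and Hessian fields are carried along with the function, so that
    the jets of the composite test functions below are read off from their
    parts. *)
Definition jet2 n (f : 'rV[R]_n -> R) (g : 'rV[R]_n -> 'rV[R]_n)
    (H : 'rV[R]_n -> 'M[R]_n) : Prop :=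
  [/\ C2 f, grad f = g & hess f = H].

Lemma addmxE m n (A B : 'M[R]_(m, n)) i j : (A + B) i j = A i j + B i j.
Proof. by rewrite mxE. Qed.

Section Continuous.
Context {T : topologicalType}.
Implicit Types f g : T -> R.

Lemma contD f g : continuous f -> continuous g -> continuous (fun x => f x + g x).
Proof. by move=> cf cg x; apply: cvgD; [exact: cf|exact: cg]. Qed.

Lemma contM f g : continuous f -> continuous g -> continuous (fun x => f x * g x).
Proof. by move=> cf cg x; apply: cvgM; [exact: cf|exact: cg]. Qed.

Lemma contN f : continuous f -> continuous (fun x => - f x).
Proof. by move=> cf x; apply: cvgN; exact: cf. Qed.

Lemma contC (c : R) : continuous (fun _ : T => c).
Proof. by move=> x; exact: cvg_cst. Qed.

End Continuous.

Lemma C1_cst n (c : R) : C1 (fun _ : 'rV[R]_n => c).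
Proof.
split=> [x|i]; first exact: differentiable_cst.
have -> : pderiv i (fun _ : 'rV[R]_n => c) = fun=> 0.
  by apply/funext => x; rewrite /pderiv derive_cst.
exact: contC.
Qed.

Lemma pderivD n (f g : 'rV[R]_n -> R) i :
  (forall x, differentiable f x) -> (forall x, differentiable g x) ->
  pderiv i (fun x => f x + g x) = fun x => pderiv i f x + pderiv i g x.
Proof. by move=> df dg; apply/funext => x; rewrite /pderiv deriveD//; exact: diff_derivable. Qed.

Lemma pderivM n (f g : 'rV[R]_n -> R) i :
  (forall x, differentiable f x) -> (forall x, differentiable g x) ->
  pderiv i (fun x => f x * g x) = fun x => f x * pderiv i g x + g x * pderiv i f x.
Proof. by move=> df dg; apply/funext => x; rewrite /pderiv deriveM//; exact: diff_derivable. Qed.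

Lemma pderivN n (f : 'rV[R]_n -> R) i : (forall x, differentiable f x) ->
  pderiv i (fun x => - f x) = fun x => - pderiv i f x.
Proof. by move=> df; apply/funext => x; rewrite /pderiv deriveN//; exact: diff_derivable. Qed.

Lemma C1D n (f g : 'rV[R]_n -> R) : C1 f -> C1 g -> C1 (fun x => f x + g x).
Proof.
move=> [df cf] [dg cg]; split=> [x|i]; first exact: differentiableD.
by rewrite pderivD//; apply: contD.
Qed.

Lemma C1N n (f : 'rV[R]_n -> R) : C1 f -> C1 (fun x => - f x).
Proof.
move=> [df cf]; split=> [x|i]; first exact: differentiableN.
by rewrite pderivN//; apply: contN.
Qed.

Lemma C1M n (f g : 'rV[R]_n -> R) : C1 f -> C1 g -> C1 (fun x => f x * g x).
Proof.
move=> Cf Cg; have [df cf] := Cf; have [dg cg] := Cg.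
split=> [x|i]; first exact: differentiableM.
by rewrite pderivM//; apply: contD; apply: contM => //; exact: C1_continuous.
Qed.

Lemma C1_sum n m (f : 'I_m -> 'rV[R]_n -> R) :
  (forall i, C1 (f i)) -> C1 (fun x => \sum_i f i x).
Proof.
elim: m f => [|m IH] f h.
  have -> : (fun x => \sum_i f i x) = fun=> 0 by apply/funext => x; rewrite big_ord0.
  exact: C1_cst.
have -> : (fun x => \sum_i f i x) = fun x => f ord0 x + \sum_i f (lift ord0 i) x.
  by apply/funext => x; rewrite big_ord_recl.
by apply: C1D => //; apply: IH.
Qed.

Lemma C2_cst n (c : R) : C2 (fun _ : 'rV[R]_n => c).
Proof.
split=> [x|i]; first exact: differentiable_cst.
have -> : pderiv i (fun _ : 'rV[R]_n => c) = fun=> 0.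
  by apply/funext => x; rewrite /pderiv derive_cst.
exact: C1_cst.
Qed.

Lemma C2D n (f g : 'rV[R]_n -> R) : C2 f -> C2 g -> C2 (fun x => f x + g x).
Proof.
move=> [df cf] [dg cg]; split=> [x|i]; first exact: differentiableD.
by rewrite pderivD//; apply: C1D.
Qed.

Lemma C2N n (f : 'rV[R]_n -> R) : C2 f -> C2 (fun x => - f x).
Proof.
move=> [df cf]; split=> [x|i]; first exact: differentiableN.
by rewrite pderivN//; apply: C1N.
Qed.

Lemma C2M n (f g : 'rV[R]_n -> R) : C2 f -> C2 g -> C2 (fun x => f x * g x).
Proof.
move=> Cf Cg; have [df cf] := Cf; have [dg cg] := Cg.
split=> [x|i]; first exact: differentiableM.
by rewrite pderivM//; apply: C1D; apply: C1M => //; exact: C2_C1.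
Qed.

Lemma C2_sum n m (f : 'I_m -> 'rV[R]_n -> R) :
  (forall i, C2 (f i)) -> C2 (fun x => \sum_i f i x).
Proof.
elim: m f => [|m IH] f h.
  have -> : (fun x => \sum_i f i x) = fun=> 0 by apply/funext => x; rewrite big_ord0.
  exact: C2_cst.
have -> : (fun x => \sum_i f i x) = fun x => f ord0 x + \sum_i f (lift ord0 i) x.
  by apply/funext => x; rewrite big_ord_recl.
by apply: C2D => //; apply: IH.
Qed.

Lemma pderiv_coord n (i j : 'I_n) :
  pderiv i (fun x : 'rV[R]_n => x 0 j) = fun=> (i == j)%:R.
Proof.
apply/funext => x; rewrite -[LHS]gradE; have <- : (delta_mx 0 j : 'rV[R]_n) 0 i = (i == j)%:R.
  by rewrite mxE.
congr (fun_of_matrix _ _ _); apply: grad_unique; first exact: differentiable_coord.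
move=> v; rewrite dotC dot_delta; apply: cvg_near_cst; near=> t.
have -> : (x + t *: v) 0 j = x 0 j + t * v 0 j by rewrite !mxE.
rewrite [x 0 j + _]addrC addrK mulrAC divff ?mul1r//.
Unshelve. all: end_near. Qed.

Lemma C2_coord n (j : 'I_n) : C2 (fun x : 'rV[R]_n => x 0 j).
Proof.
split=> [x|i]; first exact: differentiable_coord.
by rewrite pderiv_coord; exact: C1_cst.
Qed.

Lemma C2_dot n (u : 'rV[R]_n) : C2 (fun x : 'rV[R]_n => dot u x).
Proof.
under eq_fun do rewrite dotE.
by apply: C2_sum => i; apply: C2M; [exact: C2_cst|exact: C2_coord].
Qed.

Definition quad n (c : R) (l : 'rV[R]_n) (Q : 'M[R]_n) (z : 'rV[R]_n) : R :=
  c + dot l z + 2^-1 * dot (z *m Q) z.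

Lemma C2_quad n c (l : 'rV[R]_n) Q : C2 (quad c l Q).
Proof.
apply: C2D; first by apply: C2D; [exact: C2_cst|exact: C2_dot].
apply: C2M; first exact: C2_cst.
have -> : (fun x : 'rV[R]_n => dot (x *m Q) x) =
    fun x => \sum_j (\sum_i x 0 i * Q i j) * x 0 j.
  by apply/funext => x; rewrite dotE; apply: eq_bigr => j _; rewrite mxE.
apply: C2_sum => j; apply: C2M; last exact: C2_coord.
by apply: C2_sum => i; apply: C2M; [exact: C2_coord|exact: C2_cst].
Qed.

Lemma quad_shift n c (l : 'rV[R]_n) Q z v : Q^T = Q ->
  quad c l Q (z + v) = quad c l Q z + dot (l + z *m Q) v + 2^-1 * dot (v *m Q) v.
Proof.
move=> Qs; rewrite /quad mulmxDl !dot_lin.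
have -> : dot (v *m Q) z = dot (z *m Q) v by rewrite dot_mulmx Qs dotC.
move: (dot _ _) (dot _ _) (dot _ _) (dot _ _) (dot _ _) => a1 a2 a3 a4 a5; clear; field=> //.
Qed.

Lemma grad_quad n c (l : 'rV[R]_n) Q z : Q^T = Q -> grad (quad c l Q) z = l + z *m Q.
Proof.
move=> Qs; apply: grad_unique; first exact: (C2_quad c l Q).1.
move=> v.
have E : forall t : R, 0 < t -> (quad c l Q (z + t *: v) - quad c l Q z) / t =
    dot (l + z *m Q) v + t * (2^-1 * dot (v *m Q) v).
  move=> t t0; rewrite quad_shift// -scalemxAl !dot_lin.
  move: (dot _ _) (dot _ _) (dot _ _) (quad _ _ _ _) => a1 a2 a3 a4.
  by clear -t0; field; rewrite gt_eqF.
have : dot (l + z *m Q) v + t * (2^-1 * dot (v *m Q) v) @[t --> 0^'+] -->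
   dot (l + z *m Q) v + 0 * (2^-1 * dot (v *m Q) v).
  apply: cvgD; first exact: cvg_cst.
  by apply: cvgMr_tmp; exact: cvg_at_right_filter.
rewrite mul0r addr0; apply: cvg_trans; apply: near_eq_cvg.
near=> t; rewrite E//.
Unshelve. all: end_near. Qed.

Lemma hess_quad n c (l : 'rV[R]_n) Q z : Q^T = Q -> hess (quad c l Q) z = Q.
Proof.
move=> Qs; apply/matrixP => i j; rewrite hessE.
have -> : pderiv j (quad c l Q) = quad (l 0 j) (row j Q) 0.
  apply/funext => x; rewrite -gradE grad_quad// /quad mulmx0 dot0l mulr0 addr0.
  rewrite mxE; congr (_ + _); rewrite mxE dotE; apply: eq_bigr => k _.
  by rewrite mxE mulrC -[in RHS]Qs mxE.
by rewrite -gradE grad_quad ?trmx0// mulmx0 addr0 mxE -[in LHS]Qs mxE.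
Qed.

Lemma jet2_quad n c (l : 'rV[R]_n) Q : Q^T = Q ->
  jet2 (quad c l Q) (fun z => l + z *m Q) (fun=> Q).
Proof.
move=> Qs; split; [exact: C2_quad|apply/funext => z|apply/funext => z].
  exact: grad_quad.
exact: hess_quad.
Qed.

Lemma jet2D n (f1 f2 : 'rV[R]_n -> R) g1 g2 H1 H2 :
  jet2 f1 g1 H1 -> jet2 f2 g2 H2 ->
  jet2 (fun x => f1 x + f2 x) (fun x => g1 x + g2 x) (fun x => H1 x + H2 x).
Proof.
move=> [C1f1 <- <-] [C1f2 <- <-]; split; first exact: C2D.
  apply/funext => x; apply/rowP => i; rewrite gradE mxE !gradE.
  by rewrite pderivD//; [exact: C1f1.1|exact: C1f2.1].
apply/funext => x; apply/matrixP => i j.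
have -> : (hess f1 x + hess f2 x) i j =
  pderiv i (pderiv j f1) x + pderiv i (pderiv j f2) x.
  by apply: etrans (addmxE _ _ _ _) _; congr (_ + _); exact: hessE.
apply: etrans (hessE _ _ _ _) _; rewrite pderivD; [|exact: C1f1.1|exact: C1f2.1].
by rewrite pderivD//; [exact: (C1f1.2 _).1|exact: (C1f2.2 _).1].
Qed.

Lemma jet2N n (f1 : 'rV[R]_n -> R) g1 H1 : jet2 f1 g1 H1 ->
  jet2 (fun x => - f1 x) (fun x => - g1 x) (fun x => - H1 x).
Proof.
move=> [C1f1 <- <-]; split; first exact: C2N.
  apply/funext => x; apply/rowP => i; rewrite gradE mxE !gradE.
  by rewrite pderivN//; exact: C1f1.1.
apply/funext => x; apply/matrixP => i j; rewrite hessE mxE !hessE.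
rewrite pderivN; last exact: C1f1.1.
by rewrite pderivN//; exact: (C1f1.2 _).1.
Qed.

Lemma jet2_C2 n (f : 'rV[R]_n -> R) : C2 f -> jet2 f (grad f) (hess f).
Proof. by []. Qed.

Lemma jet2_continuous n (f : 'rV[R]_n -> R) g H : jet2 f g H -> continuous f.
Proof. by move=> [[df _] _ _] x; exact: differentiable_continuous. Qed.

Lemma jet2_sym n (f : 'rV[R]_n -> R) g H z : jet2 f g H -> (H z)^T = H z.
Proof. by move=> [fC2 _ <-]; exact: hess_sym. Qed.

Lemma jet2_grad_continuous n (f : 'rV[R]_n -> R) g H : jet2 f g H -> continuous g.
Proof. by move=> [fC2 <- _]; apply: C1_grad_continuous; exact: C2_C1. Qed.

Lemma jet2_hess_continuous n (f : 'rV[R]_n -> R) g H : jet2 f g H -> continuous H.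
Proof. by move=> [fC2 _ <-]; apply: C2_hess_continuous. Qed.

Section Lift.
Variable N : nat.

Lemma xpartD (z w : 'rV[R]_(N + 1)) : xpart (z + w) = xpart z + xpart w.
Proof. by apply/rowP => i; rewrite !mxE. Qed.
Lemma xpartZ (a : R) (z : 'rV[R]_(N + 1)) : xpart (a *: z) = a *: xpart z.
Proof. by apply/rowP => i; rewrite !mxE. Qed.

Lemma derive_lift (f : 'rV[R]_N -> R) (z v : 'rV[R]_(N + 1)) :
  'D_v (fun z => f (xpart z)) z = 'D_(xpart v) f (xpart z).
Proof.
by rewrite /derive; under eq_fun do rewrite /= xpartD xpartZ.
Qed.

Lemma xpart_delta_l (i : 'I_N) : xpart (delta_mx 0 (lshift 1 i) : 'rV[R]_(N + 1)) = delta_mx 0 i.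
Proof. by apply/rowP => j; rewrite !mxE eqxx /= (inj_eq (@lshift_inj _ _)). Qed.

Lemma xpart_delta_r (i : 'I_1) : xpart (delta_mx 0 (rshift N i) : 'rV[R]_(N + 1)) = 0.
Proof. by apply/rowP => j; rewrite !mxE eqxx eq_lrshift. Qed.

Lemma pderiv_lift_l (f : 'rV[R]_N -> R) i :
  pderiv (lshift 1 i) (fun z => f (xpart z)) = fun z => pderiv i f (xpart z).
Proof. by apply/funext => z; rewrite /pderiv derive_lift xpart_delta_l. Qed.

Lemma pderiv_lift_r (f : 'rV[R]_N -> R) i :
  pderiv (rshift N i) (fun z => f (xpart z)) = fun=> 0.
Proof. by apply/funext => z; rewrite /pderiv derive_lift xpart_delta_r derive0. Qed.

Lemma xpart_continuous : continuous (@xpart R N).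
Proof. by move=> z; apply: differentiable_continuous; exact: differentiable_lsubmx. Qed.

Lemma ypart_continuous : continuous (@ypart R N).
Proof. have -> : @ypart R N = fun z => z 0 (rshift N 0) by apply/funext => z; rewrite /ypart mxE.
exact: coord_continuous. Qed.

Lemma C1_lift (f : 'rV[R]_N -> R) : C1 f -> C1 (fun z => f (xpart z)).
Proof.
move=> [df cf]; split=> [z|k].
  by apply: differentiable_comp; [exact: differentiable_lsubmx|exact: df].
rewrite -(splitK k); case: (fintype.split k) => i /=.
  rewrite pderiv_lift_l => z; apply: continuous_comp; first exact: xpart_continuous.
  exact: cf.
by rewrite pderiv_lift_r; exact: contC.
Qed.

Lemma jet2_lift (f : 'rV[R]_N -> R) g H : jet2 f g H ->
  jet2 (fun z => f (xpart z)) (fun z => row_mx (g (xpart z)) 0)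
       (fun z => block_mx (H (xpart z)) 0 0 0).
Proof.
move=> [[df cf] <- <-]; split.
- split=> [z|k].
    by apply: differentiable_comp; [exact: differentiable_lsubmx|exact: df].
  rewrite -(splitK k); case: (fintype.split k) => i /=.
    by rewrite pderiv_lift_l; apply: C1_lift.
  by rewrite pderiv_lift_r; exact: C1_cst.
- apply/funext => z; apply/rowP => k; rewrite gradE -(splitK k).
  case: (fintype.split k) => i /=.
    by rewrite pderiv_lift_l row_mxEl gradE.
  by rewrite pderiv_lift_r row_mxEr mxE.
- apply/funext => z; apply/matrixP => k l; rewrite hessE -(splitK k) -(splitK l).
  case: (fintype.split l) => j /=.
    rewrite pderiv_lift_l; case: (fintype.split k) => i /=.
      by rewrite pderiv_lift_l block_mxEul hessE.
    by rewrite pderiv_lift_r block_mxEdl mxE.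
  rewrite pderiv_lift_r /pderiv derive_cst.
  by case: (fintype.split k) => i /=; rewrite ?block_mxEur ?block_mxEdr mxE.
Qed.

Lemma row_parts (z : 'rV[R]_(N + 1)) : z = row_mx (xpart z) (ypart z)%:M.
Proof.
rewrite -{1}(hsubmxK z); congr row_mx; apply/matrixP => i j.
by rewrite (ord1 i) (ord1 j) [RHS]mxE eqxx mulr1n.
Qed.

Lemma xpart_row (x : 'rV[R]_N) (a : 'rV[R]_1) : xpart (row_mx x a) = x.
Proof. exact: row_mxKl. Qed.

Lemma ypart_row (x : 'rV[R]_N) (a : R) : ypart (row_mx x a%:M) = a.
Proof. by rewrite /ypart row_mxKr mxE eqxx mulr1n. Qed.

Lemma ypartD (z w : 'rV[R]_(N + 1)) : ypart (z + w) = ypart z + ypart w.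
Proof. by rewrite /ypart linearD mxE. Qed.
Lemma ypartZ (a : R) (z : 'rV[R]_(N + 1)) : ypart (a *: z) = a * ypart z.
Proof. by rewrite /ypart linearZ mxE. Qed.

End Lift.
End Jets.

(** * Upper semicontinuous envelopes *)

Section USC.
Context {R : realType}.

Definition usc_on (T : topologicalType) (K : set T) (f : T -> R) : Prop :=
  forall z, K z -> forall e : R, 0 < e -> \forall w \near z, K w -> f w < f z + e.

Lemma usc_onD (T : topologicalType) (K : set T) (f g : T -> R) :
  usc_on K f -> usc_on K g -> usc_on K (fun z => f z + g z).
Proof.
move=> uf ug z Kz e e0; have e20 : 0 < e / 2 by rewrite divr_gt0.
near=> w => Kw; have h1 : f w < f z + e / 2 by move: Kw; near: w; exact: uf.
have h2 : g w < g z + e / 2 by move: Kw; near: w; exact: ug.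
by rewrite (splitr e) addrACA ltrD.
Unshelve. all: end_near. Qed.

Lemma within_continuous_usc (T : topologicalType) (K : set T) (f : T -> R) :
  (forall z, K z -> f w @[w --> within K (nbhs z)] --> f z) -> usc_on K f.
Proof.
move=> cf z Kz e e0; have := cf z Kz => /cvgr_lt /(_ (f z + e)).
by rewrite ltrDl => /(_ e0).
Qed.

Lemma continuous_usc (T : topologicalType) (K : set T) (f : T -> R) :
  continuous f -> usc_on K f.
Proof. by move=> cf; apply: within_continuous_usc => z _; apply: cvg_within_filter; exact: cf. Qed.

Lemma usc_on_fst (T T' : topologicalType) (K : set T) (L : set T') (f : T -> R) :
  usc_on K f -> usc_on (K `*` L) (fun p => f p.1).
Proof.
move=> uf [z t] [/= Kz _] d d0.
exists ([set w | K w -> f w < f z + d], setT).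
  by split; [exact: uf|exact: filterT].
by move=> [w t'] [/= h _] [/= Kw _]; exact: h.
Qed.

(** Compactness is used twice as a near covering: for an upper bound, and for a
    uniform gap below the supremum in case it were not attained. *)
Lemma usc_attains_max (T : topologicalType) (K : set T) (f : T -> R) :
  compact K -> K !=set0 -> usc_on K f ->
  exists2 z, K z & forall w, K w -> f w <= f z.
Proof.
move=> cK [z0 Kz0] uf; have /near_covering_withinP nK := (compact_near_coveringP K).1 cK.
have [B hB] : exists B, forall z, K z -> f z < B.
  have : \forall b \near +oo, K `<=` (fun z => f z < b).
    apply: nK => z Kz.
    have h := uf z Kz 1 ltr01.
    near=> w b => /= Kw; have h1 : f w < f z + 1.
      by move: Kw; near: w.
    apply: lt_trans h1 _; near: b; apply: nbhs_pinfty_gt; exact: num_real.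
  by move=> /filter_ex[B hB]; exists B => z /hB.
have hs : has_sup [set f z | z in K].
  by split; [exists (f z0), z0|exists B => _ [z Kz <-]; apply: ltW; exact: hB].
apply: contrapT => nomax.
have lts z : K z -> f z < sup [set f z | z in K].
  move=> Kz; rewrite ltNge; apply/negP => le; apply: nomax; exists z => // w Kw.
  by apply: le_trans le; apply: ub_le_sup; [exact: hs.2|exists w].
have : \forall i \near 0^'+, K `<=` (fun z => f z < sup [set f z | z in K] - i).
  apply: nK => z Kz; set s := sup _; have d0 : 0 < (s - f z) / 2.
    by rewrite divr_gt0// subr_gt0 lts.
  have h := uf z Kz _ d0.
  near=> w i => /= Kw; have h1 : f w < f z + (s - f z) / 2.
    by move: Kw; near: w.
  apply: lt_le_trans h1 _; have h2 : i <= (s - f z) / 2.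
    by apply: ltW; near: i; exact: nbhs_right_lt.
  by clear -h2; lra.
move=> /(filterI (nbhs_right_gt 0))/filter_ex[i [i0 hi]].
suff : sup [set f z | z in K] <= sup [set f z | z in K] - i.
  by rewrite lerBrDl gerDr leNgt i0.
by apply: ge_sup => [|_ [z Kz <-]]; [exists (f z0), z0|apply: ltW; exact: hi].
Unshelve. all: end_near. Qed.

End USC.

Section Envelope.
Context {R : realType} {n : nat}.
Implicit Types (K : set 'rV[R]_n) (u : 'rV[R]_n -> R).

Definition bnd_on K u (B : R) : Prop := forall w, K w -> `|u w| <= B.

Lemma bounded_bnd_on K u : [bounded u z | z in K] <-> exists B, bnd_on K u B.
Proof.
split=> [[M [_ hM]]|[B hB]].
  exists (M + 1) => w Kw; apply: (hM (M + 1)) => //; by rewrite ltrDl.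
by exists B; split; [exact: num_real|move=> M BM w /= /hB /le_trans; apply; exact: ltW].
Qed.

Lemma limsup_fin K u B z : bnd_on K u B -> K z ->
  limf_esup (fun w => (u w)%:E) (within K (nbhs z)) = (usc_env K u z)%:E.
Proof.
move=> hB Kz; rewrite /usc_env fineK// fin_numE; apply/andP; split.
  rewrite -ltNye; apply: lt_le_trans (ltNyr (u z)) _.
  apply: le_ereal_inf_tmp => _ [V KV <-]; apply: ereal_sup_ubound.
  by exists z => //; exact: (nbhs_singleton KV).
rewrite -ltey; apply: le_lt_trans _ (ltry B).
apply: ge_ereal_inf; exists (ereal_sup [set (u w)%:E | w in K]).
  by exists K => //; exact: withinT.
apply: ge_ereal_sup => _ [w Kw <-]; rewrite lee_fin.
by apply: le_trans (ler_norm _) _; exact: hB.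
Qed.

Lemma env_near K u B z (e : R) : bnd_on K u B -> K z -> 0 < e ->
  \forall w \near z, K w -> u w < usc_env K u z + e.
Proof.
move=> hB Kz e0; have : (limf_esup (fun w => (u w)%:E) (within K (nbhs z)) < (usc_env K u z + e)%:E)%E.
  by rewrite (limsup_fin hB Kz) lte_fin ltrDl.
move=> /ereal_inf_lt[_ [V KV <-] hV]; have : \forall w \near z, K w -> V w by exact: KV.
apply: filterS => w KVw Kw.
rewrite -lte_fin; apply: le_lt_trans hV; apply: ereal_sup_ubound.
by exists w => //; exact: KVw.
Qed.

Lemma env_approx K u B z (e : R) (V : set 'rV[R]_n) : bnd_on K u B -> K z -> 0 < e ->
  nbhs z V -> exists w, [/\ K w, V w & usc_env K u z - e < u w].
Proof.
move=> hB Kz e0 zV; pose V' := K `&` V.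
have : ((usc_env K u z - e)%:E < ereal_sup [set (u w)%:E | w in V'])%E.
  apply: (@lt_le_trans _ _ (usc_env K u z)%:E); first by rewrite lte_fin gtrDl oppr_lt0.
  rewrite -(limsup_fin hB Kz); apply: ereal_inf_lbound; exists V' => //.
  by apply: filterS zV => w Vw Kw.
by move=> /ereal_sup_gt[_ [w [Kw Vw] <-]]; rewrite lte_fin => h; exists w.
Qed.

Lemma env_le K u B z c : bnd_on K u B -> K z ->
  (\forall w \near z, K w -> u w <= c) -> usc_env K u z <= c.
Proof.
move=> hB Kz h; apply/ler_addgt0Pr => e e0.
have [w [Kw hw]] := env_approx hB Kz e0 h.
by rewrite ltrBlDr => /ltW /le_trans; apply; rewrite lerD2r; exact: hw.
Qed.

Lemma env_ge K u B z : bnd_on K u B -> K z -> u z <= usc_env K u z.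
Proof.
move=> hB Kz; apply/ler_addgt0Pr => e e0; apply: ltW.
exact: (nbhs_singleton (env_near hB Kz e0) Kz).
Qed.

Lemma env_usc K u B : bnd_on K u B -> usc_on K (usc_env K u).
Proof.
move=> hB z Kz e e0; have e20 : 0 < e / 2 by rewrite divr_gt0.
have := env_near hB Kz e20 => /nbhs_interior; apply: filterS => w hw Kw.
apply: (@le_lt_trans _ _ (usc_env K u z + e / 2)).
  by apply: (env_le hB Kw); apply: filterS hw => y hy Ky; apply: ltW; exact: hy.
by rewrite ltrD2l ltr_pdivrMr// ltr_pMr// ltr1n.
Qed.

Lemma env_le_cont K u B (g : 'rV[R]_n -> R) z : bnd_on K u B -> K z -> {for z, continuous g} ->
  (forall w, K w -> u w <= g w) -> usc_env K u z <= g z.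
Proof.
move=> hB Kz cg h; apply/ler_addgt0Pr => e e0; apply: (env_le hB Kz).
have : \forall w \near z, g w < g z + e by move/cvgr_lt : cg => /(_ (g z + e)); rewrite ltrDl; apply.
by apply: filterS => w gw Kw; apply: le_trans (h _ Kw) _; exact: ltW.
Qed.

Lemma env_mono K u B u' B' z : bnd_on K u B -> bnd_on K u' B' -> K z ->
  (forall w, K w -> u w <= u' w) -> usc_env K u z <= usc_env K u' z.
Proof.
move=> hB hB' Kz h; apply/ler_addgt0Pr => e e0; apply: (env_le hB Kz).
apply: filterS (env_near hB' Kz e0) => w uw Kw.
by apply: le_trans (h _ Kw) _; apply: ltW; exact: uw.
Qed.

Lemma lsc_envE K u z : lsc_env K u z = - usc_env K (fun w => - u w) z.
Proof. by rewrite /lsc_env /limf_einf fineN. Qed.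

End Envelope.

(** * Geometry of a C^1 boundary *)

Section ContOn.
Context {R : realType}.

Lemma near_norm n (x0 : 'rV[R]_n) (d : R) : 0 < d -> \forall x \near x0, `|x - x0| < d.
Proof. by move=> d0; apply/nbhs_normP; exists d => // y /=; rewrite distrC. Qed.

Lemma norm_near n (x0 : 'rV[R]_n) (P : 'rV[R]_n -> Prop) : (\forall x \near x0, P x) ->
  exists2 d : R, 0 < d & forall x, `|x - x0| < d -> P x.
Proof.
move=> /nbhs_normP[d /= d0 hd]; exists d => // x xd; apply: hd.
by rewrite /= distrC.
Qed.

Lemma inv_le (a b : R) : 0 < a -> a < b -> b^-1 <= a^-1.
Proof. by move=> a0 ab; have b0 := lt_trans a0 ab; rewrite lef_pV2 ?posrE// ltW. Qed.

Lemma mul_sub_lt0 (u v s : R) : 0 < v -> u <= 0 -> 0 < s -> u - s * v < 0.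
Proof. by move=> *; nra. Qed.

Definition cont_on (T U : topologicalType) (A : set T) (f : T -> U) : Prop :=
  forall x, A x -> f w @[w --> within A (nbhs x)] --> f x.

Lemma within_cont_on (T U : topologicalType) (A : set T) (f : T -> U) :
  {within A, continuous f} -> cont_on A f.
Proof. by move/subspace_continuousP. Qed.

Lemma cont_on_cvg (T U : topologicalType) (A : set T) (f : T -> U)
    (I : Type) (G : set_system I) (FG : Filter G) (X : I -> T) (x : T) :
  cont_on A f -> A x -> X @ G --> x -> (\forall i \near G, A (X i)) ->
  f (X i) @[i --> G] --> f x.
Proof.
move=> cf Ax Xx XA; apply: cvg_comp (cf x Ax) => P /= wP.
have : \forall i \near G, A (X i) -> P (X i) by exact: (Xx _ wP).
by move=> /(filterI XA); apply: filterS => i [Ai]; apply.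
Qed.

Lemma cont_on_near (T : topologicalType) (U : topologicalType) (A : set T) (f : T -> U) :
  (forall (I : Type) (G : set_system I) (FG : ProperFilter G) (X : I -> T) (x : T),
    A x -> X @ G --> x -> (\forall i \near G, A (X i)) -> f (X i) @[i --> G] --> f x) ->
  cont_on A f.
Proof.
move=> h x Ax.
have [/= P|] := pselect (ProperFilter (within A (nbhs x))).
  apply: (h _ (within A (nbhs x))) => //; last exact: withinT.
  exact: cvg_within.
move=> nP; exfalso; apply: nP; apply: Build_ProperFilter => //.
by move=> w0; have := nbhs_singleton w0; apply.
Qed.

Lemma cont_on_bounded (T : topologicalType) (V : normedModType R) (A : set T)
    (f : T -> V) : compact A -> cont_on A f ->
  exists2 B : R, 0 <= B & forall x, A x -> `|f x| <= B.
Proof.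
move=> cA cf; have : compact (f @` A).
  by apply: continuous_compact => //; apply/subspace_continuousP.
move=> /compact_bounded[M [_ hM]]; exists (`|M| + 1); first by rewrite addr_ge0.
move=> x Ax; apply: (hM (`|M| + 1)); last by exists x.
by rewrite (le_lt_trans (ler_norm _))// ltrDl.
Qed.

Lemma continuous_cont_on (T U : topologicalType) (A : set T) (f : T -> U) :
  continuous f -> cont_on A f.
Proof. by move=> cf x _; apply: cvg_within_filter; exact: cf. Qed.

End ContOn.

Section Boundary.
Context {R : realType} {N : nat}.
Variables (Om : set 'rV[R]_N) (nu : 'rV[R]_N -> 'rV[R]_N).
Hypotheses (Om_open : open Om) (Om_bnd : bounded_set Om)
  (nuP : outward_unit_normal Om nu).

(** Either the initial value is negative and continuity suffices, or it vanishes
    and the one-sided derivative decides. *)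
Lemma ray_negative (f : 'rV[R]_N -> R) (x v : 'rV[R]_N) (a b c : R) :
  differentiable f x -> a + c * f x <= 0 ->
  (a + c * f x = 0 -> b + c * dot (grad f x) v < 0) ->
  \forall t \near 0^'+, a + t * b + c * f (x + t *: v) < 0.
Proof.
move=> df le0 h0; have [E|ne] := eqVneq (a + c * f x) 0.
  have : b + c * ((f (x + t *: v) - f x) / t) @[t --> 0^'+] --> b + c * dot (grad f x) v.
    by apply: cvgD; [exact: cvg_cst|apply: cvgMl_tmp; exact: cvg_quot_right].
  move=> /cvgr_lt /(_ 0 (h0 E)); apply: filter_app; near=> t.
  have t0 : 0 < t by near: t; exact: nbhs_right_gt.
  rewrite -(pmulr_llt0 _ t0) => h; have := h.
  have -> : (b + c * ((f (x + t *: v) - f x) / t)) * t = t * b + c * f (x + t *: v) - c * f x.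
    by move: (f _) (f _) => p q; clear -t0; field; rewrite gt_eqF.
  by move: E; move: (f _) (f _) => p q; clear => E; lra.
have lt0 : a + c * f x < 0 by rewrite lt_neqAle ne.
have : a + t * b + c * f (x + t *: v) @[t --> 0^'+] --> a + 0 * b + c * f (x + 0 *: v).
  apply: cvgD.
    apply: cvgD; first exact: cvg_cst.
    by apply: cvgMr_tmp; exact: cvg_at_right_filter.
  apply: cvgMl_tmp; apply: cvg_at_right_filter.
  have cl : {for 0, continuous (fun t : R => x + t *: v)}.
    by apply: cvgD; [exact: cvg_cst|apply: cvgZr_tmp].
  apply: (continuous_comp cl); rewrite scale0r addr0.
  exact: differentiable_continuous.
by rewrite mul0r addr0 scale0r addr0 => /cvgr_lt /(_ 0 lt0).
Unshelve. all: end_near. Qed.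

Lemma closure_bdry x : closure Om x -> ~ bdry Om x -> Om x.
Proof.
move=> cx nb; apply: contrapT => nOx; apply: nb; split => // ix.
by apply: nOx; exact: (interior_subset ix).
Qed.

Lemma bdry_notin x : bdry Om x -> ~ Om x.
Proof. by move=> [_ h] Ox; apply: h; exact: Om_open. Qed.

Lemma bdry_defining_eq0 x psi : C1_defining Om x psi ->
  \forall z \near x, bdry Om z -> psi z = 0.
Proof.
move=> [Cpsi g0 h]; have := nbhs_interior h; apply: filterS => z hz bz.
apply/eqP; rewrite eq_le; apply/andP; split.
  rewrite leNgt; apply/negP => gt0.
  have : \forall w \near z, 0 < psi w.
    by have := C1_continuous Cpsi (x := z) => /cvgr_gt /(_ 0 gt0).
  move=> /(filterI hz) => hh; have [w [Ow [hw pw]]] := bz.1 _ hh.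
  by have := hw.1 Ow; rewrite ltNge (ltW pw).
rewrite leNgt; apply/negP => lt0; apply: (bdry_notin bz).
exact: (nbhs_singleton hz).2.
Qed.

(** A vector in the closed half-space of psi2 on which grad psi1 is positive can
    be pushed into the open half-space; along its ray psi2 is then negative
    and psi1 positive. *)
Lemma defining_halfspace x psi1 psi2 (p : 'rV[R]_N) :
  C1 psi1 -> C1 psi2 -> psi1 x = 0 -> psi2 x = 0 -> grad psi2 x != 0 ->
  (\forall z \near x, psi2 z < 0 -> psi1 z < 0) ->
  dot (grad psi2 x) p <= 0 -> dot (grad psi1 x) p <= 0.
Proof.
move=> C1p C2p p10 p20 g0 h le0; rewrite leNgt; apply/negP => gt0.
set D1 := grad psi1 x; set D2 := grad psi2 x.
have D20 : 0 < dot D2 D2 by exact: dot_gt0.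
have [s [s0 hs]] : exists s : R, 0 < s /\ 0 < dot D1 (p - s *: D2).
  exists (dot D1 p / (2 * (`|dot D1 D2| + 1))); set a := `|dot D1 D2|.
  have a0 : 0 <= a by exact: normr_ge0.
  split; first by rewrite divr_gt0// mulr_gt0// ltr_wpDl.
  rewrite dotBr dotZr subr_gt0.
  apply: (@le_lt_trans _ _ (dot D1 p / (2 * (a + 1)) * a)).
    by rewrite ler_wpM2l ?ler_norm// divr_ge0 ?ltW// mulr_gt0// ltr_wpDl.
  have : 0 < dot D1 p by [].
  move: (dot D1 p) => b; clear -a0 => b0.
  rewrite mulrAC ltr_pdivrMr; last by rewrite mulr_gt0// ltr_wpDl.
  by nra.
set q := p - s *: D2.
have q2 : dot D2 q < 0.
  by rewrite dotBr dotZr; apply: mul_sub_lt0.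
have n2 : \forall t \near 0^'+, 0 + t * 0 + 1 * psi2 (x + t *: q) < 0.
  by apply: ray_negative; rewrite ?p20 ?mulr0 ?addr0//; [exact: C2p.1|rewrite add0r mul1r].
have n1 : \forall t \near 0^'+, 0 + t * 0 + -1 * psi1 (x + t *: q) < 0.
  apply: ray_negative; rewrite ?p10 ?mulr0 ?addr0//; first exact: C1p.1.
  by rewrite add0r mulN1r oppr_lt0.
have nx : (x + t *: q) @[t --> 0^'+] --> x.
  rewrite -[X in _ --> X]addr0 -(scale0r q).
  apply: cvgD; first exact: cvg_cst.
  by apply: cvgZr_tmp; exact: cvg_at_right_filter.
have n3 : \forall t \near 0^'+, psi2 (x + t *: q) < 0 -> psi1 (x + t *: q) < 0.
  exact: nx _ h.
have [t [/= t3 [t1 t2]]] := filter_ex (filterI n3 (filterI n1 n2)).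
move: t1 t2; rewrite mulr0 !add0r mul1r mulN1r oppr_lt0 => t1 /t3.
by rewrite ltNge (ltW t1).
Qed.

(** The inclusion makes D1 vanish on the orthogonal complement of D2, so D1 is a
    positive multiple of D2. *)
Lemma halfspace_normal (D1 D2 : 'rV[R]_N) : D1 != 0 -> D2 != 0 ->
  (forall p, dot D2 p <= 0 -> dot D1 p <= 0) ->
  (enorm D1)^-1 *: D1 = (enorm D2)^-1 *: D2.
Proof.
move=> D10 D20 h; set c := dot D1 D2 / dot D2 D2.
have v0 : dot D2 D2 != 0 by rewrite gt_eqF// dot_gt0.
set v := D1 - c *: D2.
have D2v : dot D2 v = 0 by rewrite dotBr dotZr (dotC D2) divfK// subrr.
have D1v : dot D1 v = 0.
  apply/eqP; rewrite eq_le h ?D2v//= -oppr_le0 -dotNr; apply: h.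
  by rewrite dotNr D2v oppr0.
have : v = 0.
  by apply: dot_eq0; rewrite {1}/v dotBl dotZl D1v D2v mulr0 subr0.
move/subr0_eq => E.
have c0 : 0 < c.
  rewrite lt_neqAle; apply/andP; split.
    by apply: contra D10 => /eqP c0; rewrite E -c0 scale0r.
  rewrite divr_ge0 ?dot_ge0// -oppr_le0 -dotNr; apply: h.
  by rewrite dotNr oppr_le0 dot_ge0.
have e2 : 0 < enorm D2 by rewrite sqrtr_gt0 dot_gt0.
rewrite {1 2}E {1}/enorm !dot_lin mulrA -expr2 sqrtrM ?sqr_ge0// sqrtr_sqr gtr0_norm//.
by rewrite scalerA -/(enorm D2) invfM mulrAC mulVf ?mul1r// gt_eqF.
Qed.

(** One defining function serves all nearby boundary points, and two defining
    functions have the same half-spaces: the normal is therefore continuous. *)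
Lemma nu_defining x0 psi : C1_defining Om x0 psi ->
  \forall x \near x0, bdry Om x -> nu x = (enorm (grad psi x))^-1 *: grad psi x.
Proof.
move=> d0; have e0 := bdry_defining_eq0 d0; have [Cpsi g0 h0] := d0.
have gn : \forall x \near x0, grad psi x != 0.
  have : \forall x \near x0, 0 < dot (grad psi x) (grad psi x).
    apply: (@cvgr_gt _ _ (nbhs x0) _ (fun x => dot (grad psi x) (grad psi x))
      (dot (grad psi x0) (grad psi x0))); last exact: dot_gt0.
    by apply: (@cvg_dot _ _ _ (nbhs x0)); exact: C1_grad_continuous.
  by apply: filterS => x; apply: contraTneq => ->; rewrite dot0l ltxx.
have h1 := nbhs_interior h0.
apply: filterS (filterI gn (filterI h1 e0)) => x [gx [hx ex]] bx.
have [psi2 d2 ->] := nuP bx; have [C2 g2 h2] := d2.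
have p2 : psi2 x = 0 by apply: (nbhs_singleton (bdry_defining_eq0 d2)).
apply: halfspace_normal => // p; apply: defining_halfspace => //; first exact: ex.
have hx' : \forall z \near x, Om z <-> psi z < 0 by exact: hx.
by apply: filterS (filterI hx' h2) => z [z1 z2] /z1 /z2.
Qed.

Lemma nu_unit x : bdry Om x -> dot (nu x) (nu x) = 1.
Proof.
move=> bx; have [psi [_ g0 _] ->] := nuP bx.
have e2 : 0 < enorm (grad psi x) by rewrite sqrtr_gt0 dot_gt0.
by rewrite dotZl dotZr -enorm_sq expr2 [X in _ * X]mulrA mulVf ?mul1r ?mulVf// gt_eqF.
Qed.

Lemma nu_norm x : bdry Om x -> `|nu x| <= 1.
Proof.
by move=> bx; apply: le_trans (norm_le_enorm _) _; rewrite /enorm nu_unit// sqrtr1.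
Qed.

Lemma enorm_continuous n : continuous (@enorm R n).
Proof.
move=> u; apply: (@cvg_comp _ _ _ (fun u => dot u u) Num.sqrt (nbhs u) (nbhs (dot u u))).
  by apply: (@cvg_dot _ _ _ (nbhs u)) => //; exact: cvg_id.
exact: sqrt_continuous.
Qed.

Lemma unit_cvg (g : 'rV[R]_N -> 'rV[R]_N) x0 : {for x0, continuous g} -> g x0 != 0 ->
  (enorm (g x))^-1 *: g x @[x --> x0] --> (enorm (g x0))^-1 *: g x0.
Proof.
move=> cg g0; have e2 : 0 < enorm (g x0) by rewrite sqrtr_gt0 dot_gt0.
apply: (@cvgZ _ _ _ (nbhs x0)) => //; apply: (@cvgV _ _ (nbhs x0)); first by rewrite gt_eqF.
by apply: continuous_comp => //; exact: enorm_continuous.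
Qed.

Lemma nu_cont : cont_on (bdry Om) nu.
Proof.
move=> x0 bx0; have [psi d0 _] := nuP bx0; have hn := nu_defining d0.
have [Cpsi g0 _] := d0.
rewrite (nbhs_singleton hn bx0).
have := unit_cvg (C1_grad_continuous Cpsi (x := x0)) g0.
move=> h0; have : (enorm (grad psi x))^-1 *: grad psi x @[x --> within (bdry Om) (nbhs x0)]
    --> (enorm (grad psi x0))^-1 *: grad psi x0 by exact: cvg_within_filter h0.
apply: cvg_trans; apply: near_eq_cvg.
have : \forall x \near x0, bdry Om x -> (enorm (grad psi x))^-1 *: grad psi x = nu x.
  by apply: filterS hn => x h /h ->.
by [].
Qed.

Lemma bdry_closed : closed (bdry Om).
Proof.
by apply: closedI; [exact: closed_closure|apply: open_closedC; exact: open_interior].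
Qed.

(** Boundary and interior points have to be treated together, because a sequence
    of boundary points and interior points may converge to the same boundary
    point. *)
Lemma lateral_near (I : Type) (G : set_system I) (FG : Filter G) (x p : I -> 'rV[R]_N)
    (x0 p0 : 'rV[R]_N) : x @ G --> x0 -> p @ G --> p0 ->
  (bdry Om x0 -> 0 < dot (nu x0) p0) ->
  \forall i \near G, ~ (bdry Om (x i) /\ dot (nu (x i)) (p i) <= 0).
Proof.
move=> hx hp lat; have [b0|nb0] := pselect (bdry Om x0); last first.
  have h : \forall i \near G, ~ bdry Om (x i).
    have : nbhs x0 (~` bdry Om) by apply: open_nbhs_nbhs; split => //; exact: closed_openC bdry_closed.
    by move/hx.
  by apply: filterS h => i ni [].
have : dot (nu (x i)) (p i) @[i --> within [set i | bdry Om (x i)] G] --> dot (nu x0) p0.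
  apply: cvg_dot; last exact: cvg_within_filter.
  apply: (cont_on_cvg _ nu_cont) => //; first exact: cvg_within_filter.
  exact: withinT.
move=> /cvgr_gt /(_ _ (lat b0)); rewrite near_withinE; apply: filterS => i h [bi].
by rewrite leNgt h.
Qed.

Lemma closure_Om_bounded : exists2 B : R, 0 <= B & forall x, closure Om x -> `|x| <= B.
Proof.
have [M [_ hM]] := Om_bnd; exists (`|M| + 1); first by rewrite addr_ge0.
have cl : closed [set x : 'rV[R]_N | `|x| <= `|M| + 1].
  by apply: closed_comp (@closed_le R (`|M| + 1)) => x _; exact: norm_continuous.
move=> x; rewrite closureE => /(_ _ (conj cl _)); apply => y Oy.
by apply: (hM (`|M| + 1)) => //; rewrite (le_lt_trans (ler_norm _))// ltrDl.
Qed.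

Lemma compact_closure_Om : compact (closure Om).
Proof.
have [B _ hB] := closure_Om_bounded; apply: bounded_closed_compact.
  by exists B; split; rewrite ?num_real// => M BM x /hB /le_trans; apply; exact: ltW.
exact: closed_closure.
Qed.

Lemma compact_bdry : compact (bdry Om).
Proof. by apply: subclosed_compact bdry_closed compact_closure_Om _ => x []. Qed.

(** A coordinate attains its maximum on the compact closure, but not inside an
    open set. *)
Lemma bdry_nonempty : (0 < N)%N -> Om !=set0 -> bdry Om !=set0.
Proof.
move=> N0 [x Ox]; pose i0 := Ordinal N0; apply: contrapT => nb.
have sub : closure Om `<=` Om.
  by move=> z cz; apply: closure_bdry => // bz; apply: nb; exists z.
have [||z cz hz] := @usc_attains_max R _ (closure Om) (fun z : 'rV[R]_N => z 0 i0) compact_closure_Om.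
- by exists x; exact: subset_closure.
- by apply: continuous_usc; exact: coord_continuous.
have nz : (z + t *: (delta_mx 0 i0 : 'rV[R]_N)) @[t --> 0^'+] --> z.
  rewrite -[X in _ --> X]addr0 -(scale0r (delta_mx 0 i0)).
  apply: cvgD; first exact: cvg_cst.
  by apply: cvgZr_tmp; exact: cvg_at_right_filter.
have n1 : \forall t \near 0^'+, Om (z + t *: (delta_mx 0 i0 : 'rV[R]_N)).
  by apply: nz _ _; apply: open_nbhs_nbhs; split=> //; exact: sub.
have [t [t0 Ot]] := filter_ex (filterI (nbhs_right_gt 0) n1).
have := hz _ (subset_closure Ot); rewrite !mxE !eqxx mulr1.
by rewrite gerDl leNgt t0.
Qed.

(** A defining function vanishes at both points, so strict differentiability
    makes chords almost tangent; compactness makes this uniform. *)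
Lemma bdry_flat (e : R) : 0 < e -> exists2 t : R, 0 < t & forall x y,
  bdry Om x -> bdry Om y -> `|x - y| < t ->
  `|dot (nu y) (x - y)| <= e * `|x - y| /\ `|nu x - nu y| <= e.
Proof.
move=> e0.
have /near_covering_withinP nK := (compact_near_coveringP (bdry Om)).1 compact_bdry.
have : \forall t \near 0^'+, bdry Om `<=` (fun y => forall x, bdry Om x -> `|x - y| < t ->
  `|dot (nu y) (x - y)| <= e * `|x - y| /\ `|nu x - nu y| <= e).
  apply: nK => x0 bx0; have [psi d0 _] := nuP bx0.
  have hn := nu_defining d0; have he := bdry_defining_eq0 d0.
  have [Cpsi g0 _] := d0; have cn := nu_cont bx0.
  have e2 : 0 < enorm (grad psi x0) by rewrite sqrtr_gt0 dot_gt0.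
  set m := enorm (grad psi x0) / 2; have m0 : 0 < m by rewrite divr_gt0.
  have hm : \forall y \near x0, m < enorm (grad psi y).
    have : enorm (grad psi y) @[y --> x0] --> enorm (grad psi x0).
      by apply: (@continuous_comp _ _ _ (grad psi) (@enorm R N)); [exact: C1_grad_continuous|exact: enorm_continuous].
    by move=> /cvgr_gt; apply; rewrite /m ltr_pdivrMr// ltr_pMr// ltr1n.
  have em0 : 0 < e * m by rewrite mulr_gt0.
  have [d d_0 hd] := C1_strict_diff x0 Cpsi em0.
  have e20 : 0 < e / 2 by rewrite divr_gt0.
  have hnu : \forall y \near x0, bdry Om y -> `|nu x0 - nu y| < e / 2.
    by have := cn => /cvgrPdist_lt /(_ _ e20).
  have hall : \forall y \near x0, [/\ bdry Om y -> nu y = (enorm (grad psi y))^-1 *: grad psi y,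
      bdry Om y -> psi y = 0, m < enorm (grad psi y), bdry Om y -> `|nu x0 - nu y| < e / 2
      & `|y - x0| < d].
    near=> y; split; near: y => //.
    exact: near_norm.
  have [r r0 hr] := norm_near hall.
  near=> y t => /= by_ x bx xy.
  have yx0 : `|y - x0| < r / 2.
    by near: y; apply: near_norm; rewrite divr_gt0.
  have tr : t < r / 2 by near: t; apply: nbhs_right_lt; rewrite divr_gt0.
  have xx0 : `|x - x0| < r.
    rewrite -(subrKA y); apply: le_lt_trans (ler_normD _ _) _.
    by rewrite (splitr r) ltrD// (lt_trans xy).
  have yr : `|y - x0| < r.
    by apply: lt_trans yx0 _; rewrite ltr_pdivrMr// ltr_pMr// ltr1n.
  have [ny py my dy ady] := hr y yr.
  have [nx px mx dx adx] := hr x xx0.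
  split; last first.
    rewrite -(subrKA (nu x0)); apply: le_trans (ler_normD _ _) _.
    by rewrite (splitr e) lerD// ltW ?dy// distrC dx.
  rewrite ny// dotZl normrM ger0_norm ?invr_ge0 ?enorm_ge0//.
  have := hd x y adx ady; rewrite px// py// subrr sub0r normrN => h.
  apply: (@le_trans _ _ (m^-1 * (e * m * `|x - y|))); last first.
    by rewrite mulrCA mulrA mulfK// gt_eqF.
  apply: ler_pM => //; first by rewrite invr_ge0 enorm_ge0.
  exact: inv_le m0 my.
move=> /(filterI (nbhs_right_gt 0))/filter_ex[t [t0 ht]]; exists t => // x y bx by_.
exact: ht.
Unshelve. all: end_near. Qed.

End Boundary.

(** * The thin problem and its reflection *)

(** The data are bundled so that the reflection of u into -u acts on all of them
    at once: the graphs g+, g- (gup, glo), the equation F (eqn), the oblique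
    fields gamma_1+, gamma_1- (obp, obm) and right-hand sides beta+, beta- (rhp,
    rhm), their values on {y = 0} (ob0, rh0) and the coefficients k+, k-, l+, l-
    of their expansions (okp, okm, rlp, rlm). *)
Record problem (R : realType) (N : nat) := Problem {
  dom : set 'rV[R]_N;
  nrm : 'rV[R]_N -> 'rV[R]_N;
  gup : 'rV[R]_N -> R;
  glo : 'rV[R]_N -> R;
  eqn : 'M[R]_(N + 1) -> 'rV[R]_(N + 1) -> R -> 'rV[R]_N -> R -> R;
  obp : 'rV[R]_N -> R -> 'rV[R]_N;
  obm : 'rV[R]_N -> R -> 'rV[R]_N;
  rhp : 'rV[R]_N -> R -> R;
  rhm : 'rV[R]_N -> R -> R;
  ob0 : 'rV[R]_N -> 'rV[R]_N;
  rh0 : 'rV[R]_N -> R;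
  okp : 'rV[R]_N -> 'rV[R]_N;
  okm : 'rV[R]_N -> 'rV[R]_N;
  rlp : 'rV[R]_N -> R;
  rlm : 'rV[R]_N -> R }.

Lemma cvg_pair5 (T1 T2 T3 T4 T5 : topologicalType) (I : Type) (G : set_system I)
    (FG : Filter G) (f1 : I -> T1) (f2 : I -> T2) (f3 : I -> T3) (f4 : I -> T4)
    (f5 : I -> T5) (a1 : T1) (a2 : T2) (a3 : T3) (a4 : T4) (a5 : T5) :
  f1 @ G --> a1 -> f2 @ G --> a2 -> f3 @ G --> a3 -> f4 @ G --> a4 -> f5 @ G --> a5 ->
  (f1 i, f2 i, f3 i, f4 i, f5 i) @[i --> G] --> (a1, a2, a3, a4, a5).
Proof.
by move=> h1 h2 h3 h4 h5; exact: (cvg_pair (cvg_pair (cvg_pair (cvg_pair h1 h2) h3) h4) h5).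
Qed.

Section Admissible.
Context {R : realType} {N : nat}.

Definition eqn_domain (Om : set 'rV[R]_N) :
    set ('M[R]_(N + 1) * 'rV[R]_(N + 1) * R * 'rV[R]_N * R) :=
  [set w | let: (X, p, r, x, y) := w in [/\ X^T = X, closure Om x & -1 <= y <= 1]].

Definition uncurry5 (F : 'M[R]_(N + 1) -> 'rV[R]_(N + 1) -> R -> 'rV[R]_N -> R -> R)
    (w : 'M[R]_(N + 1) * 'rV[R]_(N + 1) * R * 'rV[R]_N * R) : R :=
  let: (X, p, r, x, y) := w in F X p r x y.

Definition proper_decreasing (Om : set 'rV[R]_N)
    (F : 'M[R]_(N + 1) -> 'rV[R]_(N + 1) -> R -> 'rV[R]_N -> R -> R) (alpha : R) :=
  forall (p : 'rV[R]_(N + 1)) (x : 'rV[R]_N) (y : R),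
     closure Om x -> -1 <= y <= 1 ->
     forall (X Y : 'M[R]_(N + 1)) (r s : R),
       X^T = X -> Y^T = Y -> mxge X Y -> r <= s ->
       F X p r x y - alpha * r <= F Y p s x y - alpha * s.

Definition slab (Om : set 'rV[R]_N) : set ('rV[R]_N * R) := closure Om `*` `[-1, 1].

Record admissible (P : problem R N) : Prop := Admissible {
  adN : (0 < N)%N;
  ad_open : open (dom P);
  ad_bnd : bounded_set (dom P);
  ad_ne : dom P !=set0;
  ad_nrm : outward_unit_normal (dom P) (nrm P);
  ad_gup : C1 (gup P);
  ad_glo : C1 (glo P);
  ad_lt : forall x, closure (dom P) x -> glo P x < gup P x;
  ad_eqn : cont_on (eqn_domain (dom P)) (uncurry5 (eqn P));
  ad_mono : exists2 alpha : R, 0 < alpha & proper_decreasing (dom P) (eqn P) alpha;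
  ad_obp : cont_on (slab (dom P)) (fun z => obp P z.1 z.2);
  ad_obm : cont_on (slab (dom P)) (fun z => obm P z.1 z.2);
  ad_rhp : cont_on (slab (dom P)) (fun z => rhp P z.1 z.2);
  ad_rhm : cont_on (slab (dom P)) (fun z => rhm P z.1 z.2);
  ad_ob0 : C1vec (ob0 P);
  ad_rh0 : C1 (rh0 P);
  ad_okp : cont_on (closure (dom P)) (okp P);
  ad_okm : cont_on (closure (dom P)) (okm P);
  ad_rlp : cont_on (closure (dom P)) (rlp P);
  ad_rlm : cont_on (closure (dom P)) (rlm P);
  ad_obp_exp : unif_expansion (closure (dom P)) (obp P) (ob0 P) (okp P);
  ad_obm_exp : unif_expansion (closure (dom P)) (obm P) (fun x => - ob0 P x) (okm P);
  ad_rhp_exp : unif_expansion (closure (dom P)) (rhp P) (rh0 P) (rlp P);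
  ad_rhm_exp : unif_expansion (closure (dom P)) (rhm P) (fun x => - rh0 P x) (rlm P) }.

(** The problem that -u solves when u solves P. *)
Definition flip (P : problem R N) : problem R N :=
  Problem (dom P) (nrm P) (gup P) (glo P)
    (fun X p r x y => - eqn P (- X) (- p) (- r) x y)
    (obp P) (obm P) (fun x y => - rhp P x y) (fun x y => - rhm P x y)
    (ob0 P) (fun x => - rh0 P x) (okp P) (okm P)
    (fun x => - rlp P x) (fun x => - rlm P x).

Lemma flipK P : flip (flip P) = P.
Proof.
case: P => *; rewrite /flip /=; congr Problem; do ?[apply/funext => ?]; by rewrite ?opprK.
Qed.

Lemma cont_onN (T : topologicalType) (A : set T) (f : T -> R) :
  cont_on A f -> cont_on A (fun x => - f x).
Proof. by move=> cf x Ax; apply: cvgN; exact: cf. Qed.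

Lemma unif_expansionN (K : set 'rV[R]_N) (f : 'rV[R]_N -> R -> R) (f0 k : 'rV[R]_N -> R) :
  unif_expansion K f f0 k ->
  unif_expansion K (fun x y => - f x y) (fun x => - f0 x) (fun x => - k x).
Proof.
move=> h e e0; apply: filterS (h e e0) => y hy x Kx.
by rewrite scalerN -!opprD normrN; exact: hy.
Qed.

Lemma trmxN m n (X : 'M[R]_(m, n)) : (- X)^T = - X^T.
Proof. by apply/matrixP => i j; rewrite !mxE. Qed.

Lemma eqn_cvg (P : problem R N) : admissible P ->
  forall (I : Type) (G : set_system I) (FG : Filter G)
    (X : I -> 'M[R]_(N + 1)) (p : I -> 'rV[R]_(N + 1)) (r : I -> R)
    (x : I -> 'rV[R]_N) (y : I -> R)
    (X0 : 'M[R]_(N + 1)) (p0 : 'rV[R]_(N + 1)) (r0 : R) (x0 : 'rV[R]_N) (y0 : R),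
  X @ G --> X0 -> p @ G --> p0 -> r @ G --> r0 -> x @ G --> x0 -> y @ G --> y0 ->
  X0^T = X0 -> closure (dom P) x0 -> -1 <= y0 <= 1 ->
  (\forall i \near G, (X i)^T = X i /\ closure (dom P) (x i) /\ -1 <= y i <= 1) ->
  eqn P (X i) (p i) (r i) (x i) (y i) @[i --> G] --> eqn P X0 p0 r0 x0 y0.
Proof.
move=> ad I G FG X p r x y X0 p0 r0 x0 y0 hX hp hr hx hy sX cx cy near.
have := @cont_on_cvg _ _ _ (uncurry5 (eqn P)) I G FG (fun i => (X i, p i, r i, x i, y i))
  (X0, p0, r0, x0, y0) (ad_eqn ad).
apply => //.
  exact: cvg_pair5.
by apply: filterS near => i [? [? ?]].
Qed.

Lemma admissible_flip P : admissible P -> admissible (flip P).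
Proof.
move=> ad; have [alpha a0 mono] := ad_mono ad.
have hF : cont_on (eqn_domain (dom P)) (uncurry5 (eqn (flip P))).
  apply: cont_on_near => I G FG w w0 Aw0 ww0 Aw.
  have h1 : (w i).1 @[i --> G] --> w0.1 by apply: cvg_comp ww0 (@cvg_fst _ _ _ _ _).
  have h11 : (w i).1.1 @[i --> G] --> w0.1.1 by apply: cvg_comp h1 (@cvg_fst _ _ _ _ _).
  have h111 : (w i).1.1.1 @[i --> G] --> w0.1.1.1 by apply: cvg_comp h11 (@cvg_fst _ _ _ _ _).
  have E : forall v, uncurry5 (fun X p r x y => - eqn P (- X) (- p) (- r) x y) v =
    - eqn P (- v.1.1.1.1) (- v.1.1.1.2) (- v.1.1.2) v.1.2 v.2.
    by move=> [[[[X p] r] x] y].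
  rewrite E; under eq_fun do rewrite E.
  apply: cvgN; have [[[sX cx] cy]] : ((w0.1.1.1.1)^T = w0.1.1.1.1 /\ closure (dom P) w0.1.2) /\ -1 <= w0.2 <= 1.
    by case: w0 {ww0 h1 h11 h111} Aw0 => [[[[X p] r] x] y] [].
  apply: (eqn_cvg ad) => //.
  + by apply: cvgN; apply: cvg_comp h111 (@cvg_fst _ _ _ _ _).
  + by apply: cvgN; apply: cvg_comp h111 (@cvg_snd _ _ _ _ _).
  + by apply: cvgN; apply: cvg_comp h11 (@cvg_snd _ _ _ _ _).
  + by apply: cvg_comp h1 (@cvg_snd _ _ _ _ _).
  + by apply: cvg_comp ww0 (@cvg_snd _ _ _ _ _).
  + by rewrite trmxN sX.
  + apply: filterS Aw => i; case: (w i) => [[[[X p] r] x] y] [/= sXi ? ?].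
    by rewrite trmxN sXi.
have hm : proper_decreasing (dom P) (eqn (flip P)) alpha.
  move=> p x y cx cy X Y r s sX sY XY rs.
  have := mono (- p) x y cx cy (- Y) (- X) (- s) (- r).
  rewrite !trmxN sX sY lerN2 => /(_ erefl erefl _ rs).
  have h0 : mxge (- Y) (- X) by move=> v; rewrite opprK addrC; exact: XY.
  move=> /(_ h0); rewrite !mulrN !opprK /=.
  move: (eqn P _ _ _ _ _) (eqn P _ _ _ _ _) => a b h; lra.
exact: (@Admissible (flip P) (adN ad) (ad_open ad) (ad_bnd ad) (ad_ne ad) (ad_nrm ad)
  (ad_gup ad) (ad_glo ad) (ad_lt ad) hF (ex_intro2 _ _ alpha a0 hm) (ad_obp ad) (ad_obm ad)
  (cont_onN (ad_rhp ad)) (cont_onN (ad_rhm ad)) (ad_ob0 ad) (C1N (ad_rh0 ad))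
  (ad_okp ad) (ad_okm ad) (cont_onN (ad_rlp ad)) (cont_onN (ad_rlm ad))
  (ad_obp_exp ad) (ad_obm_exp ad) (unif_expansionN (ad_rhp_exp ad))
  (unif_expansionN (ad_rhm_exp ad))).
Qed.

Lemma dot_parts (z w : 'rV[R]_(N + 1)) :
  dot z w = dot (xpart z) (xpart w) + ypart z * ypart w.
Proof. by rewrite {1}(row_parts z) {1}(row_parts w) dot_row_mx. Qed.

Lemma xpartN (z : 'rV[R]_(N + 1)) : xpart (- z) = - xpart z.
Proof. by apply/rowP => i; rewrite !mxE. Qed.

Lemma ypartN (z : 'rV[R]_(N + 1)) : ypart (- z) = - ypart z.
Proof. by rewrite /ypart !mxE. Qed.

Definition thinK (P : problem R N) (e : R) := closure (thin (dom P) (gup P) (glo P) e).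
Definition tle (P : problem R N) (e : R) :=
  thin_le (dom P) (nrm P) (gup P) (glo P) (eqn P) (obp P) (obm P) (rhp P) (rhm P) e.
Definition tge (P : problem R N) (e : R) :=
  thin_ge (dom P) (nrm P) (gup P) (glo P) (eqn P) (obp P) (obm P) (rhp P) (rhm P) e.

Lemma tge_flip P e X p r z : tge P e X p r z <-> tle (flip P) e (- X) (- p) (- r) z.
Proof.
rewrite /tge /tle /thin_ge /thin_le /=; rewrite !opprK xpartN !dotNr !oppr_le0 !lerN2.
by [].
Qed.

Lemma jet2_opp_grad n (f : 'rV[R]_n -> R) z : C2 f ->
  grad (fun x => - f x) z = - grad f z /\ hess (fun x => - f x) z = - hess f z.
Proof. by move=> Cf; have [_ -> ->] := jet2N (jet2_C2 Cf). Qed.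

Lemma bnd_onN n (K : set 'rV[R]_n) u B : bnd_on K u B -> bnd_on K (fun x => - u x) B.
Proof. by move=> h w Kw; rewrite normrN; exact: h. Qed.

(** Test functions are reflected together with u. This reduces every statement
    on supersolutions to one on subsolutions of the reflected problem. *)
Lemma visc_super_flip n (K : set 'rV[R]_n) (E E' : 'M[R]_n -> 'rV[R]_n -> R -> 'rV[R]_n -> Prop) u :
  (forall X p r z, E X p r z <-> E' (- X) (- p) (- r) z) ->
  visc_super K E u <-> visc_sub K E' (fun x => - u x).
Proof.
move=> EE'; split=> -[/bounded_bnd_on[B hB] h]; split.
- by apply/bounded_bnd_on; exists B; exact: bnd_onN.
- move=> phi z Cphi Kz hmax.
  have := h (fun x => - phi x) z (C2N Cphi) Kz.
  have [-> ->] := jet2_opp_grad z Cphi.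
  rewrite EE' !opprK !lsc_envE opprK => h2.
  apply: h2 => w Kw; rewrite lsc_envE; have := hmax w Kw; lra.
- apply/bounded_bnd_on; exists B => w Kw; rewrite -normrN; exact: hB.
- move=> phi z Cphi Kz hmin; rewrite EE'.
  have [<- <-] := jet2_opp_grad z Cphi; rewrite lsc_envE opprK.
  apply: (h (fun x => - phi x) z (C2N Cphi) Kz) => w Kw; have := hmin w Kw; rewrite !lsc_envE; lra.
Qed.

End Admissible.

(** * Thin domains *)

Section Thin.
Context {R : realType} {N : nat}.
Variable P : problem R N.
Hypothesis ad : admissible P.
Local Notation cl := (closure (dom P)).

Lemma cl_compact : compact cl.
Proof. exact: compact_closure_Om (ad_bnd ad). Qed.

Lemma continuous_bounded (V : normedModType R) (f : 'rV[R]_N -> V) : continuous f ->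
  exists2 B : R, 0 <= B & forall x, cl x -> `|f x| <= B.
Proof. by move=> cf; apply: cont_on_bounded; [exact: cl_compact|exact: continuous_cont_on]. Qed.

Lemma expansion_bound (V : normedModType R) (f : 'rV[R]_N -> R -> V) (f0 k : 'rV[R]_N -> V) :
  cont_on cl k -> unif_expansion cl f f0 k ->
  exists2 C : R, 0 <= C & \forall y \near 0, forall x, cl x -> `|f x y - f0 x| <= C * `|y|.
Proof.
move=> ck hf; have [B B0 hB] := cont_on_bounded cl_compact ck.
exists (B + 1); first by rewrite addr_ge0.
apply: filterS (hf 1 ltr01) => y hy x cx.
have -> : f x y - f0 x = (f x y - (f0 x + y *: k x)) + y *: k x.
  by rewrite opprD addrA subrK.
apply: le_trans (ler_normD _ _) _; rewrite mulrDl addrC lerD ?hy//.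
by rewrite normrZ mulrC ler_wpM2r// hB.
Qed.

Lemma thinK_sub (e : R) (z : 'rV[R]_(N + 1)) : 0 < e -> thinK P e z ->
  cl (xpart z) /\ e * glo P (xpart z) <= ypart z <= e * gup P (xpart z).
Proof.
move=> e0; rewrite /thinK closureE => h.
pose S1 : set 'rV[R]_(N + 1) := [set z | cl (xpart z)].
pose S2 : set 'rV[R]_(N + 1) := [set z | 0 <= ypart z - e * glo P (xpart z)].
pose S3 : set 'rV[R]_(N + 1) := [set z | 0 <= e * gup P (xpart z) - ypart z].
have cg (g : 'rV[R]_N -> R) : C1 g -> continuous (fun z : 'rV[R]_(N + 1) => e * g (xpart z)).
  move=> hg; apply: contM; first exact: contC.
  by move=> w; apply: continuous_comp; [exact: xpart_continuous|exact: C1_continuous].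
have c1 : closed S1.
  by apply: closed_comp (@closed_closure _ (dom P)) => w _; exact: xpart_continuous.
have c2 : closed S2.
  apply: closed_comp (@closed_ge R 0) => w _.
  by apply: contD; [exact: ypart_continuous|apply: contN; apply: cg; exact: ad_glo].
have c3 : closed S3.
  apply: closed_comp (@closed_ge R 0) => w _.
  by apply: contD; [apply: cg; exact: ad_gup|apply: contN; exact: ypart_continuous].
have sub : thin (dom P) (gup P) (glo P) e `<=` S1 `&` (S2 `&` S3).
  move=> w [Ow /andP[h1 h2]]; split; first exact: subset_closure.
  by split; rewrite /S2 /S3 /= subr_ge0 ltW.
have [] := h _ (conj (closedI c1 (closedI c2 c3)) sub).
by rewrite /S1 /= => ? []; rewrite /S2 /S3 /= !subr_ge0 => -> ->.
Qed.

Lemma thin_sub_K e : thin (dom P) (gup P) (glo P) e `<=` thinK P e.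
Proof. exact: subset_closure. Qed.

Lemma thinK_compact_bound : exists2 G : R, 0 < G &
  forall e z, 0 < e -> thinK P e z -> `|ypart z| <= G * e.
Proof.
have [B B0 hB] := continuous_bounded (C1_continuous (ad_gup ad)).
have [B' B'0 hB'] := continuous_bounded (C1_continuous (ad_glo ad)).
exists (B + B' + 1); first by rewrite ltr_wpDl ?addr_ge0.
move=> e z e0 /(thinK_sub e0)[cx /andP[h1 h2]].
have := hB _ cx; have := hB' _ cx; rewrite !ler_norml => /andP[a1 a2] /andP[a3 a4].
by apply/andP; split; nra.
Qed.

Lemma norm_le_parts (z : 'rV[R]_(N + 1)) : `|z| <= `|xpart z| + `|ypart z|.
Proof.
apply: norm_le_coord; first by rewrite addr_ge0.
move=> i j; rewrite (ord1 i) {1}(row_parts z) -(splitK j).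
case: (fintype.split j) => k /=; rewrite ?row_mxEl ?row_mxEr.
  by apply: le_trans (coord_le_norm _ _ _) _; rewrite lerDl.
by rewrite mxE (ord1 k) eqxx mulr1n lerDr.
Qed.

Lemma thinK_compact e : 0 < e -> compact (thinK P e).
Proof.
move=> e0; apply: bounded_closed_compact; last exact: closed_closure.
have [G G0 hG] := thinK_compact_bound.
have [B B0 hB] := closure_Om_bounded (ad_bnd ad).
exists (B + G * e); split; rewrite ?num_real// => M BM z Kz.
apply: le_trans (norm_le_parts z) _; apply: ltW; apply: le_lt_trans BM.
by apply: lerD; [exact: hB (thinK_sub e0 Kz).1|exact: hG].
Qed.

Lemma thin_open e : open (thin (dom P) (gup P) (glo P) e).
Proof.
have cg (g : 'rV[R]_N -> R) : C1 g -> continuous (fun z : 'rV[R]_(N + 1) => e * g (xpart z)).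
  move=> hg; apply: contM; first exact: contC.
  by move=> w; apply: continuous_comp; [exact: xpart_continuous|exact: C1_continuous].
have -> : thin (dom P) (gup P) (glo P) e = [set z | dom P (xpart z)] `&`
  ([set z | 0 < ypart z - e * glo P (xpart z)] `&` [set z | 0 < e * gup P (xpart z) - ypart z]).
  apply/seteqP; split => z /=; rewrite !subr_gt0.
    by move=> [? /andP[]].
  by move=> [Oz [h1 h2]]; split=> //; apply/andP.
apply: openI; first by apply: open_comp (ad_open ad) => w _; exact: xpart_continuous.
apply: openI.
  apply: open_comp (@open_gt R 0) => w _.
  by apply: contD; [exact: ypart_continuous|apply: contN; apply: cg; exact: ad_glo].
apply: open_comp (@open_gt R 0) => w _.
by apply: contD; [apply: cg; exact: ad_gup|apply: contN; exact: ypart_continuous].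
Qed.

(** Every active piece of the boundary imposes one inequality on the direction,
    and along the ray each of the three constraints is controlled separately
    by ray_negative. *)
Lemma ray_inward (e : R) (z d : 'rV[R]_(N + 1)) : 0 < e -> thinK P e z ->
  (bdry (dom P) (xpart z) -> dot (nrm P (xpart z)) (xpart d) < 0) ->
  (ypart z = e * gup P (xpart z) -> ypart d < e * dot (grad (gup P) (xpart z)) (xpart d)) ->
  (ypart z = e * glo P (xpart z) -> e * dot (grad (glo P) (xpart z)) (xpart d) < ypart d) ->
  \forall t \near 0^'+, thin (dom P) (gup P) (glo P) e (z + t *: d).
Proof.
move=> e0 Kz hL hT hB; have [cx /andP[y1 y2]] := thinK_sub e0 Kz.
set x := xpart z in cx y1 y2 hL hT hB *; set dx := xpart d in hL hT hB *.
have n1 : \forall t \near 0^'+, dom P (x + t *: dx).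
  have nx : (x + t *: dx) @[t --> 0^'+] --> x.
    rewrite -[X in _ --> X]addr0 -(scale0r dx).
    apply: cvgD; first exact: cvg_cst.
    by apply: cvgZr_tmp; exact: cvg_at_right_filter.
  have [bx|nbx] := pselect (bdry (dom P) x); last first.
    by apply: nx _ _; apply: open_nbhs_nbhs; split; [exact: ad_open|exact: closure_bdry].
  have [psi dpsi nuE] := ad_nrm ad bx; have [Cpsi g0 hpsi] := dpsi.
  have p0 : psi x = 0 by apply: (nbhs_singleton (bdry_defining_eq0 (ad_open ad) dpsi)).
  have lt0 : dot (grad psi x) dx < 0.
    have := hL bx; rewrite nuE dotZl pmulr_rlt0// invr_gt0 sqrtr_gt0.
    exact: dot_gt0.
  have r : \forall t \near 0^'+, 0 + t * 0 + 1 * psi (x + t *: dx) < 0.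
    by apply: ray_negative; rewrite ?p0 ?mulr0 ?addr0//; [exact: Cpsi.1|rewrite add0r mul1r].
  have hx : \forall t \near 0^'+, dom P (x + t *: dx) <-> psi (x + t *: dx) < 0 by exact: nx _ hpsi.
  apply: filterS (filterI r hx) => t [/= r1 h1]; apply: h1.2.
  by move: r1; rewrite mulr0 !add0r mul1r.
have n2 : \forall t \near 0^'+, ypart z + t * ypart d + (- e) * gup P (x + t *: dx) < 0.
  apply: ray_negative; rewrite ?mulNr ?subr_le0//; first exact: (ad_gup ad).1.
  by move=> /subr0_eq /hT; rewrite subr_lt0.
have n3 : \forall t \near 0^'+, - ypart z + t * - ypart d + e * glo P (x + t *: dx) < 0.
  apply: ray_negative; rewrite ?[- ypart z + _]addrC ?subr_le0//; first exact: (ad_glo ad).1.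
  by move=> /subr0_eq/esym /hB; rewrite addrC subr_lt0.
apply: filterS (filterI n1 (filterI n2 n3)) => t [/= t1 [t2 t3]].
rewrite /thin /= xpartD xpartZ ypartD ypartZ; split => //.
rewrite -/x -/dx; move: (gup P _) (glo P _) t2 t3 => a b t2 t3.
by apply/andP; split; lra.
Qed.

(** Extension by zero, so that points of the edges and of the rest of the top
    and bottom are handled by one formula. *)
Definition nrm0 (x : 'rV[R]_N) : 'rV[R]_N := if pselect (bdry (dom P) x) then nrm P x else 0.

(** Under these bounds - (gamma + t nu) is an inward direction at every point of
    the top and the bottom, edges included. *)
Definition inward_at (t e : R) : Prop :=
  forall z, thinK P e z -> let x := xpart z in let y := ypart z in
  [/\ -1 <= y <= 1,
    (bdry (dom P) x -> - dot (nrm P x) (obp P x y) < t /\ - dot (nrm P x) (obm P x y) < t),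
    e * dot (grad (gup P) x) (obp P x y + t *: nrm0 x) < 1 &
    e * - dot (grad (glo P) x) (obm P x y + t *: nrm0 x) < 1].

(** The oblique fields and the gradients of the two graphs are bounded, so that
    t can be fixed first and the thickness chosen afterwards. *)
Lemma small_thickness : exists e0 t : R, [/\ 0 < e0, 0 < t & forall e, 0 < e < e0 -> inward_at t e].
Proof.
have [G G0 hG] := thinK_compact_bound.
have cslab : compact (slab (dom P)).
  by apply: compact_setX; [exact: cl_compact|exact: segment_compact].
have [Bp Bp0 hBp] := cont_on_bounded cslab (ad_obp ad).
have [Bm Bm0 hBm] := cont_on_bounded cslab (ad_obm ad).
have [Gp Gp0 hGp] := continuous_bounded (C1_grad_continuous (ad_gup ad)).
have [Gm Gm0 hGm] := continuous_bounded (C1_grad_continuous (ad_glo ad)).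
have n0 : 0 <= N%:R :> R by [].
pose t := N%:R * (Bp + Bm) + 1.
have t0 : 0 < t by rewrite /t ltr_wpDl// mulr_ge0// addr_ge0.
pose C := N%:R * ((Gp + Gm) * (Bp + Bm + t)) + G + 1.
have C0 : 0 < C by rewrite /C ltr_wpDl// addr_ge0 ?(ltW G0)// !(mulr_ge0, addr_ge0)// ltW.
exists C^-1, t; split => //; first by rewrite invr_gt0.
move=> e /andP[e0 eC] z Kz x y.
have eC1 : e * C < 1 by rewrite -ltr_pdivlMr// div1r.
have [cx yb] := thinK_sub e0 Kz.
have GeC : G * e <= 1.
  apply: ltW; apply: le_lt_trans eC1; rewrite mulrC ler_wpM2l ?(ltW e0)// /C.
  by rewrite -addrA addrCA lerDl addr_ge0// !(mulr_ge0, addr_ge0)// ltW.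
have y1 : -1 <= y <= 1.
  have := hG e z e0 Kz; rewrite -ler_norml => h; exact: le_trans h GeC.
have sl : slab (dom P) (x, y) by split => //=; rewrite in_itv.
have b1 := hBp _ sl; have b2 := hBm _ sl; rewrite /= in b1 b2.
have nr0 : `|nrm0 x| <= 1.
  rewrite /nrm0; case: pselect => bx; last by rewrite normr0.
  by apply: nu_norm (ad_nrm ad) _ bx.
have key (g v w : 'rV[R]_N) (B B' : R) : 0 <= B -> 0 <= B' -> `|g| <= B -> `|v| <= B' ->
    `|w| <= 1 -> B <= Gp + Gm -> B' <= Bp + Bm -> e * `|dot g (v + t *: w)| < 1.
  move=> B_0 B'_0 gB vB w1 BG BB; apply: le_lt_trans eC1; rewrite ler_wpM2l ?(ltW e0)//.
  apply: le_trans (dot_le_norm _ _) _; rewrite /C -addrA; apply: ler_wpDr.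
    by rewrite addr_ge0// ltW.
  rewrite ler_wpM2l// ler_pM//; first exact: le_trans gB BG.
  apply: le_trans (ler_normD _ _) _; rewrite normrZ gtr0_norm//.
  apply: lerD; first exact: le_trans vB BB.
  by rewrite -[leRHS]mulr1 ler_wpM2l// ltW.
split => //.
- move=> bx; have nb := nu_norm (ad_nrm ad) bx.
  have bd (v : 'rV[R]_N) (B : R) : `|v| <= B -> B <= Bp + Bm -> - dot (nrm P x) v < t.
    move=> vB BB; apply: le_lt_trans (ler_norm _) _; rewrite normrN.
    apply: le_lt_trans (dot_le_norm _ _) _; rewrite /t.
    apply: le_lt_trans (_ : N%:R * (Bp + Bm) < _); last by rewrite ltrDl.
    rewrite ler_wpM2l// -[leRHS]mul1r ler_pM//; exact: le_trans vB BB.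
  split; [apply: (bd _ _ b1)|apply: (bd _ _ b2)]; by rewrite ?lerDl ?lerDr.
- apply: le_lt_trans (_ : e * `|dot (grad (gup P) x) (obp P x y + t *: nrm0 x)| < 1).
    by rewrite ler_wpM2l ?(ltW e0)// ler_norm.
  by apply: (key _ _ _ Gp Bp) => //; rewrite ?lerDl ?lerDr//; exact: hGp.
- apply: le_lt_trans (_ : e * `|dot (grad (glo P) x) (obm P x y + t *: nrm0 x)| < 1).
    by rewrite ler_wpM2l ?(ltW e0)// -normrN ler_norm.
  by apply: (key _ _ _ Gm Bm) => //; rewrite ?lerDl ?lerDr//; exact: hGm.
Qed.

End Thin.

Section OpenConditions.
Context {R : realType} {N : nat}.
Variable P : problem R N.
Hypothesis ad : admissible P.
Local Notation cl := (closure (dom P)).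

Lemma slab_cvg (V : topologicalType) (f : 'rV[R]_N -> R -> V)
    (I : Type) (G : set_system I) (FG : Filter G) (z : I -> 'rV[R]_(N + 1)) z0 :
  cont_on (slab (dom P)) (fun w => f w.1 w.2) ->
  z @ G --> z0 -> cl (xpart z0) -> -1 <= ypart z0 <= 1 ->
  (\forall i \near G, cl (xpart (z i)) /\ -1 <= ypart (z i) <= 1) ->
  f (xpart (z i)) (ypart (z i)) @[i --> G] --> f (xpart z0) (ypart z0).
Proof.
move=> cf hz cx cy hn.
have hx : xpart (z i) @[i --> G] --> xpart z0 by apply: cvg_comp hz (@xpart_continuous R N z0).
have hy : ypart (z i) @[i --> G] --> ypart z0 by apply: cvg_comp hz (@ypart_continuous R N z0).
have := @cont_on_cvg _ _ _ (fun w => f w.1 w.2) I G FG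
  (fun i => (xpart (z i), ypart (z i))) (xpart z0, ypart z0) cf.
apply; first by split => //=; rewrite in_itv.
  exact: cvg_pair hx hy.
by apply: filterS hn => i [? ?]; split => //=; rewrite in_itv.
Qed.

Lemma gammap_cvg (I : Type) (G : set_system I) (FG : Filter G)
   (z p : I -> 'rV[R]_(N + 1)) (z0 p0 : 'rV[R]_(N + 1)) (g : 'rV[R]_N -> R -> 'rV[R]_N)
   (b : 'rV[R]_N -> R -> R) (s : R) :
  cont_on (slab (dom P)) (fun w => g w.1 w.2) ->
  cont_on (slab (dom P)) (fun w => b w.1 w.2) ->
  z @ G --> z0 -> p @ G --> p0 -> cl (xpart z0) -> -1 <= ypart z0 <= 1 ->
  (\forall i \near G, cl (xpart (z i)) /\ -1 <= ypart (z i) <= 1) ->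
  b (xpart z0) (ypart z0) < dot (row_mx (g (xpart z0) (ypart z0)) s%:M) p0 ->
  \forall i \near G,
    b (xpart (z i)) (ypart (z i)) < dot (row_mx (g (xpart (z i)) (ypart (z i))) s%:M) (p i).
Proof.
move=> cg cb hz hp cx cy hn; rewrite -subr_gt0 => lt0.
have : dot (row_mx (g (xpart (z i)) (ypart (z i))) s%:M) (p i) - b (xpart (z i)) (ypart (z i))
   @[i --> G] --> dot (row_mx (g (xpart z0) (ypart z0)) s%:M) p0 - b (xpart z0) (ypart z0).
  apply: cvgB; last exact: slab_cvg.
  apply: cvg_dot => //; apply: cvg_row_mx; last exact: cvg_cst.
  exact: slab_cvg.
by move=> /cvgr_gt /(_ _ lt0); apply: filterS => i; rewrite subr_gt0.
Qed.

(** Each of the four alternatives is a closed condition on the jet and the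
    point. *)
Lemma not_tle_open (I : Type) (G : set_system I) (FG : Filter G)
    (X : I -> 'M[R]_(N + 1)) (p : I -> 'rV[R]_(N + 1)) (r : I -> R)
    (z : I -> 'rV[R]_(N + 1)) (X0 : 'M[R]_(N + 1)) (p0 : 'rV[R]_(N + 1)) (r0 : R)
    (z0 : 'rV[R]_(N + 1)) (e : R) :
  0 < e -> (forall w, thinK P e w -> -1 <= ypart w <= 1) ->
  X @ G --> X0 -> p @ G --> p0 -> r @ G --> r0 -> z @ G --> z0 ->
  X0^T = X0 -> thinK P e z0 ->
  (\forall i \near G, (X i)^T = X i /\ thinK P e (z i)) ->
  ~ tle P e X0 p0 r0 z0 -> \forall i \near G, ~ tle P e (X i) (p i) (r i) (z i).
Proof.
move=> e0 ey hX hp hr hz sX Kz0 hn nt.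
have [cx0 /andP[y1 y2]] := thinK_sub ad e0 Kz0; have cy0 := ey _ Kz0.
have hn' : \forall i \near G, cl (xpart (z i)) /\ -1 <= ypart (z i) <= 1.
  apply: filterS hn => i [_ Ki]; split; last exact: ey.
  exact: (thinK_sub ad e0 Ki).1.
have hx : xpart (z i) @[i --> G] --> xpart z0 by apply: cvg_comp hz (@xpart_continuous R N z0).
have hy : ypart (z i) @[i --> G] --> ypart z0 by apply: cvg_comp hz (@ypart_continuous R N z0).
have hF : \forall i \near G, 0 < eqn P (X i) (p i) (r i) (xpart (z i)) (ypart (z i)).
  have F0 : 0 < eqn P X0 p0 r0 (xpart z0) (ypart z0).
    by rewrite ltNge; apply/negP => ?; apply: nt; constructor 1.
  have := eqn_cvg ad FG hX hp hr hx hy sX cx0 cy0.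
  move=> /(_ _)/cvgr_gt/(_ _ F0); apply.
  by apply: filterS (filterI hn hn') => i [[? _] [? ?]].
have hL : \forall i \near G, ~ (bdry (dom P) (xpart (z i)) /\ dot (nrm P (xpart (z i))) (xpart (p i)) <= 0).
  apply: (lateral_near (ad_open ad) (ad_nrm ad) FG hx (p0 := xpart p0)).
    by apply: cvg_comp hp (@xpart_continuous R N p0).
  move=> b0; rewrite ltNge; apply/negP => le0; apply: nt; constructor 2; split => //.
  by split => //; apply/andP.
have hTB (g : 'rV[R]_N -> R) : C1 g -> ypart z0 <> e * g (xpart z0) ->
    \forall i \near G, ypart (z i) <> e * g (xpart (z i)).
  move=> Cg ne; have ne0 : 0 < `|ypart z0 - e * g (xpart z0)|.
    by rewrite normr_gt0 subr_eq0; apply/eqP.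
  have : `|ypart (z i) - e * g (xpart (z i))| @[i --> G] --> `|ypart z0 - e * g (xpart z0)|.
    apply: cvg_norm; apply: cvgB => //; apply: cvgMl_tmp.
    by apply: cvg_comp hx (C1_continuous Cg (x := _)).
  move=> /cvgr_gt /(_ _ ne0); apply: filterS => i + E.
  by rewrite E subrr normr0 ltxx.
have hT : \forall i \near G, ~ (thinT (dom P) (gup P) e (z i) /\
    dot (gammap (obp P) (z i)) (p i) <= rhp P (xpart (z i)) (ypart (z i))).
  have [E|ne] := pselect (ypart z0 = e * gup P (xpart z0)); last first.
    by apply: filterS (hTB _ (ad_gup ad) ne) => i ni [[_ E] _].
  have lt0 : rhp P (xpart z0) (ypart z0) < dot (gammap (obp P) z0) p0.
    by rewrite ltNge; apply/negP => le0; apply: nt; constructor 3.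
  apply: filterS (gammap_cvg FG (ad_obp ad) (ad_rhp ad) hz hp cx0 cy0 hn' lt0) => i h [_].
  by rewrite leNgt h.
have hB : \forall i \near G, ~ (thinB (dom P) (glo P) e (z i) /\
    dot (gammam (obm P) (z i)) (p i) <= rhm P (xpart (z i)) (ypart (z i))).
  have [E|ne] := pselect (ypart z0 = e * glo P (xpart z0)); last first.
    by apply: filterS (hTB _ (ad_glo ad) ne) => i ni [[_ E] _].
  have lt0 : rhm P (xpart z0) (ypart z0) < dot (gammam (obm P) z0) p0.
    by rewrite ltNge; apply/negP => le0; apply: nt; constructor 4.
  apply: filterS (gammap_cvg FG (ad_obm ad) (ad_rhm ad) hz hp cx0 cy0 hn' lt0) => i h [_].
  by rewrite leNgt h.
apply: filterS (filterI hF (filterI hL (filterI hT hB))) => i [h1 [h2 [h3 h4]]].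
case => //; first by rewrite leNgt h1.
by move=> [[bx _] le]; exact: h2.
Qed.

End OpenConditions.

Section OpenConditionsGe.
Context {R : realType} {N : nat}.
Variable P : problem R N.
Hypothesis ad : admissible P.

Lemma not_tge_open (I : Type) (G : set_system I) (FG : Filter G)
    (X : I -> 'M[R]_(N + 1)) (p : I -> 'rV[R]_(N + 1)) (r : I -> R)
    (z : I -> 'rV[R]_(N + 1)) (X0 : 'M[R]_(N + 1)) (p0 : 'rV[R]_(N + 1)) (r0 : R)
    (z0 : 'rV[R]_(N + 1)) (e : R) :
  0 < e -> (forall w, thinK P e w -> -1 <= ypart w <= 1) ->
  X @ G --> X0 -> p @ G --> p0 -> r @ G --> r0 -> z @ G --> z0 ->
  X0^T = X0 -> thinK P e z0 ->
  (\forall i \near G, (X i)^T = X i /\ thinK P e (z i)) ->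
  ~ tge P e X0 p0 r0 z0 -> \forall i \near G, ~ tge P e (X i) (p i) (r i) (z i).
Proof.
move=> e0 ey hX hp hr hz sX Kz0 hn; rewrite tge_flip => nt.
have h : \forall i \near G, ~ tle (flip P) e (- X i) (- p i) (- r i) (z i).
  apply: (not_tle_open (admissible_flip ad) FG e0 ey (cvgN hX) (cvgN hp) (cvgN hr) hz) => //.
    by rewrite trmxN sX.
  by apply: filterS hn => i [sXi ?]; rewrite trmxN sXi.
by apply: filterS h => i; rewrite tge_flip.
Qed.

(** In the interior, the second order condition at a maximum and ellipticity
    apply. On the boundary the maximum is tested along a ray that enters the
    domain, in a direction that combines the oblique field and the normal:
    at an edge two boundary conditions fail at once and both have to be
    contradicted. *)
Lemma strict_classical_touching (e t : R) (f : 'rV[R]_(N + 1) -> R) g H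
    (phi : 'rV[R]_(N + 1) -> R) (z : 'rV[R]_(N + 1)) :
  0 < e -> 0 < t -> thinK P e z ->
  inward_at P t e ->
  jet2 f g H -> C2 phi -> (forall w, thinK P e w -> f w - phi w <= f z - phi z) ->
  ~ tge P e (H z) (g z) (f z) z ->
  tle P e (hess phi z) (grad phi z) (f z) z.
Proof.
move=> e0 t0 Kz inw jf Cphi hmax ng; have [cy nt gt_ gb] := inw z Kz.
have jd := jet2D jf (jet2N (jet2_C2 Cphi)); have [Cd gd Hd] := jd.
have [cx /andP[y1 y2]] := thinK_sub ad e0 Kz.
set x := xpart z in nt gt_ gb cx y1 y2; set y := ypart z in cy nt gt_ gb y1 y2.
have [Ff nL nT nB] : [/\ eqn P (H z) (g z) (f z) x y < 0,
   bdry (dom P) x -> dot (nrm P x) (xpart (g z)) < 0,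
   y = e * gup P x -> dot (gammap (obp P) z) (g z) < rhp P x y &
   y = e * glo P x -> dot (gammam (obm P) z) (g z) < rhm P x y].
  split; [| move=> bx | move=> E | move=> E]; rewrite ltNge; apply/negP => ?; apply: ng.
  - by constructor 1.
  - by constructor 2; split=> //; split => //; apply/andP.
  - by constructor 3.
  - by constructor 4.
apply: contrapT => nle.
have [Fp pL pT pB] : [/\ 0 < eqn P (hess phi z) (grad phi z) (f z) x y,
   bdry (dom P) x -> 0 < dot (nrm P x) (xpart (grad phi z)),
   y = e * gup P x -> rhp P x y < dot (gammap (obp P) z) (grad phi z) &
   y = e * glo P x -> rhm P x y < dot (gammam (obm P) z) (grad phi z)].
  split; [| move=> bx | move=> E | move=> E]; rewrite ltNge; apply/negP => ?; apply: nle.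
  - by constructor 1.
  - by constructor 2; split=> //; split => //; apply/andP.
  - by constructor 3.
  - by constructor 4.
have glt : glo P x < gup P x := ad_lt ad cx.
have dirle (d : 'rV[R]_(N + 1)) :
  (bdry (dom P) x -> dot (nrm P x) (xpart d) < 0) ->
  (y = e * gup P x -> ypart d < e * dot (grad (gup P) x) (xpart d)) ->
  (y = e * glo P x -> e * dot (grad (glo P) x) (xpart d) < ypart d) ->
  dot (g z) d <= dot (grad phi z) d.
  move=> d1 d2 d3; rewrite -subr_le0 -dotBl.
  have -> : g z - grad phi z = grad (fun x => f x + - phi x) z by rewrite gd.
  apply: dir_deriv_le; first exact: Cd.1.
  apply: filterS (ray_inward ad e0 Kz d1 d2 d3) => s hs; apply: hmax.
  exact: thin_sub_K.
have nE : bdry (dom P) x -> nrm0 P x = nrm P x by rewrite /nrm0; case: pselect.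
have nE0 : ~ bdry (dom P) x -> nrm0 P x = 0 by rewrite /nrm0; case: pselect.
have n1 : bdry (dom P) x -> dot (nrm P x) (nrm P x) = 1.
  by move=> bx; exact: nu_unit (ad_nrm ad) _ bx.
have ngrad : 0 <= t * (dot (grad phi z) (row_mx (nrm0 P x) 0%:M) - dot (g z) (row_mx (nrm0 P x) 0%:M)).
  rewrite mulr_ge0 ?(ltW t0)// !dot_parts !xpart_row !ypart_row !mulr0 !addr0.
  have [bx|nbx] := pselect (bdry (dom P) x); last by rewrite nE0// !dot0r subrr.
  by rewrite nE// !(dotC _ (nrm P x)) subr_ge0 ltW// (lt_trans (nL bx) (pL bx)).
have [ET|nET] := pselect (y = e * gup P x).
  have := dirle (- row_mx (obp P x y + t *: nrm0 P x) 1%:M).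
  rewrite xpartN ypartN xpart_row ypart_row !dotNr lerN2 => h.
  have : dot (grad phi z) (row_mx (obp P x y + t *: nrm0 P x) 1%:M) <=
      dot (g z) (row_mx (obp P x y + t *: nrm0 P x) 1%:M).
    apply: h.
    - move=> bx; have [h _] := nt bx; rewrite nE// dotDr dotZr n1// mulr1 oppr_lt0.
      by rewrite -ltrBlDl sub0r.
    - by rewrite mulrN ltrN2.
    - move=> E; exfalso; move: glt; rewrite -(ltr_pM2l e0) -ET -E ltxx; by [].
  have -> : row_mx (obp P x y + t *: nrm0 P x) 1%:M =
    gammap (obp P) z + t *: row_mx (nrm0 P x) 0%:M.
    by rewrite /gammap scale_row_mx add_row_mx scale_scalar_mx mulr0 raddf0 addr0.
  rewrite !dotDr !dotZr; move: (pT ET) (nT ET) ngrad; rewrite !(dotC (gammap _ _)).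
  move: (dot _ _) (dot _ _) (dot _ _) (dot _ _) (rhp _ _ _) => a b c d b0.
  rewrite mulrBr; lra.
have [EB|nEB] := pselect (y = e * glo P x).
  have := dirle (- row_mx (obm P x y + t *: nrm0 P x) (-1)%:M).
  rewrite xpartN ypartN xpart_row ypart_row !dotNr lerN2 => h.
  have : dot (grad phi z) (row_mx (obm P x y + t *: nrm0 P x) (-1)%:M) <=
      dot (g z) (row_mx (obm P x y + t *: nrm0 P x) (-1)%:M).
    apply: h.
    - move=> bx; have [_ h] := nt bx; rewrite nE// dotDr dotZr n1// mulr1 oppr_lt0.
      by rewrite -ltrBlDl sub0r.
    - by [].
    - by move=> E; rewrite opprK.
  have -> : row_mx (obm P x y + t *: nrm0 P x) (-1)%:M =
    gammam (obm P) z + t *: row_mx (nrm0 P x) 0%:M.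
    by rewrite /gammam scale_row_mx add_row_mx scale_scalar_mx mulr0 raddf0 addr0.
  rewrite !dotDr !dotZr; move: (pB EB) (nB EB) ngrad; rewrite !(dotC (gammam _ _)).
  move: (dot _ _) (dot _ _) (dot _ _) (dot _ _) (rhm _ _ _) => a b c d b0.
  rewrite mulrBr; lra.
have [bx|nbx] := pselect (bdry (dom P) x).
  have := dirle (- row_mx (nrm P x) 0%:M).
  rewrite xpartN ypartN xpart_row ypart_row !dotNr lerN2 n1// => h.
  have := h (fun=> ltac:(by rewrite ltrN10)) (fun E => False_ind _ (nET E)) (fun E => False_ind _ (nEB E)).
  rewrite !dot_parts xpart_row ypart_row !mulr0 !addr0 !(dotC _ (nrm P x)).
  by rewrite leNgt (lt_trans (nL bx) (pL bx)).
have zin : thin (dom P) (gup P) (glo P) e z.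
  split; first exact: closure_bdry.
  by rewrite !lt_neqAle y1 y2 !andbT; apply/andP; split; apply/eqP => // E; apply: nEB.
have nmax : \forall w \near z, f w + - phi w <= f z + - phi z.
  have : nbhs z (thin (dom P) (gup P) (glo P) e).
    by apply: open_nbhs_nbhs; split=> //; exact: thin_open.
  by apply: filterS => w /thin_sub_K/hmax.
have g0 := grad0_at_max (Cd.1 z) nmax.
have H0 v := hess_le0_at_max v Cd nmax.
have Eg : g z = grad phi z by apply/eqP; rewrite -subr_eq0; have := g0; rewrite gd => ->.
have [alpha a0 mono] := ad_mono ad.
have := mono (g z) x y cx cy (hess phi z) (H z) (f z) (f z) (hess_sym z Cphi) (jet2_sym z jf).
have ell : mxge (hess phi z) (H z).
  move=> v; have := H0 v; rewrite Hd -opprB mulmxN dotNl oppr_le0.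
  by rewrite -(opprB (H z)).
move=> /(_ ell (lexx _)); rewrite lerD2r {1}Eg => /le_lt_trans/(_ Ff).
by rewrite ltNge (ltW Fp).
Qed.

End OpenConditionsGe.

(** * Perron's method *)

Section SquareDistance.
Context {R : realType} {n : nat}.

Definition sqdist (k : R) (z0 z : 'rV[R]_n) : R := k * dot (z - z0) (z - z0).

Lemma jet2_sqdist k z0 :
  jet2 (sqdist k z0) (fun z => (2 * k) *: (z - z0)) (fun=> (2 * k)%:M).
Proof.
have sQ : ((2 * k)%:M : 'M[R]_n)^T = (2 * k)%:M by rewrite tr_scalar_mx.
have := jet2_quad (k * dot z0 z0) (- (2 * k) *: z0) sQ.
have -> : quad (k * dot z0 z0) (- (2 * k) *: z0) (2 * k)%:M = sqdist k z0.
  apply/funext => z; rewrite /quad /sqdist mul_mx_scalar !dot_lin (dotC z z0).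
  by move: (dot _ _) (dot _ _) (dot _ _) => a b c; field.
have -> // : (fun z : 'rV[R]_n => - (2 * k) *: z0 + z *m (2 * k)%:M) =
  fun z => (2 * k) *: (z - z0).
by apply/funext => z; rewrite mul_mx_scalar scaleNr scalerBr addrC.
Qed.

Lemma jet2_cst (c : R) : jet2 (fun _ : 'rV[R]_n => c) (fun=> 0) (fun=> 0).
Proof.
have := jet2_quad c (0 : 'rV[R]_n) (trmx0 R n n).
have -> : quad c (0 : 'rV[R]_n) 0 = fun=> c.
  by apply/funext => z; rewrite /quad mulmx0 !dot0l mulr0 !addr0.
have -> : (fun z : 'rV[R]_n => 0 + z *m (0 : 'M[R]_n)) = fun=> 0.
  by apply/funext => z; rewrite mulmx0 addr0.
by [].
Qed.

Lemma sqdist_ge k z0 z : 0 <= k -> k * `|z - z0| ^+ 2 <= sqdist k z0 z.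
Proof. by move=> k0; rewrite /sqdist ler_wpM2l// norm_sq_le_dot. Qed.

Lemma sqdist_ge0 k z0 z : 0 <= k -> 0 <= sqdist k z0 z.
Proof. by move=> k0; rewrite mulr_ge0// dot_ge0. Qed.

Lemma sqdist0 k z0 : sqdist k z0 z0 = 0.
Proof. by rewrite /sqdist subrr dot0l mulr0. Qed.

Lemma norm_lt_of_sqdist k z0 z (d : R) : 0 < k -> 0 < d ->
  sqdist k z0 z < k * d ^+ 2 -> `|z - z0| < d.
Proof.
move=> k0 d0 h; rewrite -(@ltr_pXn2r _ 2) ?nnegrE ?normr_ge0 ?(ltW d0)//.
by rewrite -(ltr_pM2l k0); apply: le_lt_trans h; apply: sqdist_ge; exact: ltW.
Qed.

End SquareDistance.

Section Sequences.
Context {R : realType}.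

Lemma cvg_inv_succ : ((n.+1%:R)^-1 : R) @[n --> \oo] --> (0 : R).
Proof. exact: cvg_harmonic. Qed.

Lemma cvg_of_dist m n (A : nat -> 'M[R]_(m, n)) B :
  (forall k, `|A k - B| < (k.+1%:R)^-1) -> A @ \oo --> B.
Proof.
move=> h; apply/cvgrPdist_lt => e e0.
have := cvg_inv_succ => /cvgr_lt/(_ e e0); apply: filterS => k hk.
by rewrite distrC; apply: lt_trans hk.
Qed.

Lemma cvg_of_dist_real (A : nat -> R) B :
  (forall k, `|A k - B| < (k.+1%:R)^-1) -> A @ \oo --> B.
Proof.
move=> h; apply/cvgrPdist_lt => e e0.
have := cvg_inv_succ => /cvgr_lt/(_ e e0); apply: filterS => k hk.
by rewrite distrC; apply: lt_trans hk.
Qed.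

Lemma inv_succ_gt0 k : (0 : R) < (k.+1%:R)^-1.
Proof. by rewrite invr_gt0. Qed.

Lemma continuous_norm n (f : 'rV[R]_n -> R) z (e : R) : {for z, continuous f} -> 0 < e ->
  exists2 d : R, 0 < d & forall w, `|w - z| < d -> `|f w - f z| < e.
Proof.
move=> /cvgrPdist_lt cf e0; have [d d0 hd] := norm_near (cf e e0).
by exists d => // w /hd; rewrite distrC.
Qed.

End Sequences.

Section Perron.
Context {R : realType} {N : nat}.
Variable P : problem R N.
Hypothesis ad : admissible P.
Variables (e t C : R).
Local Notation K := (thinK P e).
Local Notation sub := (visc_sub K (tle P e)).
Hypotheses (e0 : 0 < e) (t0 : 0 < t).
Hypothesis inward : inward_at P t e.
Hypothesis sub_le : forall w, sub w -> forall z, K z -> w z <= C.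
Variable w0 : 'rV[R]_(N + 1) -> R.
Hypothesis sub_w0 : sub w0.

Definition perron (z : 'rV[R]_(N + 1)) : R := sup [set w z | w in [set w | sub w]].
Local Notation u := perron.

Let yK z : K z -> -1 <= ypart z <= 1. Proof. by move=> /inward[]. Qed.

Let hsup z : K z -> has_sup [set w z | w in [set w | sub w]].
Proof.
move=> Kz; split; first by exists (w0 z), w0.
by exists C => _ [w sw <-]; exact: sub_le.
Qed.

Lemma perron_ge w z : sub w -> K z -> w z <= u z.
Proof. by move=> sw Kz; apply: ub_le_sup; [exact: (hsup Kz).2|exists w]. Qed.

Lemma perron_le z : K z -> u z <= C.
Proof.
move=> Kz; apply: ge_sup; first by exists (w0 z), w0.
by move=> _ [w sw <-]; exact: sub_le.
Qed.

Lemma perron_bnd : exists B, bnd_on K u B.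
Proof.
have [B hB] := (bounded_bnd_on _ _).1 sub_w0.1.
exists (B + `|C|) => z Kz; rewrite ler_norml; apply/andP; split.
  rewrite lerNl; apply: (@le_trans _ _ (- w0 z)); first by rewrite lerN2 perron_ge.
  by apply: le_trans (ler_norm _) _; rewrite normrN -[leLHS]addr0 lerD// hB.
apply: le_trans (perron_le Kz) _; apply: le_trans (ler_norm _) _.
by rewrite lerDr; apply: le_trans (normr_ge0 (w0 z)) (hB _ Kz).
Qed.

(** The quadratic penalty makes the maximum at z0 strict, so a single
    subsolution close to the supremum near z0 attains its maximum, after
    penalization, near z0 as well. *)
Lemma perron_localize (phi : 'rV[R]_(N + 1) -> R) z0 (k r : R) :
  continuous phi -> K z0 ->
  (forall w, K w -> usc_env K u w - phi w <= usc_env K u z0 - phi z0) ->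
  0 < k -> 0 < r ->
  exists w z1, [/\ sub w, K z1, `|z1 - z0| < r,
    `|usc_env K w z1 - usc_env K u z0| < r &
    forall y, K y -> usc_env K w y - (phi y + sqdist k z0 y) <=
                     usc_env K w z1 - (phi z1 + sqdist k z0 z1)].
Proof.
move=> cphi Kz0 hmax k0 r0; have [B hB] := perron_bnd.
have r20 : 0 < r / 2 by rewrite divr_gt0.
have [d d0 hd] := continuous_norm (cphi z0) r20.
pose d1 := Num.min d r; have d10 : 0 < d1 by rewrite lt_min d0.
pose s := Num.min (r / 2) (k * d1 ^+ 2) / 3.
have s0 : 0 < s by rewrite divr_gt0// lt_min r20 mulr_gt0// exprn_gt0.
have s3 : 3 * s = Num.min (r / 2) (k * d1 ^+ 2) by rewrite /s mulrC divfK.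
have cpk : continuous (fun z => phi z + sqdist k z0 z).
  by apply: contD => //; exact: jet2_continuous (jet2_sqdist k z0).
have nV : \forall y \near z0, phi y + sqdist k z0 y < phi z0 + s.
  have := cpk z0 => /cvgr_lt /(_ (phi z0 + s)); rewrite sqdist0 addr0 ltrDl.
  by apply.
have [y [Ky hy uy]] := env_approx hB Kz0 s0 nV.
have [_ [w sw <-] wy] := sup_adherent s0 (hsup Ky).
have [Bw hBw] := (bounded_bnd_on _ _).1 sw.1.
have [z1 Kz1 hz1] : exists2 z, K z & forall x, K x ->
    usc_env K w x + - (phi x + sqdist k z0 x) <= usc_env K w z + - (phi z + sqdist k z0 z).
  apply: usc_attains_max; first exact: thinK_compact.
    by exists z0.
  by apply: usc_onD; [exact: env_usc hBw|apply: continuous_usc; exact: contN].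
have h1 : usc_env K u z0 - phi z0 - 3 * s < usc_env K w z1 - (phi z1 + sqdist k z0 z1).
  apply: lt_le_trans (hz1 _ Ky); have := env_ge hBw Ky; move: wy uy hy.
  rewrite -/(u y); move: (usc_env _ _ _) (usc_env _ _ _) (u y) (w y) (phi y + _) => a b c d2 f.
  by lra.
have h2 : usc_env K w z1 <= usc_env K u z1.
  by apply: env_mono hBw hB Kz1 _ => x Kx; exact: perron_ge.
have h3 := hmax z1 Kz1.
have sd : sqdist k z0 z1 < 3 * s by lra.
have zd : `|z1 - z0| < d1.
  apply: norm_lt_of_sqdist k0 d10 _; apply: lt_le_trans sd _.
  by rewrite s3 ge_min lexx orbT.
have zd1 : `|z1 - z0| < d by apply: lt_le_trans zd _; rewrite ge_min lexx.
exists w, z1; split => //.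
  by apply: lt_le_trans zd _; rewrite ge_min lexx orbT.
have := hd _ zd1; have s3r : 3 * s <= r / 2 by rewrite s3 ge_min lexx.
have sd0 := sqdist_ge0 z0 z1 (ltW k0).
rewrite !ltr_norml => /andP[a1 a2]; apply/andP; split; lra.
Qed.

(** The points where single subsolutions are touched converge to z0 with their
    jets, and the negation of the conditions to be proved is open. *)
Lemma perron_sub : sub u.
Proof.
have [B hB] := perron_bnd; split; first by apply/bounded_bnd_on; exists B.
move=> phi z0 Cphi Kz0 hmax; apply: contrapT => nt.
have jphi := jet2_C2 Cphi.
have hloc (n : nat) := perron_localize (jet2_continuous jphi) Kz0 hmax (inv_succ_gt0 n) (inv_succ_gt0 n).
have [f hf] := choice (fun n => hloc n).
have [z hz] := choice hf.
pose kk n : R := (n.+1%:R)^-1.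
have zc : z @ \oo --> z0 by apply: cvg_of_dist => n; have [] := hz n.
have rc : usc_env K (f n) (z n) @[n --> \oo] --> usc_env K u z0.
  by apply: cvg_of_dist_real => n; have [] := hz n.
have jp n := jet2D jphi (jet2_sqdist (kk n) z0).
have kc : (2 * kk n) @[n --> \oo] --> (2 * 0 : R).
  by apply: cvgMl_tmp; exact: cvg_inv_succ.
have Xc : hess phi (z n) + (2 * kk n)%:M @[n --> \oo] --> hess phi z0.
  rewrite -[X in _ --> X]addr0 -(raddf0 (@scalar_mx R (N + 1))) -[in X in _ --> X](mulr0 2).
  apply: cvgD; last exact: cvg_scalar_mx.
  by apply: cvg_comp zc (jet2_hess_continuous jphi (x := z0)).
have pc : grad phi (z n) + (2 * kk n) *: (z n - z0) @[n --> \oo] --> grad phi z0.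
  rewrite -[X in _ --> X]addr0 -(scale0r (z0 - z0)) -[in X in _ --> X](mulr0 2).
  apply: cvgD; first by apply: cvg_comp zc (jet2_grad_continuous jphi (x := z0)).
  by apply: cvgZ => //; apply: cvgB => //; exact: cvg_cst.
have hK : \forall n \near \oo, (hess phi (z n) + (2 * kk n)%:M)^T = hess phi (z n) + (2 * kk n)%:M
    /\ K (z n).
  by apply: nearW => n; split; [exact: jet2_sym (jp n)|have [] := hz n].
have no := not_tle_open ad _ e0 yK Xc pc rc zc (hess_sym z0 Cphi) Kz0 hK nt.
have [n hn] := filter_ex (no _).
apply: hn; have [[_ sf] Kz _ _ hm] := hz n; have [Cj gj Hj] := jp n.
by have := sf _ _ Cj Kz hm; rewrite gj Hj.
Qed.

Lemma env_max_le (K' : set 'rV[R]_(N + 1)) (v f : 'rV[R]_(N + 1) -> R) B B' z :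
  bnd_on K' v B -> bnd_on K' (fun w => Num.max (v w) (f w)) B' -> K' z ->
  {for z, continuous f} ->
  usc_env K' (fun w => Num.max (v w) (f w)) z <= Num.max (usc_env K' v z) (f z).
Proof.
move=> hB hB' Kz cf; apply/ler_addgt0Pr => d d0; apply: (env_le hB' Kz).
have h1 := env_near hB Kz d0.
have h2 : \forall w \near z, f w < f z + d.
  by move/cvgr_lt : cf => /(_ (f z + d)); rewrite ltrDl; apply.
apply: filterS (filterI h1 h2) => w [v1 f1] Kw; rewrite ge_max; apply/andP; split.
  by apply: ltW; apply: lt_le_trans (v1 Kw) _; rewrite lerD2r le_max lexx.
by apply: ltW; apply: lt_le_trans f1 _; rewrite lerD2r le_max lexx orbT.
Qed.

(** If the supremum failed to be a supersolution at a point, a strict classical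
    subsolution touching it from below could be lifted slightly and glued to
    it, which contradicts maximality. *)
Lemma perron_super : visc_super K (tge P e) u.
Proof.
have [B hB] := perron_bnd; split; first by apply/bounded_bnd_on; exists B.
move=> phi z0 Cphi Kz0 hmin; apply: contrapT => nt.
have hBN := bnd_onN hB.
have jphi := jet2_C2 Cphi.
set l := lsc_env K u z0 in nt.
have lle z : K z -> lsc_env K u z <= u z.
  by move=> Kz; rewrite lsc_envE lerNl; exact: env_ge hBN Kz.
(* a small quadratic correction keeps the strict inequalities at the point *)
have [k k0 nk] : exists2 k : R, 0 < k &
    ~ tge P e (hess phi z0 - (2 * k)%:M) (grad phi z0) l z0.
  have Xc : hess phi z0 - (2 * k)%:M @[k --> 0^'+] --> hess phi z0.
    rewrite -[X in _ --> X]subr0 -(raddf0 (@scalar_mx R (N + 1))) -[in X in _ --> X](mulr0 2).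
    apply: cvgB; first exact: cvg_cst.
    by apply: cvg_scalar_mx; apply: cvgMl_tmp; exact: cvg_at_right_filter.
  have FG : Filter (0 : R)^'+ by exact: at_right_proper_filter.
  have no := not_tge_open ad FG e0 yK Xc (cvg_cst (grad phi z0)) (cvg_cst l) (cvg_cst z0)
    (hess_sym z0 Cphi) Kz0.
  have hn : \forall k \near 0^'+, (hess phi z0 - (2 * k)%:M)^T = hess phi z0 - (2 * k)%:M /\ K z0.
    by apply: nearW => k; rewrite linearB /= tr_scalar_mx hess_sym.
  have [k [k0 hk]] := filter_ex (filterI (nbhs_right_gt 0) (no FG FG FG hn nt)).
  by exists k.
pose c d := l - phi z0 + d.
pose f d z := (phi z + c d) + - sqdist k z0 z.
have jf d : jet2 (f d) (fun z => (grad phi z + 0) + - ((2 * k) *: (z - z0)))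
    (fun z => (hess phi z + 0) + - (2 * k)%:M).
  apply: jet2D; last exact: jet2N (jet2_sqdist k z0).
  exact: jet2D jphi (jet2_cst (c d)).
have [d0 d00 hd0] : exists2 d0 : R, 0 < d0 & forall d z, K z -> `|z - z0| < d0 -> 0 <= d < d0 ->
    ~ tge P e (hess phi z + 0 - (2 * k)%:M) (grad phi z + 0 - (2 * k) *: (z - z0)) (f d z) z.
  have [hc gc Hc] := jf 0.
  pose G := filter_prod (within K (nbhs z0)) (nbhs (0 : R)).
  have FG : Filter G by exact: filter_prod_filter.
  have zc : p.1 @[p --> G] --> z0.
    move=> A zA; exists (A, setT); last by move=> [? ?] [].
    split; last exact: filterT.
    have : \forall w \near z0, K w -> A w by apply: filterS zA => w Aw _.
    by [].
  have dc : p.2 @[p --> G] --> (0 : R) by exact: cvg_snd.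
  have Xc : hess phi p.1 + 0 - (2 * k)%:M @[p --> G] --> hess phi z0 - (2 * k)%:M.
    apply: cvgB; last exact: cvg_cst.
    rewrite -[X in _ --> X]addr0; apply: cvgD; last exact: cvg_cst.
    by apply: cvg_comp zc (jet2_hess_continuous jphi (x := z0)).
  have pc : grad phi p.1 + 0 - (2 * k) *: (p.1 - z0) @[p --> G] --> grad phi z0.
    have -> : grad phi z0 = grad phi z0 + 0 - (2 * k) *: (z0 - z0).
      by rewrite subrr scaler0 subr0 addr0.
    apply: cvgB.
      apply: cvgD; last exact: cvg_cst.
      by apply: cvg_comp zc (jet2_grad_continuous jphi (x := z0)).
    by apply: cvgZ; [exact: cvg_cst|apply: cvgB => //; exact: cvg_cst].
  have rc : f p.2 p.1 @[p --> G] --> l.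
    have -> : l = phi z0 + (l - phi z0 + 0) - sqdist k z0 z0.
      by rewrite sqdist0 addr0 subr0 addrC subrK.
    apply: cvgB; last by apply: cvg_comp zc (jet2_continuous (jet2_sqdist k z0) (x := z0)).
    apply: cvgD; first by apply: cvg_comp zc (jet2_continuous jphi (x := z0)).
    by apply: cvgD => //; exact: cvg_cst.
  have hn : \forall p \near G, (hess phi p.1 + 0 - (2 * k)%:M)^T = hess phi p.1 + 0 - (2 * k)%:M /\ K p.1.
    exists (K, setT); first by split; [exact: withinT|exact: filterT].
    move=> [z d] [/= Kz _]; split => //; exact: jet2_sym (jf 0).
  have sX : (hess phi z0 - (2 * k)%:M)^T = hess phi z0 - (2 * k)%:M.
    by rewrite linearB /= tr_scalar_mx hess_sym.
  have [[Q1 Q2] /= [q1 q2] hQ] := not_tge_open ad FG e0 yK Xc pc rc zc sX Kz0 hn nk.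
  have [d1 d10 h1] := norm_near (q1 : \forall z \near z0, K z -> Q1 z).
  move/nbhs_ballP : q2 => [d2 /= d20 h2].
  exists (Num.min d1 d2); first by rewrite lt_min d10.
  move=> d z Kz; rewrite !lt_min => /andP[z1 _] /andP[dg /andP[_ dl]].
  apply: (hQ (z, d)); split => /=; first exact: h1.
  by apply: h2; rewrite /ball /= sub0r normrN ger0_norm.
pose d := Num.min (d0 / 2) (k * (d0 / 2) ^+ 2).
have dgt0 : 0 < d by rewrite lt_min divr_gt0// mulr_gt0// exprn_gt0// divr_gt0.
have dlt : d < d0.
  by apply: (@le_lt_trans _ _ (d0 / 2)); [rewrite ge_min lexx|rewrite ltr_pdivrMr// ltr_pMr// ltr1n].
have f_le z : K z -> f d z <= u z + d - sqdist k z0 z.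
  move=> Kz; have := hmin z Kz; have := lle z Kz; rewrite /f /c -/l.
  move: (u z) (lsc_env _ _ z) (phi z) (phi z0) (sqdist _ _ _) => a b c1 c2 c3.
  by lra.
have near_touch z : K z -> u z < f d z -> `|z - z0| < d0.
  move=> Kz uf; have h : sqdist k z0 z < d by have := f_le z Kz; lra.
  apply: lt_trans (_ : `|z - z0| < d0 / 2) _; last by rewrite ltr_pdivrMr// ltr_pMr// ltr1n.
  apply: norm_lt_of_sqdist k0 _ _; first by rewrite divr_gt0.
  by apply: lt_le_trans h _; rewrite ge_min lexx orbT.
have [Cf gf Hf] := jf d.
have cf : continuous (f d) by exact: jet2_continuous (jf d).
have [Bf _ hBf] := cont_on_bounded (thinK_compact ad e0) (continuous_cont_on (A := K) cf).
pose W z := Num.max (u z) (f d z).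
have hBW : bnd_on K W (Num.max B Bf).
  move=> z Kz; rewrite /W; case: (leP (u z) (f d z)) => _; rewrite le_max.
    by rewrite hBf// orbT.
  by rewrite hB.
have sW : sub W.
  split; first by apply/bounded_bnd_on; exists (Num.max B Bf).
  move=> psi z1 Cpsi Kz1 hmax.
  have uW z : K z -> usc_env K u z <= usc_env K W z.
    by move=> Kz; apply: env_mono hB hBW Kz _ => w Kw; rewrite le_max lexx.
  have fW z : K z -> f d z <= usc_env K W z.
    by move=> Kz; apply: le_trans (env_ge hBW Kz); rewrite le_max lexx orbT.
  have := env_max_le hB hBW Kz1 (cf z1); case: (leP (f d z1) (usc_env K u z1)) => cmp Wle.
    have E : usc_env K W z1 = usc_env K u z1 by apply/eqP; rewrite eq_le Wle uW.
    rewrite E; apply: (perron_sub.2 psi z1 Cpsi Kz1) => w Kw; rewrite -E.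
    by apply: le_trans (hmax w Kw); rewrite lerD2r uW.
  have E : usc_env K W z1 = f d z1 by apply/eqP; rewrite eq_le Wle fW.
  rewrite E; apply: (strict_classical_touching ad e0 t0 Kz1 inward (jf d) Cpsi).
    by move=> w Kw; rewrite -E; apply: le_trans (hmax w Kw); rewrite lerD2r fW.
  apply: hd0 => //; last by rewrite ltW.
  by apply: near_touch => //; apply: le_lt_trans cmp; exact: env_ge hB Kz1.
have d20 : 0 < d / 2 by rewrite divr_gt0.
have nf : \forall w \near z0, f d z0 - d / 2 < f d w.
  by have := cf z0 => /cvgr_gt /(_ (f d z0 - d / 2)); rewrite gtrDl oppr_lt0; apply.
have [w [Kw fw uw]] := env_approx hBN Kz0 d20 nf.
have := perron_ge sW Kw; rewrite ge_max lexx /= => fu.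
have fz : f d z0 = l + d by rewrite /f /c sqdist0 subr0; ring.
have ll : l = - usc_env K (fun w => - u w) z0 by rewrite /l lsc_envE.
move: uw fu fw; rewrite fz ll; move: (usc_env _ _ _) (u w) (f d w) => a b c1.
by lra.
Qed.

Lemma perron_solution : exists v, visc_sub K (tle P e) v /\ visc_super K (tge P e) v.
Proof. by exists u; split; [exact: perron_sub|exact: perron_super]. Qed.

End Perron.

(** * Barriers *)

Ltac nonneg := repeat first
  [ assumption | done | apply: ltW; assumption | rewrite invr_ge0
  | apply: addr_ge0 | apply: mulr_ge0 ].

Section BlockQuadratic.
Context {R : realType} {N : nat}.

(** The general quadratic polynomial of (x, y), by blocks. *)
Definition bquad (c : R) (l : 'rV[R]_N) (a : R) (Q : 'M[R]_N) (w : 'rV[R]_N) (m : R)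
    (z : 'rV[R]_(N + 1)) : R :=
  c + dot l (xpart z) + a * ypart z +
  2^-1 * (dot (xpart z *m Q) (xpart z) + 2 * (ypart z * dot w (xpart z)) + m * ypart z ^+ 2).

Definition bquad_grad (l : 'rV[R]_N) (a : R) (Q : 'M[R]_N) (w : 'rV[R]_N) (m : R)
    (z : 'rV[R]_(N + 1)) : 'rV[R]_(N + 1) :=
  row_mx (l + xpart z *m Q + ypart z *: w) (a + dot w (xpart z) + m * ypart z)%:M.

Definition bquad_hess (Q : 'M[R]_N) (w : 'rV[R]_N) (m : R) : 'M[R]_(N + 1) :=
  block_mx Q w^T w m%:M.

Lemma bquad_hess_sym (Q : 'M[R]_N) w m : Q^T = Q -> (bquad_hess Q w m)^T = bquad_hess Q w m.
Proof. by move=> sQ; rewrite /bquad_hess tr_block_mx sQ trmxK tr_scalar_mx. Qed.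

Lemma sym_addI (Q : 'M[R]_N) (a : R) : Q^T = Q -> (Q + a%:M)^T = Q + a%:M.
Proof. by move=> sQ; apply/matrixP => i j; rewrite -[in RHS]sQ !mxE eq_sym. Qed.

Lemma mulmx_bquad_hess Q w m (z : 'rV[R]_(N + 1)) :
  z *m bquad_hess Q w m =
  row_mx (xpart z *m Q + ypart z *: w) (dot w (xpart z) + m * ypart z)%:M.
Proof.
rewrite {1}(row_parts z) /bquad_hess mul_row_block; congr row_mx.
  by rewrite mul_scalar_mx.
rewrite -scalar_mxM mulrC raddfD /=; congr (_ + _); apply/matrixP => i j.
by rewrite (ord1 i) (ord1 j) [RHS]mxE eqxx mulr1n dotC.
Qed.

Lemma jet2_bquad c l a (Q : 'M[R]_N) w m : Q^T = Q ->
  jet2 (bquad c l a Q w m) (bquad_grad l a Q w m) (fun=> bquad_hess Q w m).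
Proof.
move=> sQ; have sH := bquad_hess_sym w m sQ.
have := jet2_quad c (row_mx l a%:M) sH.
have -> : quad c (row_mx l a%:M) (bquad_hess Q w m) = bquad c l a Q w m.
  apply/funext => z; rewrite /quad mulmx_bquad_hess !dot_parts !xpart_row !ypart_row /bquad.
  rewrite dotDl dotZl mulrDl.
  by move: (dot _ _) (dot _ _) (dot _ _) (ypart z) => d1 d2 d3 y; field.
have -> // : (fun z => row_mx l a%:M + z *m bquad_hess Q w m) = bquad_grad l a Q w m.
apply/funext => z; rewrite mulmx_bquad_hess add_row_mx /bquad_grad !addrA.
by congr row_mx; rewrite !raddfD /= addrA.
Qed.

End BlockQuadratic.

Section SmallParameter.
Context {R : realType}.

Lemma slack_add (a b c : R) : c + 2 <= a -> -1 <= b -> c + 1 <= a + b.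
Proof. by move=> ? ?; lra. Qed.

Lemma near0_mul_lt (c d : R) : 0 < d -> \forall e \near 0^'+, e * c < d.
Proof.
move=> d0; have : e * c @[e --> 0^'+] --> 0 * c.
  by apply: cvgMr_tmp; exact: cvg_at_right_filter.
by rewrite mul0r => /cvgr_lt/(_ d d0).
Qed.

End SmallParameter.

Section LateralSlope.
Context {R : realType} {N : nat}.
Variables (Om : set 'rV[R]_N) (nu : 'rV[R]_N -> 'rV[R]_N).
Hypotheses (Om_open : open Om) (Om_bnd : bounded_set Om)
  (nuP : outward_unit_normal Om nu).

Definition wedge (M : R) (xi x : 'rV[R]_N) : R :=
  M * dot (x - xi) (x - xi) + dot (nu xi) (x - xi).

(** The infimum over boundary points xi of these paraboloids is a substitute for
    a smooth defining function: where a paraboloid is almost minimal at a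
    boundary point, xi is close and its slope in the normal direction is
    bounded from below. *)
Lemma wedge_slope : exists M s : R, [/\ 0 < M, 0 < s & forall x xi,
  bdry Om x -> bdry Om xi -> wedge M xi x <= s ->
  4^-1 <= dot (nu x) ((2 * M) *: (x - xi) + nu xi)].
Proof.
set n : R := N%:R; have n0 : 0 <= n by [].
pose e := (4 * (n + 2))^-1.
have n2 : 0 < n + 2 by rewrite ltr_wpDl.
have e0 : 0 < e by rewrite invr_gt0 mulr_gt0.
have en : e * (n + 2) = 4^-1 by rewrite /e invfM -mulrA mulVf ?mulr1// gt_eqF.
have e8 : e <= 8^-1 by rewrite lef_pV2 ?posrE ?mulr_gt0//; lra.
have [t0 t00 flat] := bdry_flat Om_open Om_bnd nuP e0.
have [M [M0 Mt0]] : exists M : R, 0 < M /\ M * t0 = n + 1.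
  by exists ((n + 1) / t0); rewrite divfK ?gt_eqF// divr_gt0// ltr_wpDl.
exists M, (Num.min (t0 / 2) (2 * M)^-1); split=> //.
  by rewrite lt_min divr_gt0//= invr_gt0 mulr_gt0.
move=> x xi bx bxi; rewrite le_min /wedge => /andP[w1 w2].
have nx := nu_norm nuP bx; have nxi := nu_norm nuP bxi.
set t := `|x - xi|; have tge : 0 <= t by exact: normr_ge0.
have sq : M * t ^+ 2 <= M * dot (x - xi) (x - xi) by rewrite ler_pM2l// norm_sq_le_dot.
have [tt0|tt0] := leP t0 t.
  exfalso; have hq : `|dot (nu xi) (x - xi)| <= n * t.
    apply: le_trans (dot_le_norm _ _) _; rewrite ler_wpM2l//.
    by rewrite -[leRHS]mul1r ler_pM.
  move: hq; rewrite ler_norml => /andP[hq _].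
  have : n + 1 <= M * t by rewrite -Mt0 ler_pM2l.
  move: w1 sq hq tge tt0 t00; move: (dot _ _) (dot _ _) => a b; clear -t0; rewrite expr2; nra.
have [f1 f2] := flat x xi bx bxi tt0.
have tt0' : `|xi - x| < t0 by rewrite distrC.
have [f3 _] := flat xi x bxi bx tt0'; rewrite distrC -/t in f3.
have Mt : M * t <= 1.
  rewrite leNgt; apply/negP => Mt1.
  have : M * (M * t ^+ 2 - e * t) <= 2^-1.
    have w2' : M * t ^+ 2 - e * t <= (2 * M)^-1.
      apply: le_trans w2; move: f1; rewrite -/t ler_norml => /andP[f1 _]; lra.
    have : M * (M * t ^+ 2 - e * t) <= M * (2 * M)^-1 by rewrite ler_pM2l.
    by have -> // : M / (2 * M) = 2^-1; rewrite invfM mulrCA mulfV ?mulr1// gt_eqF.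
  have -> : M * (M * t ^+ 2 - e * t) = M * t * (M * t - e) by rewrite expr2; ring.
  by move: (M * t) Mt1 => s s1; nra.
have -> : (2 * M) *: (x - xi) + nu xi = nu x + (nu xi - nu x) - (2 * M) *: (xi - x).
  by rewrite -(opprB x xi) scalerN opprK addrC (addrC (nu x)) subrK.
rewrite dotBr dotDr dotZr (nu_unit nuP bx).
have g1 : `|dot (nu x) (nu xi - nu x)| <= n * e.
  apply: le_trans (dot_le_norm _ _) _; rewrite ler_wpM2l// -[leRHS]mul1r ler_pM//.
  by rewrite distrC.
have g2 : 2 * M * dot (nu x) (xi - x) <= 2 * e.
  apply: le_trans (ler_norm _) _; rewrite normrM gtr0_norm ?mulr_gt0//.
  apply: (@le_trans _ _ (2 * M * (e * t))); first by rewrite ler_wpM2l// mulr_ge0// ltW.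
  have -> : 2 * M * (e * t) = 2 * e * (M * t) by ring.
  by rewrite -[leRHS]mulr1 ler_wpM2l// mulr_ge0// ltW.
move: g1; rewrite ler_norml => /andP[g1 _].
have : n * e + 2 * e = 4^-1 by rewrite -en; ring.
move: (dot _ _) (2 * M * _) g1 g2 => a b g1 g2 E; lra.
Qed.

End LateralSlope.

Section Barrier.
Context {R : realType} {N : nat}.
Variable P : problem R N.
Hypothesis ad : admissible P.
Local Notation cl := (closure (dom P)).
Local Notation bd := (bdry (dom P)).

Definition params : set ('rV[R]_N * 'rV[R]_N) := bd `*` cl.

Definition gmean (x : 'rV[R]_N) : R := (gup P x + glo P x) / 2.

(** The slope in y for which the paraboloid based at xi satisfies, to leading
    order, both oblique conditions at zeta. *)
Definition defect (M : R) (xi zeta : 'rV[R]_N) : R :=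
  rh0 P zeta - dot (ob0 P zeta) ((2 * M) *: (zeta - xi) + nrm P xi).

(** The data are frozen at zeta, which is tied to x by a penalty, because the
    defect is merely Lipschitz in x. The parabola m y^2 / 2 is centred at
    the middle of the layer, so that its slope points outwards, with size of
    order e m, on the top and on the bottom. *)
Definition barrier (M m e : R) (t : 'rV[R]_N * 'rV[R]_N) : 'rV[R]_(N + 1) -> R :=
  bquad (M * dot t.1 t.1 - dot (nrm P t.1) t.1 + dot t.2 t.2)
    (nrm P t.1 - (2 * M) *: t.1 - 2 *: t.2)
    (defect M t.1 t.2 - e * m * gmean t.2) (2 * M + 2)%:M 0 m.

Definition barrier_grad (M m e : R) (t : 'rV[R]_N * 'rV[R]_N) : 'rV[R]_(N + 1) -> 'rV[R]_(N + 1) :=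
  bquad_grad (nrm P t.1 - (2 * M) *: t.1 - 2 *: t.2)
    (defect M t.1 t.2 - e * m * gmean t.2) (2 * M + 2)%:M 0 m.

Definition barrier_hess (M m : R) : 'M[R]_(N + 1) := bquad_hess (2 * M + 2)%:M 0 m.

Lemma jet2_barrier M m e t :
  jet2 (barrier M m e t) (barrier_grad M m e t) (fun=> barrier_hess M m).
Proof. by apply: jet2_bquad; rewrite tr_scalar_mx. Qed.

Lemma barrierE M m e t z : barrier M m e t z =
  wedge (nrm P) M t.1 (xpart z) + ypart z * (defect M t.1 t.2 - e * m * gmean t.2) +
  dot (xpart z - t.2) (xpart z - t.2) + 2^-1 * (m * ypart z ^+ 2).
Proof.
rewrite /barrier /bquad /wedge mul_mx_scalar !dot_lin.
rewrite (dotC (xpart z) t.1) (dotC (xpart z) t.2).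
move: (dot _ _) (dot _ _) (dot _ _) (dot _ _) (dot _ _) (dot _ _) (dot _ _) (ypart z)
  (defect _ _ _) (gmean _) => a1 a2 a3 a4 a5 a6 a7 y d g.
by field.
Qed.

Lemma barrier_gradE M m e t z : barrier_grad M m e t z =
  row_mx ((2 * M) *: (xpart z - t.1) + nrm P t.1 + 2 *: (xpart z - t.2))
    (defect M t.1 t.2 - e * m * gmean t.2 + m * ypart z)%:M.
Proof.
rewrite /barrier_grad /bquad_grad mul_mx_scalar scaler0 addr0 dot0l addr0; congr row_mx.
by apply/rowP => i; rewrite !mxE; ring.
Qed.

Lemma params_compact : compact params.
Proof.
apply: compact_setX; last exact: cl_compact.
exact: compact_bdry (ad_bnd ad).
Qed.

Lemma params_nonempty : params !=set0.
Proof.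
have [xi bxi] := bdry_nonempty (ad_open ad) (ad_bnd ad) (adN ad) (ad_ne ad).
by have [x Ox] := ad_ne ad; exists (xi, x); split => //=; exact: subset_closure.
Qed.

Lemma thin_midpoint e x : 0 < e -> dom P x ->
  thin (dom P) (gup P) (glo P) e (row_mx x (e * gmean x)%:M).
Proof.
move=> e0 Ox; have lt := ad_lt ad (subset_closure Ox).
rewrite /thin /= xpart_row ypart_row; split => //.
by rewrite !ltr_pM2l// /gmean; apply/andP; split; lra.
Qed.

Lemma C1vec_continuous m (f : 'rV[R]_N -> 'rV[R]_m) : C1vec f -> continuous f.
Proof.
move=> h x; apply: (@cvg_mxP _ _ _ _ (nbhs x)) => i j; rewrite (ord1 i).
exact: (C1_continuous (h j) (x := x)).
Qed.

Lemma barrier_cont M m e :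
  cont_on (params `*` [set: 'rV[R]_(N + 1)]) (fun p => barrier M m e p.1 p.2).
Proof.
apply: cont_on_near => I G FG X [[xi zeta] z] [[/= bxi czeta] _] hX hn.
have h1 : (X i).1 @[i --> G] --> (xi, zeta) by apply: cvg_comp hX (@cvg_fst _ _ _ _ _).
have hz : (X i).2 @[i --> G] --> z by apply: cvg_comp hX (@cvg_snd _ _ _ _ _).
have hxi : (X i).1.1 @[i --> G] --> xi by apply: cvg_comp h1 (@cvg_fst _ _ _ _ _).
have hzeta : (X i).1.2 @[i --> G] --> zeta by apply: cvg_comp h1 (@cvg_snd _ _ _ _ _).
have hnu : nrm P (X i).1.1 @[i --> G] --> nrm P xi.
  apply: (cont_on_cvg FG (nu_cont (ad_open ad) (ad_nrm ad))) => //.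
  by apply: filterS hn => i [[]].
have hx : xpart (X i).2 @[i --> G] --> xpart z by apply: cvg_comp hz (@xpart_continuous R N z).
have hy : ypart (X i).2 @[i --> G] --> ypart z by apply: cvg_comp hz (@ypart_continuous R N z).
rewrite barrierE; under eq_fun do rewrite barrierE.
have cC n (a : R) (f : I -> 'rV[R]_n) (f0 : 'rV[R]_n) : f @ G --> f0 -> a *: f i @[i --> G] --> a *: f0.
  by move=> hf; apply: cvgZ => //; exact: cvg_cst.
have hdef : defect M (X i).1.1 (X i).1.2 @[i --> G] --> defect M xi zeta.
  apply: cvgB; first by apply: cvg_comp hzeta (C1_continuous (ad_rh0 ad) (x := zeta)).
  apply: cvg_dot; first by apply: cvg_comp hzeta (C1vec_continuous (ad_ob0 ad) (x := zeta)).
  by apply: cvgD => //; apply: cC; exact: cvgB.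
have hg : gmean (X i).1.2 @[i --> G] --> gmean zeta.
  apply: cvgMr_tmp; apply: cvgD.
    by apply: cvg_comp hzeta (C1_continuous (ad_gup ad) (x := zeta)).
  by apply: cvg_comp hzeta (C1_continuous (ad_glo ad) (x := zeta)).
apply: cvgD; last by do 2!apply: cvgMl_tmp; rewrite expr2; apply: cvgM.
apply: cvgD; last by apply: cvg_dot; exact: cvgB.
apply: cvgD.
  by apply: cvgD; [apply: cvgMl_tmp|]; apply: cvg_dot => //; exact: cvgB.
by apply: cvgM => //; apply: cvgB => //; apply: cvgMl_tmp.
Qed.

Lemma lipschitz_on_cl (f : 'rV[R]_N -> R) : C1 f ->
  exists2 L : R, 0 <= L & forall x y, cl x -> cl y -> `|f x - f y| <= L * `|x - y|.
Proof.
move=> Cf; have [B B0 hB] := closure_Om_bounded (ad_bnd ad).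
have [L L0 hL] := C1_lipschitz B Cf; exists L => // x y cx cy.
by apply: hL; exact: hB.
Qed.

Lemma lipschitz_on_cl_vec (f : 'rV[R]_N -> 'rV[R]_N) : C1vec f ->
  exists2 L : R, 0 <= L & forall x y, cl x -> cl y -> `|f x - f y| <= L * `|x - y|.
Proof.
move=> Cf; have h i : exists L : R, 0 <= L /\ forall x y, cl x -> cl y ->
    `|f x 0 i - f y 0 i| <= L * `|x - y|.
  by have [L L0 hL] := lipschitz_on_cl (Cf i); exists L.
have [L hL] := choice h; exists (\sum_i L i).
  by apply: sumr_ge0 => i _; exact: (hL i).1.
move=> x y cx cy; apply: norm_le_coord.
  by rewrite mulr_ge0// sumr_ge0// => i _; exact: (hL i).1.
move=> i j; rewrite (ord1 i) !mxE; apply: le_trans ((hL j).2 x y cx cy) _.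
rewrite ler_wpM2r// (bigD1 j)//= lerDl.
by apply: sumr_ge0 => k _; exact: (hL k).1.
Qed.

Section FixedSlope.
Variable M : R.
Hypothesis M0 : 0 < M.

Definition wslope (xi x : 'rV[R]_N) : 'rV[R]_N := (2 * M) *: (x - xi) + nrm P xi.

Lemma wslope_bound : exists2 B : R, 0 <= B &
  forall x xi, cl x -> bd xi -> `|wslope xi x| <= B.
Proof.
have [B B0 hB] := closure_Om_bounded (ad_bnd ad).
have M2 : 0 <= 2 * M by rewrite mulr_ge0// ltW.
exists (2 * M * (B + B) + 1); first by rewrite addr_ge0// mulr_ge0// addr_ge0.
move=> x xi cx bxi; apply: le_trans (ler_normD _ _) _; apply: lerD.
  rewrite normrZ ger0_norm// ler_wpM2l//; apply: le_trans (ler_normB _ _) _.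
  by apply: lerD; apply: hB => //; case: bxi.
exact: nu_norm (ad_nrm ad) _ bxi.
Qed.

Lemma defectE xi x : defect M xi x = rh0 P x - dot (ob0 P x) (wslope xi x).
Proof. by []. Qed.

Lemma ob0_bound : exists2 B : R, 0 <= B & forall x, cl x -> `|ob0 P x| <= B.
Proof. exact: (continuous_bounded ad (C1vec_continuous (ad_ob0 ad))). Qed.

Lemma defect_bound : exists2 B : R, 0 <= B &
  forall x xi, cl x -> bd xi -> `|defect M xi x| <= B.
Proof.
have [Bb Bb0 hBb] := continuous_bounded ad (C1_continuous (ad_rh0 ad)).
have [Bg Bg0 hBg] := ob0_bound; have [Bv Bv0 hBv] := wslope_bound.
exists (Bb + N%:R * (Bg * Bv)); first by rewrite addr_ge0// !mulr_ge0.
move=> x xi cx bxi; rewrite defectE; apply: le_trans (ler_normB _ _) _; apply: lerD.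
  exact: hBb.
apply: le_trans (dot_le_norm _ _) _; rewrite ler_wpM2l// ler_pM//; [exact: hBg|exact: hBv].
Qed.

Lemma defect_lipschitz : exists2 L : R, 0 <= L & forall x y xi, cl x -> cl y -> bd xi ->
  `|defect M xi x - defect M xi y| <= L * `|x - y|.
Proof.
have [Lb Lb0 hLb] := lipschitz_on_cl (ad_rh0 ad).
have [Lg Lg0 hLg] := lipschitz_on_cl_vec (ad_ob0 ad).
have [Bg Bg0 hBg] := ob0_bound; have [Bv Bv0 hBv] := wslope_bound.
have M2 : 0 <= 2 * M by rewrite mulr_ge0// ltW.
exists (Lb + (N%:R * (Bg * (2 * M)) + N%:R * (Lg * Bv))).
  by nonneg.
move=> x y xi cx cy bxi; rewrite !defectE.
have -> : rh0 P x - dot (ob0 P x) (wslope xi x) - (rh0 P y - dot (ob0 P y) (wslope xi y)) =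
  (rh0 P x - rh0 P y) - (dot (ob0 P x) ((2 * M) *: (x - y)) +
     dot (ob0 P x - ob0 P y) (wslope xi y)).
  have -> : wslope xi x = (2 * M) *: (x - y) + wslope xi y.
    by rewrite /wslope addrA -scalerDr subrKA.
  rewrite dotDr dotBl; move: (dot _ _) (dot _ _) (dot _ _) (rh0 _ _) (rh0 _ _) => a b c d e.
  ring.
rewrite [leRHS]mulrDl; apply: le_trans (ler_normB _ _) _; apply: lerD; first exact: hLb.
rewrite [leRHS]mulrDl; apply: le_trans (ler_normD _ _) _; apply: lerD.
  apply: le_trans (dot_le_norm _ _) _; rewrite normrZ (ger0_norm M2) -!mulrA ler_wpM2l// ler_wpM2r ?hBg//.
  by rewrite !mulr_ge0// ltW.
apply: le_trans (dot_le_norm _ _) _; rewrite -!mulrA ler_wpM2l//.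
rewrite [Bv * _]mulrC mulrA ler_pM//; [exact: hLg|exact: hBv].
Qed.

(** Freezing the data at zeta costs the distance to zeta, and replacing the
    oblique field by its value at y = 0 costs r; only the term sg q is left
    to be positive. *)
Lemma oblique_estimate (L Bg Bv r d sg q b : R) (g1 x xi zeta : 'rV[R]_N) :
  0 <= Bg -> 0 <= Bv -> 0 <= r -> 0 <= d -> 0 <= L -> `|sg| = 1 ->
  `|defect M xi zeta - defect M xi x| <= L * `|x - zeta| ->
  `|ob0 P x| <= Bg -> `|wslope xi x| <= Bv ->
  `|g1 - sg *: ob0 P x| <= r -> `|b - sg * rh0 P x| <= r -> `|x - zeta| <= d ->
  sg * q - (L * d + N%:R * (r * Bv) + N%:R * ((Bg + r) * (2 * d)) + r) <=
  dot g1 (wslope xi x + 2 *: (x - zeta)) + sg * (defect M xi zeta + q) - b.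
Proof.
move=> Bg0 Bv0 r0 d0 L0 sg1 hL hBg hBv hg hb hd.
have E : dot g1 (wslope xi x + 2 *: (x - zeta)) + sg * (defect M xi zeta + q) - b =
  sg * q + (sg * (defect M xi zeta - defect M xi x) + (sg * rh0 P x - b) +
    dot (g1 - sg *: ob0 P x) (wslope xi x) + dot g1 (2 *: (x - zeta))).
  rewrite dotDr dotBl dotZl [defect M xi x]defectE.
  move: (dot _ _) (dot _ _) (dot _ _) (rh0 _ _) (defect _ _ _) => a1 a2 a3 a4 a5; ring.
rewrite E lerD2l; set A := sg * _; set B := sg * _ - b; set C := dot _ (wslope _ _).
have hA : `|A| <= L * d.
  rewrite normrM sg1 mul1r; apply: le_trans hL _; by rewrite ler_wpM2l.
have hB : `|B| <= r by rewrite distrC.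
have hC : `|C| <= N%:R * (r * Bv).
  by apply: le_trans (dot_le_norm _ _) _; rewrite ler_wpM2l// ler_pM.
have hD : `|dot g1 (2 *: (x - zeta))| <= N%:R * ((Bg + r) * (2 * d)).
  apply: le_trans (dot_le_norm _ _) _; rewrite ler_wpM2l// ler_pM//.
    have -> : g1 = sg *: ob0 P x + (g1 - sg *: ob0 P x) by rewrite addrC subrK.
    by apply: le_trans (ler_normD _ _) _; rewrite normrZ sg1 mul1r lerD.
  by rewrite normrZ ger0_norm// ler_wpM2l.
move: hA hB hC hD; rewrite !ler_norml => /andP[hA _] /andP[hB _] /andP[hC _] /andP[hD _].
move: (dot _ _) hD => D hD; lra.
Qed.

End FixedSlope.

Lemma gap_pos : exists2 d : R, 0 < d & forall x, cl x -> d <= gup P x - glo P x.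
Proof.
have cg : continuous (fun x => - (gup P x - glo P x)).
  apply: contN; apply: contD; first exact: C1_continuous (ad_gup ad).
  by apply: contN; exact: C1_continuous (ad_glo ad).
have [||x cx hx] := @usc_attains_max R _ cl (fun x => - (gup P x - glo P x)) (cl_compact ad).
- by have [x Ox] := ad_ne ad; exists x; exact: subset_closure.
- exact: continuous_usc.
exists (gup P x - glo P x); first by rewrite subr_gt0 ad_lt.
by move=> y /hx; rewrite lerN2.
Qed.

Lemma gmean_lipschitz : exists2 L : R, 0 <= L & forall x y, cl x -> cl y ->
  `|gmean x - gmean y| <= L * `|x - y|.
Proof.
have [L1 L10 h1] := lipschitz_on_cl (ad_gup ad).
have [L2 L20 h2] := lipschitz_on_cl (ad_glo ad).
exists (L1 + L2); first by rewrite addr_ge0.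
move=> x y cx cy.
have -> : gmean x - gmean y = ((gup P x - gup P y) + (glo P x - glo P y)) / 2.
  by rewrite /gmean; field.
rewrite normrM [X in _ * X]ger0_norm ?invr_ge0// ler_pdivrMr//; apply: le_trans (ler_normD _ _) _.
have := h1 x y cx cy; have := h2 x y cx cy; have := normr_ge0 (x - y).
move: (Num.norm _) (Num.norm _) (Num.norm _) => a b c; nra.
Qed.

Definition strictly_inward (e : R) (z p : 'rV[R]_(N + 1)) : Prop :=
  [/\ bd (xpart z) -> 0 < dot (nrm P (xpart z)) (xpart p),
     ypart z = e * gup P (xpart z) ->
       rhp P (xpart z) (ypart z) < dot (gammap (obp P) z) p &
     ypart z = e * glo P (xpart z) ->
       rhm P (xpart z) (ypart z) < dot (gammam (obm P) z) p].

(** Each paraboloid has to satisfy the boundary conditions only where it is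
    minimal in the family: there xi and zeta are well placed. Taking an
    envelope over parameters replaces a regularization of the boundary and
    of the oblique data, which are only of class C^1. *)
Lemma barrier_strict : exists M m C : R, 0 <= C /\ \forall e \near 0^'+,
  forall z t, thinK P e z -> params t ->
  [/\ `|barrier M m e t z| <= C, `|barrier_grad M m e t z| <= C &
    (forall t', params t' -> barrier M m e t z <= barrier M m e t' z) ->
    strictly_inward e z (barrier_grad M m e t z)].
Proof.
have [M [s [M0 s0 slope]]] := wedge_slope (ad_open ad) (ad_bnd ad) (ad_nrm ad).
have [G G0 hG] := thinK_compact_bound ad.
have [Bx Bx0 hBx] := closure_Om_bounded (ad_bnd ad).
have [L L0 hL] := defect_lipschitz M0.
have [Bq Bq0 hBq] := defect_bound M0.
have [Bv Bv0 hBv] := wslope_bound M0.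
have [Bg Bg0 hBg] := ob0_bound.
have [dg dg0 hdg] := gap_pos.
have [Lm Lm0 hLm] := gmean_lipschitz.
have [K1 K10 hK1] := expansion_bound ad (ad_okp ad) (ad_obp_exp ad).
have [K2 K20 hK2] := expansion_bound ad (ad_okm ad) (ad_obm_exp ad).
have [K3 K30 hK3] := expansion_bound ad (ad_rlp ad) (ad_rhp_exp ad).
have [K4 K40 hK4] := expansion_bound ad (ad_rlm ad) (ad_rhm_exp ad).
have [Bm Bm0 hBm] : exists2 B : R, 0 <= B & forall x, cl x -> `|gmean x| <= B.
  apply: (continuous_bounded ad (f := gmean)).
  have -> : gmean = fun x => (gup P x + glo P x) * 2^-1 by [].
  apply: contM; last exact: contC.
  by apply: contD; [exact: C1_continuous (ad_gup ad)|exact: C1_continuous (ad_glo ad)].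
set n : R := N%:R; have n0 : 0 <= n by [].
pose Kc := K1 + K2 + K3 + K4; have Kc0 : 0 <= Kc by rewrite !addr_ge0.
pose C1 := G * (L + Lm); have C10 : 0 <= C1 by rewrite mulr_ge0 ?addr_ge0// ltW.
pose KG := Kc * G; have KG0 : 0 <= KG by rewrite mulr_ge0// ltW.
pose C2 := L * C1 + n * (KG * Bv) + n * ((Bg + KG) * (2 * C1)) + KG.
have C20 : 0 <= C2 by rewrite /C2; nonneg.
(* C2 collects the errors of order e; the width of the layer is at least dg e *)
pose m := 2 * (C2 + 2) / dg.
have m0 : 0 < m by rewrite divr_gt0// mulr_gt0// ltr_wpDl.
have mdg : m * (dg / 2) = C2 + 2 by rewrite /m; field; rewrite gt_eqF.
clearbody m; pose Cw := M * (n * ((Bx + Bx) * (Bx + Bx))) + n * (1 * (Bx + Bx)).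
pose CV := Cw + 1 * (Bq + Bm) + n * ((Bx + Bx) * (Bx + Bx)) + 2^-1 * m.
pose CG := (Bv + 2 * (Bx + Bx)) + (Bq + Bm + m).
have CV0 : 0 <= CV.
  by rewrite /CV /Cw; nonneg.
have CG0 : 0 <= CG by rewrite /CG; nonneg.
exists M, m, (CV + CG); split; first exact: addr_ge0.
have hexp : \forall y \near (0 : R), forall x, cl x -> [/\ `|obp P x y - ob0 P x| <= Kc * `|y|,
    `|obm P x y - - ob0 P x| <= Kc * `|y|, `|rhp P x y - rh0 P x| <= Kc * `|y| &
    `|rhm P x y - - rh0 P x| <= Kc * `|y|].
  apply: filterS (filterI hK1 (filterI hK2 (filterI hK3 hK4))) => y [h1 [h2 [h3 h4]]] x cx.
  have hh (k : R) : k <= Kc -> k * `|y| <= Kc * `|y| by move=> ?; rewrite ler_wpM2r.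
  by split; [apply: le_trans (h1 x cx) (hh _ _)|apply: le_trans (h2 x cx) (hh _ _)
    |apply: le_trans (h3 x cx) (hh _ _)|apply: le_trans (h4 x cx) (hh _ _)];
    rewrite /Kc; move: K10 K20 K30 K40; clear; lra.
move/nbhs_ballP : hexp => [y0 /= y00 hexp].
near=> e => z t Kz [bxi czeta]; set xi := t.1 in bxi *; set zeta := t.2 in czeta *.
have e0 : 0 < e by near: e; exact: nbhs_right_gt.
have e1 : e < 1 by near: e; exact: nbhs_right_lt.
have eG : e * G < 1 by near: e; exact: near0_mul_lt.
have eGy : e * G < y0 by near: e; exact: near0_mul_lt.
have em : e * m < 1 by near: e; exact: near0_mul_lt.
have emL : e * (m * (Lm * C1)) < 1 by near: e; exact: near0_mul_lt.
have es : e * (G * (Bq + Bq)) < s by near: e; exact: near0_mul_lt.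
have eC : e * (n * (2 * C1)) < 4^-1 by near: e; exact: near0_mul_lt.
have [cx _] := thinK_sub ad e0 Kz; have yG := hG e z e0 Kz; rewrite mulrC in yG.
set x := xpart z in cx *; set y := ypart z in yG *.
have cxi : cl xi by case: bxi.
have y1 : `|y| <= 1 by apply: le_trans yG _; exact: ltW.
have dB u v : cl u -> cl v -> `|u - v| <= Bx + Bx.
  by move=> cu cv; apply: le_trans (ler_normB _ _) _; rewrite lerD// hBx.
have nxi := nu_norm (ad_nrm ad) bxi.
have em0 := mulr_gt0 e0 m0.
have emg : `|e * m * gmean zeta| <= Bm.
  rewrite normrM gtr0_norm// -[leRHS]mul1r; apply: ler_pM => //; last exact: hBm.
    exact: ltW.
  exact: ltW.
split.
- apply: le_trans (_ : CV <= _); last by rewrite lerDl.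
  rewrite barrierE -/x -/y -/xi -/zeta; apply: le_trans (ler_normD _ _) _; apply: lerD.
    apply: le_trans (ler_normD _ _) _; apply: lerD.
      apply: le_trans (ler_normD _ _) _; apply: lerD.
        apply: le_trans (ler_normD _ _) _; apply: lerD.
          rewrite normrM gtr0_norm// ler_wpM2l ?(ltW M0)//.
          by apply: le_trans (dot_le_norm _ _) _; rewrite ler_wpM2l// ler_pM// dB.
        by apply: le_trans (dot_le_norm _ _) _; rewrite ler_wpM2l// ler_pM// dB.
      rewrite normrM ler_pM//; apply: le_trans (ler_normB _ _) _.
      by apply: lerD => //; exact: hBq.
    by apply: le_trans (dot_le_norm _ _) _; rewrite ler_wpM2l// ler_pM// dB.
  rewrite normrM ger0_norm ?invr_ge0// ler_wpM2l ?invr_ge0//.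
  rewrite normrM gtr0_norm// -[leRHS]mulr1 ler_wpM2l ?(ltW m0)//.
  by rewrite normrX exprn_ile1.
- apply: le_trans (_ : CG <= _); last by rewrite lerDr.
  rewrite barrier_gradE; apply: le_trans (norm_le_parts _) _; rewrite xpart_row ypart_row.
  apply: lerD.
    apply: le_trans (ler_normD _ _) _; apply: lerD; first exact: hBv.
    by rewrite normrZ ger0_norm//; apply: ler_wpM2l => //; exact: dB.
  apply: le_trans (ler_normD _ _) _; apply: lerD.
    by apply: le_trans (ler_normB _ _) _; apply: lerD; [exact: hBq|exact: emg].
  by rewrite normrM gtr0_norm// -[leRHS]mulr1 ler_wpM2l// ltW.
move=> tmin.
have xz : `|x - zeta| <= C1 * e.
  have := tmin (xi, x) (conj bxi cx); rewrite !barrierE /= -/x -/y -/xi -/zeta subrr dot0l.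
  move=> h; have sq := norm_sq_le_dot (x - zeta).
  have h2 : dot (x - zeta) (x - zeta) <=
     y * (defect M xi x - defect M xi zeta + (e * m) * (gmean zeta - gmean x)).
    move: h; move: (wedge _ _ _ _) (dot _ _) (defect _ _ _) (defect _ _ _) (gmean _) (gmean _) (2^-1 * _).
    move=> a1 a2 a3 a4 a5 a6 a7; clear; nra.
  have h3 : `|x - zeta| ^+ 2 <= (e * G) * ((L + Lm) * `|x - zeta|).
    apply: le_trans sq _; apply: le_trans h2 _; apply: le_trans (ler_norm _) _.
    rewrite normrM; apply: ler_pM => //; apply: le_trans (ler_normD _ _) _.
    rewrite mulrDl; apply: lerD; first exact: hL.
    rewrite normrM gtr0_norm// -[leRHS]mul1r; apply: ler_pM => //.
    - exact: ltW.
    - exact: ltW.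
    - by rewrite distrC; exact: hLm.
  move: h3; have := normr_ge0 (x - zeta); move: (Num.norm _) => d; rewrite le_eqVlt => /orP[/eqP<- _|d0].
    by rewrite mulr_ge0// ltW.
  rewrite expr2 mulrA ler_pM2r// => h3; apply: le_trans h3 _.
  by rewrite /C1 [e * G]mulrC mulrAC.
have xz1 : 0 <= C1 * e by rewrite mulr_ge0// ltW.
have yb : ball 0 y0 y.
  by rewrite /ball /= sub0r normrN; apply: le_lt_trans yG eGy.
have [x1 x2 x3 x4] := hexp y yb x cx.
have KyG : Kc * `|y| <= KG * e.
  by rewrite /KG -mulrA ler_wpM2l// mulrC.
have rr0 : 0 <= KG * e by rewrite mulr_ge0// ltW.
have est (sg q b : R) (g1 : 'rV[R]_N) : `|sg| = 1 -> `|g1 - sg *: ob0 P x| <= KG * e ->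
    `|b - sg * rh0 P x| <= KG * e -> e * (C2 + 1) <= sg * q ->
    b < dot g1 (wslope M xi x + 2 *: (x - zeta)) + sg * (defect M xi zeta + q).
  move=> sg1 hg hb hq; rewrite -subr_gt0.
  have hd : `|defect M xi zeta - defect M xi x| <= L * `|x - zeta|.
    by rewrite [`|x - zeta|]distrC; exact: hL.
  have := oblique_estimate q Bg0 Bv0 rr0 xz1 L0 sg1 hd (hBg x cx) (hBv x xi cx bxi) hg hb xz.
  apply: lt_le_trans.
  rewrite subr_gt0; apply: lt_le_trans hq.
  have le1 : N%:R * ((Bg + KG * e) * (2 * (C1 * e))) <= n * ((Bg + KG) * (2 * C1)) * e.
    rewrite -mulrA ler_wpM2l// -mulrA; apply: ler_pM.
    - by rewrite addr_ge0.
    - by rewrite mulr_ge0.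
    - by rewrite lerD2l ler_piMr// ltW.
    - by rewrite mulrA.
  apply: le_lt_trans (_ : e * C2 < _); last by rewrite ltr_pM2l// ltrDl.
  apply: le_trans (lerD (lerD (lexx _) le1) (lexx _)) _.
  by rewrite le_eqVlt; apply/orP; left; apply/eqP; rewrite /C2 -/n; ring.
have qest (sg gs : R) : sg * (gs - gmean x) = (gup P x - glo P x) / 2 -> `|sg| = 1 ->
    e * (C2 + 1) <= sg * (- (e * m * gmean zeta) + m * (e * gs)).
  move=> hs sg1.
  have h5 : `|sg * (gmean x - gmean zeta)| <= Lm * C1 * e.
    rewrite normrM sg1 mul1r; apply: le_trans (hLm x zeta cx czeta) _.
    by rewrite -mulrA ler_wpM2l.
  move: h5; rewrite ler_norml => /andP[h5 _]; have h6 := hdg x cx.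
  have -> : sg * (- (e * m * gmean zeta) + m * (e * gs)) =
    e * (m * (sg * (gs - gmean x) + sg * (gmean x - gmean zeta))) by ring.
  rewrite ler_pM2l// hs mulrDr.
  have h7 : C2 + 2 <= m * ((gup P x - glo P x) / 2).
    by rewrite -mdg ler_pM2l// ler_pM2r// invr_gt0.
  have h8 : - 1 <= m * (sg * (gmean x - gmean zeta)).
    apply: le_trans (_ : - (e * (m * (Lm * C1))) <= _); first by rewrite lerN2 ltW.
    have -> : - (e * (m * (Lm * C1))) = m * - (Lm * C1 * e) by ring.
    by rewrite ler_pM2l.
  exact: slack_add h7 h8.
rewrite /strictly_inward -/x -/y barrier_gradE xpart_row -/x -/y -/xi -/zeta; split.
- move=> bx; rewrite dotDr.
  have w : wedge (nrm P) M xi x <= s.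
    have := tmin (x, zeta) (conj bx czeta); rewrite !barrierE /= -/x -/y -/xi -/zeta.
    have -> : wedge (nrm P) M x x = 0 by rewrite /wedge subrr !dot0r mulr0 addr0.
    move=> h; have h2 : wedge (nrm P) M xi x <= y * (defect M x zeta - defect M xi zeta).
      move: h; move: (wedge _ _ _ _) (dot _ _) (defect _ _ _) (defect _ _ _) (e * m * gmean _) (2^-1 * _).
      by move=> a1 a2 a3 a4 a5 a6; clear; lra.
    apply: le_trans h2 _; apply: le_trans (ler_norm _) _; rewrite normrM.
    apply: le_trans (ltW es); rewrite mulrA; apply: ler_pM => //.
    by apply: le_trans (ler_normB _ _) _; apply: lerD; exact: hBq.
  have := slope x xi bx bxi w.
  have : `|dot (nrm P x) (2 *: (x - zeta))| < 4^-1.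
    apply: le_lt_trans eC; apply: le_trans (dot_le_norm _ _) _.
    have nx := nu_norm (ad_nrm ad) bx.
    have -> : e * (n * (2 * C1)) = n * (1 * (2 * (C1 * e))) by ring.
    apply: ler_wpM2l => //; apply: ler_pM => //.
    by rewrite normrZ ger0_norm//; apply: ler_wpM2l.
  rewrite ltr_norml => /andP[h1 _]; move: h1; move: (dot _ _) (dot _ _) => a b; lra.
- move=> yE; rewrite /gammap -/x -/y dot_row_mx mul1r.
  have -> : defect M xi zeta - e * m * gmean zeta + m * y =
    1 * (defect M xi zeta + (- (e * m * gmean zeta) + m * (e * gup P x))).
    by rewrite -yE; ring.
  apply: est; rewrite ?normr1 ?scale1r ?mul1r//.
  + by apply: le_trans x1 _.
  + by apply: le_trans x3 _.
  + have := qest 1 (gup P x); rewrite !mul1r; apply; last exact: normr1.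
    by rewrite /gmean; field.
- move=> yE; rewrite /gammam -/x -/y dot_row_mx.
  have -> : defect M xi zeta - e * m * gmean zeta + m * y =
    defect M xi zeta + (- (e * m * gmean zeta) + m * (e * glo P x)).
    by rewrite -yE; ring.
  apply: est; rewrite ?normrN1 ?scaleN1r ?mulN1r//.
  + by apply: le_trans x2 _.
  + by apply: le_trans x4 _.
  + have := qest (-1) (glo P x); rewrite !mulN1r; apply; last exact: normrN1.
    by rewrite /gmean; field.
Unshelve. all: end_near. Qed.

End Barrier.

(** * Bounds and existence for the thin problems *)

Section EquationBound.
Context {R : realType} {N : nat}.
Variable P : problem R N.
Hypothesis ad : admissible P.
Local Notation cl := (closure (dom P)).

Lemma eqn_bound (H : 'M[R]_(N + 1)) (C : R) : H^T = H ->
  exists2 B : R, 0 <= B & forall p x y, `|p| <= C -> cl x -> -1 <= y <= 1 ->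
    `|eqn P H p 0 x y| <= B.
Proof.
move=> sH; pose A := ([set p : 'rV[R]_(N + 1) | `|p| <= C] `*` cl) `*` `[(-1 : R), 1].
have cA : compact A.
  apply: compact_setX; last exact: segment_compact.
  by apply: compact_setX; [exact: compact_closed_ball|exact: cl_compact].
have cf : cont_on A (fun w => eqn P H w.1.1 0 w.1.2 w.2).
  apply: cont_on_near => I G FG X [[p x] y] [[/= pC cx] cy] hX hn.
  have h1 : (X i).1 @[i --> G] --> (p, x) by apply: cvg_comp hX (@cvg_fst _ _ _ _ _).
  apply: (eqn_cvg ad) => //.
  - exact: cvg_cst.
  - by apply: cvg_comp h1 (@cvg_fst _ _ _ _ _).
  - exact: cvg_cst.
  - by apply: cvg_comp h1 (@cvg_snd _ _ _ _ _).
  - by apply: cvg_comp hX (@cvg_snd _ _ _ _ _).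
  - by apply: filterS hn => i [[_ ci] /= yi]; split=> //; split => //; move: yi; rewrite in_itv.
have [B B0 hB] := cont_on_bounded cA cf; exists B => // p x y pC cx cy.
by apply: (hB (p, x, y)); split => //=; rewrite in_itv.
Qed.

Lemma K_nonempty e : 0 < e -> thinK P e !=set0.
Proof.
move=> e0; have [x Ox] := ad_ne ad.
by exists (row_mx x (e * gmean P x)%:M); apply: thin_sub_K; exact: thin_midpoint.
Qed.

End EquationBound.

Section Solutions.
Context {R : realType} {N : nat}.
Implicit Type P : problem R N.

Lemma small_thickness_near P : admissible P -> exists2 t : R, 0 < t &
  \forall e \near 0^'+, inward_at P t e.
Proof.
move=> ad; have [e0 [t [e00 t0 h]]] := small_thickness ad; exists t => //.
near=> e; apply: h; apply/andP; split; near: e.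
  exact: nbhs_right_gt.
exact: nbhs_right_lt.
Unshelve. all: end_near. Qed.

(** At a maximum taken over the parameters too, the barrier satisfies the
    boundary conditions strictly, so the inequality for the equation is the
    one that holds there, and properness bounds the value. *)
Lemma sub_upper_bound P : admissible P -> exists C : R, \forall e \near 0^'+,
  forall w, visc_sub (thinK P e) (tle P e) w -> forall z, thinK P e z -> w z <= C.
Proof.
move=> ad; have [M [m [C [C0 hbar]]]] := barrier_strict ad.
have [t0 _ hth] := small_thickness_near ad.
have [alpha a0 mono] := ad_mono ad.
have sH : (barrier_hess M m)^T = barrier_hess M m :> 'M[R]_(N + 1).
  by have [xi0 bxi] := params_nonempty ad; exact: jet2_sym 0 (jet2_barrier P M m 0 xi0).
have [B B0 hB] := eqn_bound ad C sH.
exists (B / alpha + (C + C)).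
near=> e => w sw z Kz.
have e0 : 0 < e by near: e; exact: nbhs_right_gt.
have hb : forall z t, thinK P e z -> params P t ->
  [/\ `|barrier P M m e t z| <= C, `|barrier_grad P M m e t z| <= C &
    (forall t', params P t' -> barrier P M m e t z <= barrier P M m e t' z) ->
    strictly_inward P e z (barrier_grad P M m e t z)] by near: e.
have ht : forall z, thinK P e z -> -1 <= ypart z <= 1.
  have hi : inward_at P t0 e by near: e.
  by move=> z1 /hi[].
have [Bw hBw] := (bounded_bnd_on _ _).1 sw.1.
pose T := thinK P e `*` params P.
have cT : compact T by apply: compact_setX; [exact: thinK_compact|exact: params_compact].
have uT : usc_on T (fun q => usc_env (thinK P e) w q.1 + - barrier P M m e q.2 q.1).
  apply: usc_onD.
    exact: usc_on_fst (env_usc hBw).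
  apply: within_continuous_usc; apply: cont_on_near => I G FG X [z1 t1] [/= Kz1 pt1] hX hn.
  apply: cvgN.
  have := @cont_on_cvg _ _ _ (fun p => barrier P M m e p.1 p.2) I G _ (fun i => ((X i).2, (X i).1))
    (t1, z1) (barrier_cont ad (M := M) (m := m) (e := e)).
  apply => //.
    have h1 : (X i).1 @[i --> G] --> z1 by apply: cvg_comp hX (@cvg_fst _ _ _ _ _).
    have h2 : (X i).2 @[i --> G] --> t1 by apply: cvg_comp hX (@cvg_snd _ _ _ _ _).
    exact: cvg_pair h2 h1.
  by apply: filterS hn => i [].
have [] := usc_attains_max cT _ uT.
  have [t1 pt1] := params_nonempty ad; have [z1 Kz1] := K_nonempty ad e0.
  by exists (z1, t1).
move=> [z1 t1] [/= Kz1 pt1] hmax.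
have [b1 g1 st] := hb z1 t1 Kz1 pt1.
have {}st := st (fun t' pt' => ltac:(by have := hmax (z1, t') (conj Kz1 pt'); rewrite /= lerD2l lerN2)).
have [Cj gj Hj] := jet2_barrier P M m e t1.
have := sw.2 _ z1 Cj Kz1 (fun y Ky => hmax (y, t1) (conj Ky pt1)); rewrite gj Hj => tl.
have [cx1 _] := thinK_sub ad e0 Kz1; have y1 := ht z1 Kz1.
have F0 : eqn P (barrier_hess M m) (barrier_grad P M m e t1 z1) (usc_env (thinK P e) w z1)
   (xpart z1) (ypart z1) <= 0.
  have [sL sT sB] := st; case: tl => // -[[h1 h2] h3]; exfalso; move: h3; rewrite leNgt.
  - by rewrite sL.
  - by rewrite sT.
  - by rewrite sB.
have v1 : usc_env (thinK P e) w z1 <= B / alpha.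
  have [v0|v0] := leP (usc_env (thinK P e) w z1) 0; first by apply: le_trans v0 _; rewrite divr_ge0// ltW.
  have := mono (barrier_grad P M m e t1 z1) _ _ cx1 y1 _ _ 0 _ sH sH (fun v => ltac:(by rewrite subrr mulmx0 dot0l)) (ltW v0).
  have := hB _ _ _ g1 cx1 y1; rewrite ler_norml => /andP[h1 _].
  rewrite mulr0 => h2; rewrite ler_pdivlMr// [_ * alpha]mulrC; move: F0 h1 h2.
  move: (eqn P _ _ _ _ _) (eqn P _ _ _ _ _) (alpha * _) => a b c; lra.
have := hmax (z, t1) (conj Kz pt1); have [b2 _ _] := hb z t1 Kz pt1.
have := env_ge hBw Kz; move: b1 b2; rewrite /= !ler_norml => /andP[b11 b12] /andP[b21 b22].
move: v1; move: (usc_env _ _ _) (usc_env _ _ _) (barrier _ _ _ _ _ _) (barrier _ _ _ _ _ _) (w z) (B / alpha) b11 b12 b21 b22.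
by move=> a b c d f g; clear; lra.
Unshelve. all: end_near. Qed.

(** The reflected barriers, lowered by a constant, are strict classical
    subsolutions wherever they are maximal in the family, and their maximum
    is tested there. *)
Lemma sub_exists P : admissible P -> \forall e \near 0^'+,
  exists w, visc_sub (thinK P e) (tle P e) w.
Proof.
move=> ad; have adf := admissible_flip ad.
have [M [m [C [C0 hbar]]]] := barrier_strict adf.
have [t0 t00 hth] := small_thickness_near ad.
have [alpha a0 mono] := ad_mono ad.
set H := barrier_hess M m : 'M[R]_(N + 1).
have sH : (- H)^T = - H.
  have [xi0 bxi] := params_nonempty adf; rewrite trmxN; congr (- _).
  exact: jet2_sym 0 (jet2_barrier (flip P) M m 0 xi0).
have [B B0 hB] := eqn_bound ad C sH.
(* low enough for properness to make the equation strict *)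
pose C4 := C + (B + 1) / alpha.
near=> e.
have e0 : 0 < e by near: e; exact: nbhs_right_gt.
pose psi t z := barrier (flip P) M m e t z.
have hb0 : forall z t, thinK P e z -> params P t ->
  [/\ `|barrier (flip P) M m e t z| <= C, `|barrier_grad (flip P) M m e t z| <= C &
    (forall t', params P t' -> barrier (flip P) M m e t z <= barrier (flip P) M m e t' z) ->
    strictly_inward (flip P) e z (barrier_grad (flip P) M m e t z)] by near: e.
have hb : forall z t, thinK P e z -> params P t ->
  [/\ `|psi t z| <= C, `|barrier_grad (flip P) M m e t z| <= C &
    (forall t', params P t' -> psi t z <= psi t' z) ->
    strictly_inward (flip P) e z (barrier_grad (flip P) M m e t z)].
  exact: hb0.
have ht : inward_at P t0 e by near: e.
have psic : cont_on (params P `*` setT) (fun p => psi p.1 p.2) := barrier_cont adf (M := M) (m := m) (e := e).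
have cpar : compact (params P) := params_compact adf.
have /boolp.choice[tau htau] : forall z, exists t,
    params P t /\ forall t', params P t' -> psi t z <= psi t' z.
  move=> z.
  have uz : usc_on (params P) (fun t => - psi t z).
    apply: within_continuous_usc; apply: cont_on_near => I G FG X t pt hX hn.
    apply: cvgN.
    have := @cont_on_cvg _ _ _ (fun p => psi p.1 p.2) I G _ (fun i => (X i, z)) (t, z) psic.
    have h1 : (X i, z) @[i --> G] --> (t, z) by exact: cvg_pair hX (@cvg_cst _ z _ G _).
    by apply => //; apply: filterS hn.
  have [t pt hm] := usc_attains_max cpar (params_nonempty adf) uz.
  by exists t; split => // t' pt'; rewrite -lerN2; exact: hm.
exists (fun z => - psi (tau z) z + - C4).
set w0 := (fun z => _).
have hBw : bnd_on (thinK P e) w0 (C + C4).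
  move=> z Kz; have [h1 _ _] := hb z (tau z) Kz (htau z).1.
  apply: le_trans (ler_normD _ _) _; rewrite !normrN lerD//.
  by rewrite ger0_norm// /C4 addr_ge0// divr_ge0 ?addr_ge0// ltW.
split; first by apply/bounded_bnd_on; exists (C + C4).
(* the minimum over a compact set of parameters is lower semicontinuous *)
have env0 z : thinK P e z -> usc_env (thinK P e) w0 z = w0 z.
  move=> Kz; apply/eqP; rewrite eq_le (env_ge hBw Kz) andbT.
  apply/ler_addgt0Pr => d d0; apply: (env_le hBw Kz).
  have /near_covering_withinP nK := (compact_near_coveringP (params P)).1 cpar.
  have h : \forall w \near z, params P `<=` (fun t => psi (tau z) z - d < psi t w).
    apply: (nK _ (nbhs z) (fun w t => psi (tau z) z - d < psi t w)) => t pt.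
    have lt : psi (tau z) z - d < psi t z.
      by rewrite ltrBlDr; apply: le_lt_trans ((htau z).2 t pt) _; rewrite ltrDl.
    have := psic (t, z) (conj pt Logic.I) => /cvgr_gt /(_ _ lt).
    rewrite near_withinE => -[[U V] /= [hU hV] sub].
    exists (U, V) => // -[t' w'] [/= Ut Vw] pt'.
    by apply: (sub (t', w')).
  apply: filterS h => w hw _; rewrite /w0.
  have := hw _ (htau w).1 => /=; move: (psi _ _) (psi _ _) => a b; lra.
move=> phi z Cphi Kz; rewrite env0// => hmax.
have jp := jet2N (jet2_barrier (flip P) M m e (tau z)).
have jf := jet2D jp (jet2_cst (- C4)).
have [b1 g1 st] := hb z (tau z) Kz (htau z).1.
have [sL sT sB] := st (htau z).2.
have [cx1 _] := thinK_sub ad e0 Kz; have [y1 _ _ _] := ht z Kz.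
apply: (strict_classical_touching ad e0 t00 Kz ht jf Cphi).
  move=> y Ky; apply: le_trans (hmax y Ky); rewrite env0// lerD2r lerD2r lerN2.
  exact: (htau y).2 (htau z).1.
rewrite !addr0 => -[F0|[[h1 h2] h3]|[[h1 h2] h3]|[[h1 h2] h3]].
- have v0 : - psi (tau z) z + - C4 <= 0.
    move: b1; rewrite ler_norml => /andP[b1 _].
    have : C <= C4 by rewrite /C4 lerDl divr_ge0 ?addr_ge0// ltW.
    lra.
  have := mono (- barrier_grad (flip P) M m e (tau z) z) _ _ cx1 y1 _ _ _ 0 sH sH (fun v => ltac:(by rewrite subrr mulmx0 dot0l)) v0.
  have gN : `|- barrier_grad (flip P) M m e (tau z) z| <= C by rewrite normrN.
  have := hB _ _ _ gN cx1 y1; rewrite ler_norml => /andP[_ h1].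
  have h2 : alpha * (- psi (tau z) z + - C4) <= - (B + 1).
    have -> : - (B + 1) = alpha * - ((B + 1) / alpha) by rewrite mulrN mulrC divfK// gt_eqF.
    rewrite ler_pM2l//; move: b1; rewrite ler_norml /C4 => /andP[b1 _]; lra.
  move: F0 h1 h2; rewrite -/H /psi mulr0.
  by move: (eqn P _ _ _ _ _) (eqn P _ _ _ _ _) (alpha * _) => a b c; lra.
- by move: h3; rewrite xpartN dotNr oppr_ge0 leNgt sL.
- by move: h3; rewrite dotNr lerNr leNgt; move: (sT h2); rewrite /= => ->.
- by move: h3; rewrite dotNr lerNr leNgt; move: (sB h2); rewrite /= => ->.
Unshelve. all: end_near. Qed.

Definition sols P (e : R) := thin_solutions (dom P) (nrm P) (gup P) (glo P) (eqn P)
  (obp P) (obm P) (rhp P) (rhm P) e.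

Lemma solsE P e u : sols P e u <->
  visc_sub (thinK P e) (tle P e) u /\ visc_super (thinK P e) (tge P e) u.
Proof. by []. Qed.

Lemma sols_flip P e u : sols P e u -> sols (flip P) e (fun z => - u z).
Proof.
move=> /solsE[su sp]; apply/solsE; split.
  have h := (@visc_super_flip R _ (thinK P e) (tge P e) (tle (flip P) e) u
    (fun X p r z => tge_flip P e X p r z)).
  exact: (h.1 sp).
have h : forall X p r z, tge (flip P) e X p r z <-> tle P e (- X) (- p) (- r) z.
  by move=> X p r z; rewrite tge_flip flipK.
apply: (@visc_super_flip R _ (thinK P e) (tge (flip P) e) (tle P e) (fun z => - u z) h).2.
by have -> : (fun z => - - u z) = u by apply/funext => z; rewrite opprK.
Qed.

Lemma sols_exist P : admissible P -> \forall e \near 0^'+, exists u, sols P e u.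
Proof.
move=> ad; have [C hC] := sub_upper_bound ad; have [t t0 ht] := small_thickness_near ad.
have hw := sub_exists ad.
near=> e; have e0 : 0 < e by near: e; exact: nbhs_right_gt.
have [w sw] : exists w, visc_sub (thinK P e) (tle P e) w by near: e.
have ht' : inward_at P t e by near: e.
have hC' : forall w, visc_sub (thinK P e) (tle P e) w -> forall z, thinK P e z -> w z <= C by near: e.
have [u hu] := perron_solution ad e0 t0 ht' hC' sw.
by exists u.
Unshelve. all: end_near. Qed.

Lemma sols_bounded P : admissible P -> exists C : R, \forall e \near 0^'+,
  forall u, sols P e u -> bnd_on (thinK P e) u C.
Proof.
move=> ad; have [C1 h1] := sub_upper_bound ad.
have [C2 h2] := sub_upper_bound (admissible_flip ad).
exists (`|C1| + `|C2|); near=> e => u su z Kz.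
have u1 : u z <= C1.
  have h : forall w, visc_sub (thinK P e) (tle P e) w -> forall z, thinK P e z -> w z <= C1 by near: e.
  exact: h _ su.1 z Kz.
have u2 : - u z <= C2.
  have h : forall w, visc_sub (thinK P e) (tle (flip P) e) w -> forall z, thinK P e z -> w z <= C2 by near: e.
  exact: h _ (sols_flip su).1 z Kz.
rewrite ler_norml; apply/andP; split.
  rewrite lerNl; apply: le_trans u2 _; apply: le_trans (ler_norm _) _; by rewrite lerDr.
by apply: le_trans u1 _; apply: le_trans (ler_norm _) _; rewrite lerDl.
Unshelve. all: end_near. Qed.

End Solutions.

(** * The limit operator and the perturbed test function *)

Section Flux.
Context {R : realType} {N : nat}.

Lemma pderiv_sum n m (f : 'I_m -> 'rV[R]_n -> R) i x : (forall k, C1 (f k)) ->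
  pderiv i (fun x => \sum_k f k x) x = \sum_k pderiv i (f k) x.
Proof.
elim: m f => [|m IH] f h.
  have -> : (fun x => \sum_k f k x) = fun=> 0 by apply/funext => y; rewrite big_ord0.
  by rewrite big_ord0 /pderiv derive_cst.
have -> : (fun x => \sum_k f k x) = fun x => f ord0 x + \sum_k f (lift ord0 k) x.
  by apply/funext => y; rewrite big_ord_recl.
rewrite pderivD; last 2 first.
- exact: (h ord0).1.
- exact: (C1_sum (fun k => h (lift ord0 k))).1.
by rewrite big_ord_recl IH.
Qed.

(** The derivative in y that both oblique conditions prescribe on {y = 0} to a
    function with horizontal gradient grad phi. *)
Definition flux (g0 : 'rV[R]_N -> 'rV[R]_N) (b0 phi : 'rV[R]_N -> R) (x : 'rV[R]_N) : R :=
  b0 x - dot (g0 x) (grad phi x).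

Variables (g0 : 'rV[R]_N -> 'rV[R]_N) (b0 phi : 'rV[R]_N -> R).
Hypotheses (Cg : C1vec g0) (Cb : C1 b0) (Cphi : C2 phi).

Lemma fluxE : flux g0 b0 phi = fun x => b0 x + - \sum_i g0 x 0 i * pderiv i phi x.
Proof.
apply/funext => x; rewrite /flux dotE; congr (_ - _); apply: eq_bigr => i _.
by rewrite gradE.
Qed.

Lemma flux_term_C1 i : C1 (fun x => g0 x 0 i * pderiv i phi x).
Proof. exact: C1M (Cg i) (Cphi.2 i). Qed.

Lemma flux_C1 : C1 (flux g0 b0 phi).
Proof. by rewrite fluxE; exact: C1D Cb (C1N (C1_sum flux_term_C1)). Qed.

(** This is the off-diagonal block of the matrix in the limit operator. *)
Lemma flux_grad x :
  grad (flux g0 b0 phi) x = grad b0 x - grad phi x *m Dmx g0 x - g0 x *m hess phi x.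
Proof.
apply/rowP => j; rewrite gradE fluxE pderivD; last 2 first.
- exact: Cb.1.
- exact: (C1N (C1_sum flux_term_C1)).1.
rewrite pderivN; last exact: (C1_sum flux_term_C1).1.
rewrite (pderiv_sum _ _ flux_term_C1) [RHS]mxE [in RHS]mxE -addrA; congr (_ + _).
  by rewrite gradE.
have E (A B : 'rV[R]_N) : (- A) 0 j + (- B) 0 j = - (A 0 j + B 0 j) by rewrite !mxE opprD.
rewrite E; congr (- _); rewrite [X in _ = X + _]mxE [X in _ = _ + X]mxE -big_split /=.
apply: eq_bigr => i _; rewrite (pderivM j (Cg i).1 (Cphi.2 i).1) addrC.
have hs : hess phi x j i = hess phi x i j by rewrite -[in LHS](hess_sym x Cphi) [in LHS]mxE.
by rewrite -hs hessE gradE [Dmx g0 x i j]mxE.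
Qed.

End Flux.

Section LimitOperator.
Context {R : realType} {N : nat}.
Variable P : problem R N.
Hypothesis ad : admissible P.

Definition lim_b := limit_b (gup P) (glo P) (ob0 P) (okp P) (okm P).
Definition lim_c := limit_c (gup P) (glo P) (ob0 P) (rh0 P) (rlp P) (rlm P).
Definition lim_G := limit_G (gup P) (glo P) (eqn P) (ob0 P) (rh0 P) (okp P) (okm P) (rlp P) (rlm P).

Definition limit_yy (X : 'M[R]_N) (p x : 'rV[R]_N) : R :=
  dot (ob0 P x *m X) (ob0 P x) + dot (lim_b x) p + lim_c x.

Definition limit_xy (X : 'M[R]_N) (p x : 'rV[R]_N) : 'rV[R]_N :=
  grad (rh0 P) x - p *m Dmx (ob0 P) x - ob0 P x *m X.

Lemma lim_GE X p r x : X^T = X -> lim_G X p r x =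
  eqn P (bquad_hess X (limit_xy X p x) (limit_yy X p x))
    (row_mx p (rh0 P x - dot (ob0 P x) p)%:M) r x 0.
Proof.
move=> sX; rewrite /lim_G /limit_G; congr (eqn P _ _ _ _ _).
rewrite /limit_A /limit_B /limit_C !add_block_mx !addr0 /bquad_hess; congr block_mx.
- have -> : X *m (ob0 P x)^T = (ob0 P x *m X)^T by rewrite trmx_mul sX.
  have E (a b c : 'rV[R]_N) : - a^T - b^T + c^T = (c - b - a)^T.
    by apply/matrixP => i j; rewrite !mxE; ring.
  exact: E.
- have E (a b c : 'rV[R]_N) : - a - b + c = c - b - a by rewrite addrC -opprD (addrC a) opprD addrA.
  exact: E.
- rewrite /limit_yy !raddfD /= -!addrA; congr (_ + _).
  by apply/matrixP => i j; rewrite (ord1 i) (ord1 j) [RHS]mxE eqxx mulr1n.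
Qed.

(** The first order terms of the two oblique conditions, weighted by the two
    graphs: for this value of the second derivative in y the conditions on
    top and bottom balance. *)
Lemma limit_yyE X p x : closure (dom P) x -> limit_yy X p x = - dot (ob0 P x) (limit_xy X p x) +
  (gup P x * (rlp P x - dot (okp P x) p) + glo P x * (rlm P x - dot (okm P x) p)) /
    (gup P x - glo P x).
Proof.
move=> cx; have d0 : gup P x - glo P x != 0 by rewrite subr_eq0 gt_eqF// (ad_lt ad cx).
rewrite /limit_yy /limit_xy /lim_b /lim_c /limit_b /limit_c.
have -> : dot (ob0 P x *m (Dmx (ob0 P) x)^T - (gup P x - glo P x)^-1 *: (gup P x *: okp P x + glo P x *: okm P x)) p
  = dot (ob0 P x) (p *m Dmx (ob0 P) x) - (gup P x - glo P x)^-1 * (gup P x * dot (okp P x) p + glo P x * dot (okm P x) p).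
  by rewrite dotBl dot_mulmx trmxK dotZl dotDl !dotZl.
rewrite !dotBr (dotC (ob0 P x) (ob0 P x *m X)).
move: d0; move: (dot _ _) (dot _ _) (dot _ _) (dot _ _) (dot _ _) (gup P x) (glo P x) (rlp P x) (rlm P x).
by clear=> a b c d e g h l k d0; field.
Qed.

End LimitOperator.

Section Tester.
Context {R : realType} {N : nat}.
Variables (phi q : 'rV[R]_N -> R) (tau m s : R).

(** The flux is only of class C^1, so its product with y is not an admissible
    test function; it is replaced by its first order expansion at xi. *)
Definition tilt (xi x : 'rV[R]_N) : R := q xi + dot (grad q xi) (x - xi).

(** The perturbed test function: phi (x) + y (tilt + e s) + m y^2 / 2, with a
    penalty that keeps xi close to x; see testerE. *)
Definition tester (e : R) (xi : 'rV[R]_N) (z : 'rV[R]_(N + 1)) : R :=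
  phi (xpart z) + bquad (tau * dot xi xi) (- (2 * tau) *: xi)
    (q xi - dot (grad q xi) xi + e * s) (2 * tau)%:M (grad q xi) m z.

Definition tester_grad (e : R) (xi x : 'rV[R]_N) (y : R) : 'rV[R]_(N + 1) :=
  row_mx (grad phi x + (2 * tau) *: (x - xi) + y *: grad q xi) (tilt xi x + m * y + e * s)%:M.

Definition tester_hess (xi x : 'rV[R]_N) : 'M[R]_(N + 1) :=
  bquad_hess (hess phi x + (2 * tau)%:M) (grad q xi) m.

Lemma testerE e xi z : tester e xi z = phi (xpart z) +
  (sqdist tau xi (xpart z) + ypart z * tilt xi (xpart z) +
   (e * s * ypart z + 2^-1 * (m * ypart z ^+ 2))).
Proof.
rewrite /tester /bquad /sqdist /tilt mul_mx_scalar !dot_lin (dotC (xpart z) xi); congr (_ + _).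
move: (dot _ _) (dot _ _) (dot _ _) (dot _ _) (dot _ _) (q xi) (ypart z) => a b c d f g y.
by field.
Qed.

Hypothesis Cphi : C2 phi.

Lemma jet2_tester e xi : jet2 (tester e xi)
  (fun z => tester_grad e xi (xpart z) (ypart z)) (fun z => tester_hess xi (xpart z)).
Proof.
have sQ : ((2 * tau)%:M : 'M[R]_N)^T = (2 * tau)%:M by rewrite tr_scalar_mx.
have := jet2D (jet2_lift (jet2_C2 Cphi)) (jet2_bquad (tau * dot xi xi) (- (2 * tau) *: xi)
  (q xi - dot (grad q xi) xi + e * s) (grad q xi) m sQ).
have -> : (fun x : 'rV[R]_(N + 1) => row_mx (grad phi (xpart x)) 0 + bquad_grad (- (2 * tau) *: xi)
  (q xi - dot (grad q xi) xi + e * s) (2 * tau)%:M (grad q xi) m x) =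
  (fun z => tester_grad e xi (xpart z) (ypart z)).
  apply/funext => z; rewrite /bquad_grad add_row_mx add0r /tester_grad /tilt; congr row_mx.
    by rewrite !addrA mul_mx_scalar; congr (_ + _); rewrite -addrA; congr (_ + _); rewrite scalerBr scaleNr addrC.
  by congr (_%:M); rewrite dotBr; ring.
have -> : (fun x : 'rV[R]_(N + 1) => block_mx (hess phi (xpart x)) 0 0 0 + bquad_hess (2 * tau)%:M (grad q xi) m) =
  (fun z => tester_hess xi (xpart z)).
  by apply/funext => z; rewrite /bquad_hess add_block_mx !add0r.
by [].
Qed.

End Tester.

(** * Oblique conditions at first order in the thickness *)

Section ScaledExpansion.
Context {R : realType} {N : nat} {I : Type}.
Variable cl : set 'rV[R]_N.

Lemma expansion_scaled (V : normedModType R) (f : 'rV[R]_N -> R -> V) (f0 k : 'rV[R]_N -> V)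
    (G : set_system I) (FG : Filter G) (g : 'rV[R]_N -> R) (e : I -> R) (x : I -> 'rV[R]_N) (x0 : 'rV[R]_N) :
  unif_expansion cl f f0 k -> cont_on cl k -> continuous g -> cl x0 ->
  e @ G --> (0 : R) -> (\forall i \near G, 0 < e i) -> x @ G --> x0 ->
  (\forall i \near G, cl (x i)) ->
  (e i)^-1 *: (f (x i) (e i * g (x i)) - f0 (x i)) @[i --> G] --> g x0 *: k x0.
Proof.
move=> hf ck cg cx0 he epos hx hcl.
have hg : g (x i) @[i --> G] --> g x0 by apply: cvg_comp hx (cg x0).
have hk : k (x i) @[i --> G] --> k x0 by exact: cont_on_cvg ck cx0 hx hcl.
have hy : e i * g (x i) @[i --> G] --> (0 : R) by rewrite -(mul0r (g x0)); exact: cvgM.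
have hr : (e i)^-1 *: (f (x i) (e i * g (x i)) - (f0 (x i) + (e i * g (x i)) *: k (x i))) @[i --> G] --> (0 : V).
  apply/cvgrPdist_le => d d0; pose d' := d / (`|g x0| + 1).
  have B0 : 0 < `|g x0| + 1 by rewrite ltr_pwDr.
  have d'0 : 0 < d' by rewrite divr_gt0.
  have h1 : \forall i \near G, `|g (x i)| < `|g x0| + 1.
    have lt : `|g x0| < `|g x0| + 1 by rewrite ltrDl.
    have hn : `|g (x i)| @[i --> G] --> `|g x0| by exact: cvg_norm.
    by move: hn => /cvgr_lt /(_ _ lt).
  have h2 : \forall i \near G, forall w, cl w ->
      `|f w (e i * g (x i)) - (f0 w + (e i * g (x i)) *: k w)| <= d' * `|e i * g (x i)|.
    exact: hy _ (hf d' d'0).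
  apply: filterS (filterI (filterI h1 h2) (filterI epos hcl)) => i [[b1 b2] [ei ci]].
  rewrite sub0r normrN normrZ gtr0_norm ?invr_gt0//.
  rewrite ler_pdivrMl//; apply: le_trans (b2 _ ci) _.
  rewrite normrM (gtr0_norm ei) mulrCA ler_pM2l// /d' -mulrA ler_piMr ?(ltW d0)//.
  by rewrite mulrC ler_pdivrMr// mul1r ltW.
have E : \forall i \near G, (e i)^-1 *: (f (x i) (e i * g (x i)) - (f0 (x i) + (e i * g (x i)) *: k (x i))) + g (x i) *: k (x i)
    = (e i)^-1 *: (f (x i) (e i * g (x i)) - f0 (x i)).
  apply: filterS epos => i ei; rewrite opprD addrA scalerBr scalerA mulrA mulVf ?gt_eqF// mul1r.
  by rewrite subrK.
apply: cvg_trans (_ : (fun i => (e i)^-1 *: (f (x i) (e i * g (x i)) - (f0 (x i) + (e i * g (x i)) *: k (x i))) + g (x i) *: k (x i)) @ G --> _).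
  exact: near_eq_cvg.
rewrite -[X in _ --> X]add0r; apply: cvgD => //; exact: cvgZ.
Qed.

Lemma boundary_algebra (tau m s sg e g gp op gx gxi gq ox oxi oq t r b : R) : e != 0 ->
  e^-1 * (gp - sg * op) + e^-1 * (2 * tau * (gx - gxi) - sg * (2 * tau * (ox - oxi))) +
  e^-1 * (e * g * gq - sg * (e * g * oq)) + sg * (2 * tau * (e^-1 * (ox - oxi)) + g * oq) +
  sg * (e^-1 * (t - (r - op)) + m * g + s) - e^-1 * (b - sg * r) =
  e^-1 * (gp + 2 * tau * (gx - gxi) + e * g * gq + sg * (t + m * (e * g) + e * s) - b).
Proof. by move=> e0; field. Qed.

Lemma cvg_scaled_zero (G : set_system I) (FG : Filter G) (B : R) (e y : I -> R) :
  e @ G --> (0 : R) -> (\forall i \near G, `|y i| <= B * e i) -> y @ G --> (0 : R).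
Proof.
move=> he hy; have hB : B * e i @[i --> G] --> (0 : R) by rewrite -(mulr0 B); exact: cvgMl_tmp.
apply/cvgrPdist_le => d d0; have := hB => /cvgr_le/(_ _ d0) h.
by apply: filterS (filterI h hy) => i [h1 h2]; rewrite sub0r normrN; exact: le_trans h2 h1.
Qed.

Lemma cvg_perturbed (a : R) (G : set_system I) (FG : Filter G)
    (p d q : I -> 'rV[R]_N) (y : I -> R) (p0 q0 : 'rV[R]_N) :
  p @ G --> p0 -> d @ G --> (0 : 'rV[R]_N) -> y @ G --> (0 : R) -> q @ G --> q0 ->
  p i + a *: d i + y i *: q i @[i --> G] --> p0.
Proof.
move=> hp hd hy hq; have -> : p0 = p0 + a *: 0 + (0 : R) *: q0 by rewrite scaler0 scale0r !addr0.
by apply: cvgD; [apply: cvgD => //; apply: cvgZ => //; exact: cvg_cst|exact: cvgZ].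
Qed.

Lemma scaled_limit (tau m s sg : R) (G : set_system I) (FG : Filter G)
    (D p d q h o : I -> 'rV[R]_N) (y g w b : I -> R)
    (D0 p0 q0 o0 : 'rV[R]_N) (g0 b0 : R) :
  D @ G --> D0 -> p @ G --> p0 -> d @ G --> (0 : 'rV[R]_N) -> y @ G --> (0 : R) ->
  q @ G --> q0 -> h @ G --> (0 : 'rV[R]_N) -> o @ G --> o0 -> g @ G --> g0 ->
  w @ G --> (0 : R) -> b @ G --> b0 ->
  dot (D i) (p i + (2 * tau) *: d i + y i *: q i) +
    sg * dot (o i) ((2 * tau) *: h i + g i *: q i) + sg * (w i + m * g i + s) - b i
   @[i --> G] -->
  dot D0 p0 + sg * (g0 * dot o0 q0) + sg * (m * g0 + s) - b0.
Proof.
move=> hD hp hd hy hq hh ho hg hw hb.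
have cZ (a : R) (f : I -> 'rV[R]_N) (f0 : 'rV[R]_N) : f @ G --> f0 -> a *: f i @[i --> G] --> a *: f0.
  by move=> hf; apply: cvgZ => //; exact: cvg_cst.
have h1 : p i + (2 * tau) *: d i + y i *: q i @[i --> G] --> p0.
  exact: (cvg_perturbed _ FG hp hd hy hq).
have h2 : (2 * tau) *: h i + g i *: q i @[i --> G] --> g0 *: q0.
  have -> : g0 *: q0 = (2 * tau) *: 0 + g0 *: q0 by rewrite scaler0 add0r.
  by apply: cvgD; [exact: cZ|exact: cvgZ].
have h3 : sg * (w i + m * g i + s) @[i --> G] --> sg * (m * g0 + s).
  apply: cvgMl_tmp; rewrite -[m * g0]add0r; apply: cvgD; last exact: cvg_cst.
  by apply: cvgD => //; exact: cvgMl_tmp.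
apply: cvgB => //; apply: cvgD => //; apply: cvgD; first exact: cvg_dot.
by apply: cvgMl_tmp; rewrite -dotZr; exact: cvg_dot.
Qed.

End ScaledExpansion.

Section ScaledBoundary.
Context {R : realType} {N : nat} {I : Type}.
Variable P : problem R N.
Hypothesis ad : admissible P.
Local Notation cl := (closure (dom P)).
Variables (phi : 'rV[R]_N -> R).
Hypothesis Cphi : C2 phi.
Local Notation q := (flux (ob0 P) (rh0 P) phi).

Lemma problem_flux_C1 : C1 q. Proof. exact: flux_C1 (ad_ob0 ad) (ad_rh0 ad) Cphi. Qed.

Variables (G : set_system I) (e : I -> R) (x xi : I -> 'rV[R]_N) (x0 : 'rV[R]_N).
Context {FG : Filter G}.
Hypotheses (he : e @ G --> (0 : R)) (epos : \forall i \near G, 0 < e i)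
  (hx : x @ G --> x0) (hcl : \forall i \near G, cl (x i)) (cx0 : cl x0)
  (hh : (e i)^-1 *: (x i - xi i) @[i --> G] --> (0 : 'rV[R]_N)).

Lemma xi_cvg : xi @ G --> x0.
Proof.
have : x i - e i *: ((e i)^-1 *: (x i - xi i)) @[i --> G] --> x0 - (0 : R) *: (0 : 'rV[R]_N).
  by apply: cvgB => //; exact: cvgZ.
rewrite scale0r subr0; apply: cvg_trans; apply: near_eq_cvg.
by apply: filterS epos => i ei; rewrite scalerA divff ?gt_eqF// scale1r subKr.
Qed.

(** Strict differentiability of the flux; the distance of x to xi is o(e). *)
Lemma tilt_error : (e i)^-1 * (tilt q (xi i) (x i) - q (x i)) @[i --> G] --> (0 : R).
Proof.
apply/cvgrPdist_le => d d0.
have [r r0 hr] := C1_strict_diff x0 problem_flux_C1 d0.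
have h1 : \forall i \near G, `|x i - x0| < r by exact: hx _ (near_norm x0 r0).
have h2 : \forall i \near G, `|xi i - x0| < r by exact: xi_cvg _ (near_norm x0 r0).
have h3 : \forall i \near G, `|(e i)^-1 *: (x i - xi i)| < 1.
  have hn : `|(e i)^-1 *: (x i - xi i)| @[i --> G] --> `|0 : 'rV[R]_N| by exact: cvg_norm.
  have lt : `|0 : 'rV[R]_N| < 1 by rewrite normr0.
  by move: hn => /cvgr_lt /(_ _ lt).
apply: filterS (filterI (filterI h1 h2) (filterI h3 epos)) => i [[b1 b2] [b3 ei]].
rewrite sub0r normrN normrM gtr0_norm ?invr_gt0// -normrN opprB /tilt opprD addrA.
apply: le_trans (_ : (e i)^-1 * (d * `|x i - xi i|) <= _).
  by rewrite ler_pM2l ?invr_gt0//; exact: hr.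
move: b3; rewrite normrZ gtr0_norm ?invr_gt0// mulrCA => b3.
by rewrite ler_piMr// ltW.
Qed.

(** At order 1 the defect of the oblique condition vanishes by the choice of the
    flux; the limit is its coefficient of order e. The sign sg is 1 on the
    top and - 1 on the bottom. *)
Lemma scaled_boundary (tau m s sg : R) (g1 : 'rV[R]_N -> R -> 'rV[R]_N) (b : 'rV[R]_N -> R -> R)
    (g l : 'rV[R]_N -> R) (k : 'rV[R]_N -> 'rV[R]_N) :
  unif_expansion cl g1 (fun x => sg *: ob0 P x) k -> cont_on cl k ->
  unif_expansion cl b (fun x => sg * rh0 P x) l -> cont_on cl l -> continuous g ->
  (e i)^-1 * (dot (row_mx (g1 (x i) (e i * g (x i))) sg%:M)
      (tester_grad phi q tau m s (e i) (xi i) (x i) (e i * g (x i))) - b (x i) (e i * g (x i)))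
   @[i --> G] -->
  g x0 * (sg * dot (ob0 P x0) (grad q x0) + dot (k x0) (grad phi x0) - l x0 + sg * m) + sg * s.
Proof.
move=> hg1 ck hb cl' cg.
have hgx : g (x i) @[i --> G] --> g x0 by apply: cvg_comp hx (cg x0).
have D1 := expansion_scaled FG hg1 ck cg cx0 he epos hx hcl.
have D2 := expansion_scaled FG hb cl' cg cx0 he epos hx hcl.
have hg0 : ob0 P (x i) @[i --> G] --> ob0 P x0.
  by apply: cvg_comp hx (C1vec_continuous (ad_ob0 ad) (x := x0)).
have hp : grad phi (x i) @[i --> G] --> grad phi x0.
  by apply: cvg_comp hx (C1_grad_continuous (C2_C1 Cphi) (x := x0)).
have hq : grad q (xi i) @[i --> G] --> grad q x0.
  by apply: cvg_comp xi_cvg (C1_grad_continuous problem_flux_C1 (x := x0)).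
have hxx : x i - xi i @[i --> G] --> (0 : 'rV[R]_N).
  by rewrite -(subrr x0); apply: cvgB => //; exact: xi_cvg.
have hy : e i * g (x i) @[i --> G] --> (0 : R) by rewrite -(mul0r (g x0)); exact: cvgM.
have := scaled_limit tau (m:=m) (s:=s) (sg:=sg) FG D1 hp hxx hy hq hh hg0 hgx tilt_error D2.
have -> : dot (g x0 *: k x0) (grad phi x0) + sg * (g x0 * dot (ob0 P x0) (grad q x0)) +
    sg * (m * g x0 + s) - g x0 *: l x0 =
   g x0 * (sg * dot (ob0 P x0) (grad q x0) + dot (k x0) (grad phi x0) - l x0 + sg * m) + sg * s.
  rewrite dotZl [_ *: l x0]/GRing.scale /=.
  by move: (dot _ _) (dot _ _) (g x0) (l x0) => a1 a2 a3 a4; ring.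
apply: cvg_trans; apply: near_eq_cvg; apply: filterS epos => i ei.
rewrite /tester_grad dot_row_mx /GRing.scale /= [flux _ _ _ (x i)]/flux.
have e0 : e i != 0 by rewrite gt_eqF.
by rewrite !dot_lin; exact: boundary_algebra.
Qed.

End ScaledBoundary.

Section TestFails.
Context {R : realType} {N : nat} {I : Type}.
Variable P : problem R N.
Hypothesis ad : admissible P.
Local Notation cl := (closure (dom P)).
Variables (phi : 'rV[R]_N -> R).
Hypothesis Cphi : C2 phi.
Local Notation q := (flux (ob0 P) (rh0 P) phi).

(** The equation and the lateral condition fail by continuity; the oblique
    conditions fail because their coefficients of order e have the right
    sign in the limit. *)
Lemma tester_fails (tau m s : R) (G : set_system I) (FG : Filter G) (e r : I -> R)
    (z : I -> 'rV[R]_(N + 1)) (xi : I -> 'rV[R]_N) (x0 : 'rV[R]_N) (r0 : R) :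
  e @ G --> (0 : R) -> (\forall i \near G, 0 < e i) -> (\forall i \near G, thinK P (e i) (z i)) ->
  xpart (z i) @[i --> G] --> x0 -> cl x0 ->
  (e i)^-1 *: (xpart (z i) - xi i) @[i --> G] --> (0 : 'rV[R]_N) -> r @ G --> r0 ->
  0 < eqn P (bquad_hess (hess phi x0 + (2 * tau)%:M) (grad q x0) m)
        (row_mx (grad phi x0) (q x0)%:M) r0 x0 0 ->
  (bdry (dom P) x0 -> 0 < dot (nrm P x0) (grad phi x0)) ->
  0 < gup P x0 * (dot (ob0 P x0) (grad q x0) + dot (okp P x0) (grad phi x0) - rlp P x0 + m) + s ->
  0 < glo P x0 * (- dot (ob0 P x0) (grad q x0) + dot (okm P x0) (grad phi x0) - rlm P x0 - m) - s ->
  \forall i \near G, ~ tle P (e i) (tester_hess phi q tau m (xi i) (xpart (z i)))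
    (tester_grad phi q tau m s (e i) (xi i) (xpart (z i)) (ypart (z i))) (r i) (z i).
Proof.
move=> he epos hK hx cx0 hh hr F0 lat top bot.
have [Gb Gb0 hGb] := thinK_compact_bound ad.
have hcl : \forall i \near G, cl (xpart (z i)).
  by apply: filterS (filterI epos hK) => i [ei Ki]; exact: (thinK_sub ad ei Ki).1.
have hyb : \forall i \near G, `|ypart (z i)| <= Gb * e i.
  by apply: filterS (filterI epos hK) => i [ei Ki]; exact: hGb.
have hy : ypart (z i) @[i --> G] --> (0 : R) by exact: cvg_scaled_zero he hyb.
have hy1 : \forall i \near G, -1 <= ypart (z i) <= 1.
  have hn : `|ypart (z i)| @[i --> G] --> `|0 : R| by exact: cvg_norm.
  have lt : `|0 : R| < 1 by rewrite normr0.
  by move: hn => /cvgr_lt /(_ _ lt); apply: filterS => i /ltW; rewrite ler_norml.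
have Cq := problem_flux_C1 ad Cphi.
have hxi : xi @ G --> x0 by exact: xi_cvg he epos hx hh.
have hp : grad phi (xpart (z i)) @[i --> G] --> grad phi x0.
  by apply: cvg_comp hx (C1_grad_continuous (C2_C1 Cphi) (x := x0)).
have hq : grad q (xi i) @[i --> G] --> grad q x0.
  by apply: cvg_comp hxi (C1_grad_continuous Cq (x := x0)).
have hqv : q (xi i) @[i --> G] --> q x0 by apply: cvg_comp hxi (C1_continuous Cq (x := x0)).
have hxx : xpart (z i) - xi i @[i --> G] --> (0 : 'rV[R]_N) by rewrite -(subrr x0); exact: cvgB.
have hP : grad phi (xpart (z i)) + (2 * tau) *: (xpart (z i) - xi i) + ypart (z i) *: grad q (xi i)
    @[i --> G] --> grad phi x0.
  exact: (cvg_perturbed _ FG hp hxx hy hq).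
have hT : tilt q (xi i) (xpart (z i)) + m * ypart (z i) + e i * s @[i --> G] --> q x0.
  have -> : q x0 = q x0 + dot (grad q x0) 0 + m * 0 + 0 * s by rewrite dot0r mulr0 mul0r !addr0.
  apply: cvgD; last exact: cvgMr_tmp.
  by apply: cvgD; [apply: cvgD => //; exact: cvg_dot|exact: cvgMl_tmp].
have hF : \forall i \near G, 0 < eqn P (tester_hess phi q tau m (xi i) (xpart (z i)))
    (tester_grad phi q tau m s (e i) (xi i) (xpart (z i)) (ypart (z i))) (r i) (xpart (z i)) (ypart (z i)).
  have sH x (w : 'rV[R]_N) : (bquad_hess (hess phi x + (2 * tau)%:M) w m)^T =
      bquad_hess (hess phi x + (2 * tau)%:M) w m.
    by apply: bquad_hess_sym; apply: sym_addI; exact: hess_sym.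
  have hX : tester_hess phi q tau m (xi i) (xpart (z i)) @[i --> G] -->
      bquad_hess (hess phi x0 + (2 * tau)%:M) (grad q x0) m.
    apply: cvg_block_mx => //; last exact: cvg_cst.
      apply: cvgD; last exact: cvg_cst.
      by apply: cvg_comp hx (C2_hess_continuous Cphi (x := x0)).
    exact: cvg_trmx.
  have hg : tester_grad phi q tau m s (e i) (xi i) (xpart (z i)) (ypart (z i)) @[i --> G] -->
      row_mx (grad phi x0) (q x0)%:M.
    by apply: cvg_row_mx => //; exact: cvg_scalar_mx.
  have y0 : -1 <= (0 : R) <= 1 by rewrite lerN10 ler01.
  have hn : \forall i \near G, (tester_hess phi q tau m (xi i) (xpart (z i)))^T =
      tester_hess phi q tau m (xi i) (xpart (z i)) /\ cl (xpart (z i)) /\ -1 <= ypart (z i) <= 1.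
    apply: filterS (filterI hcl hy1) => i [h1 h2]; split; last by split.
    exact: sH.
  by have := eqn_cvg ad FG hX hg hr hx hy (sH _ _) cx0 y0 hn => /cvgr_gt/(_ _ F0).
have hL := lateral_near (ad_open ad) (ad_nrm ad) FG hx hP lat.
have hTB (sg : R) (g1 : 'rV[R]_N -> R -> 'rV[R]_N) (b : 'rV[R]_N -> R -> R) (g l : 'rV[R]_N -> R)
    (k : 'rV[R]_N -> 'rV[R]_N) : unif_expansion cl g1 (fun x => sg *: ob0 P x) k -> cont_on cl k ->
    unif_expansion cl b (fun x => sg * rh0 P x) l -> cont_on cl l -> continuous g ->
    0 < g x0 * (sg * dot (ob0 P x0) (grad q x0) + dot (k x0) (grad phi x0) - l x0 + sg * m) + sg * s ->
    \forall i \near G, ~ (ypart (z i) = e i * g (xpart (z i)) /\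
      dot (row_mx (g1 (xpart (z i)) (ypart (z i))) sg%:M)
       (tester_grad phi q tau m s (e i) (xi i) (xpart (z i)) (ypart (z i))) <= b (xpart (z i)) (ypart (z i))).
  move=> h1 h2 h3 h4 h5 pos.
  have := scaled_boundary (FG := FG) ad Cphi he epos hx hcl cx0 hh tau (m := m) (s := s) h1 h2 h3 h4 h5.
  move=> /cvgr_gt/(_ _ pos) h; apply: filterS (filterI h epos) => i [h0 ei] [E].
  rewrite E; rewrite -subr_le0 leNgt => /negP; apply.
  by move: h0; rewrite pmulr_rgt0 ?invr_gt0.
have hTop : \forall i \near G, ~ (thinT (dom P) (gup P) (e i) (z i) /\
    dot (gammap (obp P) (z i)) (tester_grad phi q tau m s (e i) (xi i) (xpart (z i)) (ypart (z i)))
     <= rhp P (xpart (z i)) (ypart (z i))).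
  have := hTB 1 (obp P) (rhp P) (gup P) (rlp P) (okp P) _ (ad_okp ad) _ (ad_rlp ad) (C1_continuous (ad_gup ad)).
  have -> : (fun x => 1 *: ob0 P x) = ob0 P by apply/funext => x; rewrite scale1r.
  have -> : (fun x => 1 * rh0 P x) = rh0 P by apply/funext => x; rewrite mul1r.
  rewrite !mul1r => /(_ (ad_obp_exp ad) (ad_rhp_exp ad) top).
  by apply: filterS => i h [[_ E] le]; apply: h; split.
have hBot : \forall i \near G, ~ (thinB (dom P) (glo P) (e i) (z i) /\
    dot (gammam (obm P) (z i)) (tester_grad phi q tau m s (e i) (xi i) (xpart (z i)) (ypart (z i)))
     <= rhm P (xpart (z i)) (ypart (z i))).
  have := hTB (-1) (obm P) (rhm P) (glo P) (rlm P) (okm P) _ (ad_okm ad) _ (ad_rlm ad) (C1_continuous (ad_glo ad)).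
  have -> : (fun x => -1 *: ob0 P x) = (fun x => - ob0 P x) by apply/funext => x; rewrite scaleN1r.
  have -> : (fun x => -1 * rh0 P x) = (fun x => - rh0 P x) by apply/funext => x; rewrite mulN1r.
  rewrite !mulN1r => /(_ (ad_obm_exp ad) (ad_rhm_exp ad) bot).
  by apply: filterS => i h [[_ E] le]; apply: h; split.
apply: filterS (filterI hF (filterI hL (filterI hTop hBot))) => i [h1 [h2 [h3 h4]]].
case => //; first by rewrite leNgt h1.
by move=> [[bx _]]; rewrite /tester_grad xpart_row => le; exact: h2.
Qed.

End TestFails.

(** * Localization of the maxima *)

Section Arithmetic.
Context {R : realType}.
Implicit Types a b c d r : R.

Lemma penalty_bound (tau Gb e d y t q0 D sq r : R) : 0 < tau -> 0 < Gb -> 0 < e -> 0 < d -> 0 <= D ->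
  `|y| <= Gb * e -> `|q0 - t| <= tau * d / Gb * D -> tau * D ^+ 2 <= sq ->
  sq + (y * t + r) <= y * q0 + r -> D <= e * d.
Proof.
move=> tau0 G0 e0 d0 D0 hy hq hs le; have [->|Dn] := eqVneq D 0; first by rewrite mulr_ge0// ltW.
have Dp : 0 < D by rewrite lt_def Dn.
have h : y * (q0 - t) <= Gb * e * (tau * d / Gb * D).
  by apply: le_trans (ler_norm _) _; rewrite normrM; exact: ler_pM.
have E : Gb * e * (tau * d / Gb * D) = tau * D * (e * d) by field; rewrite gt_eqF.
have td : 0 < tau * D by rewrite mulr_gt0.
rewrite -(ler_pM2l td) -E; have -> : tau * D * D = tau * D ^+ 2 by ring.
apply: le_trans hs _; apply: le_trans h; rewrite mulrBr; move: le.
by move: (y * t) (y * q0) => a b; lra.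
Qed.

Lemma joint_max_lower (a u v1 v2 f1 f2 c1 c2 k : R) : a <= u -> u <= v1 ->
  v1 - (f1 + (0 + c1)) <= v2 - (f2 + (k + c2)) -> a - f1 - c1 <= v2 - f2 - k - c2.
Proof. by move=> ? ? ?; lra. Qed.

Lemma joint_max_penalties (U f0 a f1 c f2 r v k1 k2 sg : R) :
  v <= U - f0 + f2 - k1 + sg / 2 -> U - f0 - (a - f1 - c) - r < sg / 2 ->
  0 <= k2 -> 0 <= k1 -> a - f1 - c <= v - f2 - k2 - r -> k1 < sg /\ k2 < sg.
Proof. by move=> ? ? ? ? ?; split; lra. Qed.

Lemma joint_max_value (U f0 a f1 c f2 r v k1 k2 d : R) :
  U - d < a - f1 - c + f2 + r -> f2 < f0 + d / 2 -> v <= U - f0 + f2 - k1 + d / 2 ->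
  0 <= k2 -> 0 <= k1 -> a - f1 - c <= v - f2 - k2 - r -> `|U - v| <= d.
Proof. by move=> ? ? ? ? ? ?; rewrite ler_norml; apply/andP; split; lra. Qed.

End Arithmetic.

Section Localization.
Context {R : realType} {N : nat}.
Variable P : problem R N.
Hypothesis ad : admissible P.
Local Notation cl := (closure (dom P)).
Variables (phi q : 'rV[R]_N -> R).
Hypotheses (Cphi : C2 phi) (Cq : C1 q).
Variables (tau m s : R).
Hypothesis tau0 : 0 < tau.

Local Notation psi := (tester phi q tau m s).

Lemma tilt_cvg (I : Type) (G : set_system I) (FG : Filter G) (xi x : I -> 'rV[R]_N) (xi0 x0 : 'rV[R]_N) :
  xi @ G --> xi0 -> x @ G --> x0 -> tilt q (xi i) (x i) @[i --> G] --> tilt q xi0 x0.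
Proof.
move=> hxi hx; apply: cvgD; first by apply: cvg_comp hxi (C1_continuous Cq (x := xi0)).
apply: cvg_dot; last exact: cvgB.
by apply: cvg_comp hxi (C1_grad_continuous Cq (x := xi0)).
Qed.

Lemma tester_cvg (e : R) (I : Type) (G : set_system I) (FG : Filter G) (xi : I -> 'rV[R]_N)
    (z : I -> 'rV[R]_(N + 1)) (xi0 : 'rV[R]_N) (z0 : 'rV[R]_(N + 1)) :
  xi @ G --> xi0 -> z @ G --> z0 -> psi e (xi i) (z i) @[i --> G] --> psi e xi0 z0.
Proof.
move=> hxi hz; rewrite testerE; under eq_fun do rewrite testerE.
have hx : xpart (z i) @[i --> G] --> xpart z0 by apply: cvg_comp hz (@xpart_continuous R N z0).
have hy : ypart (z i) @[i --> G] --> ypart z0 by apply: cvg_comp hz (@ypart_continuous R N z0).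
apply: cvgD; first by apply: cvg_comp hx (C1_continuous (C2_C1 Cphi) (x := xpart z0)).
apply: cvgD; last first.
  apply: cvgD; first exact: cvgMl_tmp.
  by do 2!apply: cvgMl_tmp; rewrite expr2; apply: cvgM.
apply: cvgD; last by apply: cvgM => //; exact: tilt_cvg.
by apply: cvgMl_tmp; apply: cvg_dot; exact: cvgB.
Qed.

Lemma tilt_bounded : exists2 B : R, 0 <= B & forall xi x, cl xi -> cl x -> `|tilt q xi x| <= B.
Proof.
have cA : compact (cl `*` cl) by apply: compact_setX; exact: cl_compact.
have cf : cont_on (cl `*` cl) (fun p => tilt q p.1 p.2).
  apply: cont_on_near => I G FG X [xi x] _ hX _.
  apply: tilt_cvg; first by apply: cvg_comp hX (@cvg_fst _ _ _ _ _).
  by apply: cvg_comp hX (@cvg_snd _ _ _ _ _).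
have [B B0 hB] := cont_on_bounded cA cf; exists B => // xi x cxi cx.
exact: (hB (xi, x)).
Qed.

Lemma joint_max (e B : R) (u : 'rV[R]_(N + 1) -> R) : 0 < e -> bnd_on (thinK P e) u B ->
  exists p : 'rV[R]_(N + 1) * 'rV[R]_N, [/\ thinK P e p.1, cl p.2 &
    forall z xi, thinK P e z -> cl xi ->
      usc_env (thinK P e) u z - psi e xi z <= usc_env (thinK P e) u p.1 - psi e p.2 p.1].
Proof.
move=> e0 hB; pose T := thinK P e `*` cl.
have cT : compact T by apply: compact_setX; [exact: thinK_compact|exact: cl_compact].
have uT : usc_on T (fun p => usc_env (thinK P e) u p.1 + - psi e p.2 p.1).
  apply: usc_onD.
    exact: usc_on_fst (env_usc hB).
  apply: within_continuous_usc; apply: cont_on_near => I G FG X [z1 t1] [/= Kz1 pt1] hX hn.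
  apply: cvgN; apply: tester_cvg; first by apply: cvg_comp hX (@cvg_snd _ _ _ _ _).
  by apply: cvg_comp hX (@cvg_fst _ _ _ _ _).
have [] := usc_attains_max cT _ uT.
  have [x Ox] := ad_ne ad; have [z1 Kz1] := K_nonempty ad e0.
  by exists (z1, x); split => //; exact: subset_closure.
move=> p [/= K1 c2] hmax; exists p; split => // z xi Kz cxi.
exact: (hmax (z, xi) (conj Kz cxi)).
Qed.

Definition remainder (e y t : R) : R := y * t + (e * s * y + 2^-1 * (m * y ^+ 2)).

Lemma testerER e xi z : psi e xi z = phi (xpart z) +
  (sqdist tau xi (xpart z) + remainder e (ypart z) (tilt q xi (xpart z))).
Proof. by rewrite testerE -[sqdist _ _ _ + _ + _]addrA. Qed.

Lemma tilt_diag x : tilt q x x = q x.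
Proof. by rewrite /tilt subrr dot0r addr0. Qed.

Lemma remainder_cvg (I : Type) (G : set_system I) (FG : Filter G) (Gb B : R) (e y t : I -> R) :
  e @ G --> (0 : R) -> (\forall i \near G, `|y i| <= Gb * e i) ->
  (\forall i \near G, `|t i| <= B) -> remainder (e i) (y i) (t i) @[i --> G] --> (0 : R).
Proof.
move=> he hyb htb.
have hy : y @ G --> (0 : R) by exact: cvg_scaled_zero he hyb.
have hyn : `|y i| * B @[i --> G] --> (0 : R).
  rewrite -(mul0r B); apply: cvgMr_tmp; rewrite -(@normr0 _ R); exact: cvg_norm.
have hyt : y i * t i @[i --> G] --> (0 : R).
  apply/cvgrPdist_le => d d0; have := hyn => /cvgr_le/(_ _ d0) h.
  apply: filterS (filterI h htb) => i [h1 h2]; rewrite sub0r normrN normrM.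
  by apply: le_trans h1; exact: ler_wpM2l.
have -> : (0 : R) = 0 + (0 * s * 0 + 2^-1 * (m * 0 ^+ 2)) by rewrite expr0n !mulr0 !addr0.
apply: cvgD => //; apply: cvgD; first by apply: cvgM => //; exact: cvgMr_tmp.
by do 2!apply: cvgMl_tmp; rewrite expr2; apply: cvgM.
Qed.

(** Comparison of the joint maximum with the points w n brings z n to x0 and the
    values to U0. Comparison with xi = x gives tau |x - xi|^2 <= y (q x -
    tilt), where y is of order e and the last factor is o(|x - xi|) by
    strict differentiability: hence |x - xi| = o(e). *)
Lemma localization (kap U0 : R) (x0 : 'rV[R]_N) (e a : nat -> R) (u : nat -> 'rV[R]_(N + 1) -> R)
    (w : nat -> 'rV[R]_(N + 1)) :
  0 < kap -> (forall n, 0 < e n) -> e @ \oo --> (0 : R) ->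
  (forall n, exists B, bnd_on (thinK P (e n)) (u n) B) ->
  (forall n, thinK P (e n) (w n)) -> xpart (w n) @[n --> \oo] --> x0 ->
  (forall n, a n <= u n (w n)) -> a @ \oo --> U0 ->
  (forall sg : R, 0 < sg -> \forall n \near \oo, forall z, thinK P (e n) z ->
    u n z <= U0 - phi x0 + phi (xpart z) - sqdist kap x0 (xpart z) + sg) ->
  exists (z : nat -> 'rV[R]_(N + 1)) (xi : nat -> 'rV[R]_N),
  [/\ forall n, thinK P (e n) (z n),
      forall n z', thinK P (e n) z' -> usc_env (thinK P (e n)) (u n) z' - psi (e n) (xi n) z' <=
        usc_env (thinK P (e n)) (u n) (z n) - psi (e n) (xi n) (z n),
      xpart (z n) @[n --> \oo] --> x0,
      (e n)^-1 *: (xpart (z n) - xi n) @[n --> \oo] --> (0 : 'rV[R]_N) &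
      usc_env (thinK P (e n)) (u n) (z n) @[n --> \oo] --> U0].
Proof.
move=> kap0 epos he ub Kw hw aw ha hup.
have [Gb Gb0 hGb] := thinK_compact_bound ad; have [B B0 hB] := tilt_bounded.
have /boolp.choice[p hp] : forall n, exists p : 'rV[R]_(N + 1) * 'rV[R]_N,
    [/\ thinK P (e n) p.1, cl p.2 & forall z xi, thinK P (e n) z -> cl xi ->
      usc_env (thinK P (e n)) (u n) z - psi (e n) xi z <=
      usc_env (thinK P (e n)) (u n) p.1 - psi (e n) p.2 p.1].
  by move=> n; have [Bn hn] := ub n; exact: joint_max (epos n) hn.
pose z n := (p n).1; pose xi n := (p n).2; pose v n := usc_env (thinK P (e n)) (u n) (z n).
have Kz n : thinK P (e n) (z n) by have [] := hp n.
have cxi n : cl (xi n) by have [] := hp n.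
have cx n : cl (xpart (z n)) by exact: (thinK_sub ad (epos n) (Kz n)).1.
have cxw n : cl (xpart (w n)) by exact: (thinK_sub ad (epos n) (Kw n)).1.
pose rho n := remainder (e n) (ypart (z n)) (tilt q (xi n) (xpart (z n))).
pose c n := remainder (e n) (ypart (w n)) (tilt q (xpart (w n)) (xpart (w n))).
have hrho : rho @ \oo --> (0 : R).
  apply: (remainder_cvg _ he (Gb := Gb) (B := B)); apply: nearW => n; [exact: hGb|exact: hB].
have hc : c @ \oo --> (0 : R).
  apply: (remainder_cvg _ he (Gb := Gb) (B := B)); apply: nearW => n; [exact: hGb|exact: hB].
have H1 n : a n - phi (xpart (w n)) - c n <=
    v n - phi (xpart (z n)) - sqdist tau (xi n) (xpart (z n)) - rho n.
  have [Bn hn] := ub n; have [_ _ /(_ (w n) _ (Kw n) (cxw n))] := hp n.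
  rewrite -/(z n) -/(xi n) -/(v n) !testerER sqdist0.
  exact: joint_max_lower (aw n) (env_ge hn (Kw n)).
pose eta n := U0 - phi x0 - (a n - phi (xpart (w n)) - c n) - rho n.
have heta : eta @ \oo --> (0 : R).
  have -> : (0 : R) = U0 - phi x0 - (U0 - phi x0 - 0) - 0 by ring.
  apply: cvgB => //; apply: cvgB; first exact: cvg_cst.
  apply: cvgB => //; apply: cvgB => //.
  by apply: cvg_comp hw (C1_continuous (C2_C1 Cphi) (x := x0)).
have H2 sg : 0 < sg -> \forall n \near \oo,
    v n <= U0 - phi x0 + phi (xpart (z n)) - sqdist kap x0 (xpart (z n)) + sg.
  move=> sg0; apply: filterS (hup sg sg0) => n hn; have [Bn hBn] := ub n.
  apply: (env_le_cont (g := fun z => U0 - phi x0 + phi (xpart z) - sqdist kap x0 (xpart z) + sg) hBn (Kz n)) => //.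
  have cphi : continuous (fun z => phi (xpart z)) := jet2_continuous (jet2_lift (jet2_C2 Cphi)).
  have csq : continuous (fun z => sqdist kap x0 (@xpart R N z)) := jet2_continuous (jet2_lift (jet2_sqdist kap x0)).
  have cg : continuous (fun z : 'rV[R]_(N + 1) => U0 - phi x0 + phi (xpart z) - sqdist kap x0 (xpart z) + sg).
    apply: contD; last exact: contC.
    by apply: contD; [apply: contD; [exact: contC|exact: cphi]|apply: contN; exact: csq].
  exact: cg.
have H3 sg : 0 < sg -> \forall n \near \oo,
    sqdist kap x0 (xpart (z n)) < sg /\ sqdist tau (xi n) (xpart (z n)) < sg.
  move=> sg0; have sg2 : 0 < sg / 2 by rewrite divr_gt0.
  have := heta => /cvgr_lt/(_ _ sg2) h; apply: filterS (filterI (H2 _ sg2) h) => n [h1 h2].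
  exact: joint_max_penalties h1 h2 (sqdist_ge0 _ _ (ltW tau0)) (sqdist_ge0 _ _ (ltW kap0)) (H1 n).
have hx : xpart (z n) @[n --> \oo] --> x0.
  apply/cvgrPdist_lt => d d0; have kd : 0 < kap * d ^+ 2 by rewrite mulr_gt0// exprn_gt0.
  apply: filterS (H3 _ kd) => n [h _]; rewrite distrC; exact: norm_lt_of_sqdist h.
have hxi : xi @ \oo --> x0.
  apply/cvgrPdist_lt => d d0; have d2 : 0 < d / 2 by rewrite divr_gt0.
  have kd : 0 < tau * (d / 2) ^+ 2 by rewrite mulr_gt0// exprn_gt0.
  have h0 : \forall n \near \oo, `|xpart (z n) - x0| < d / 2 by exact: hx _ (near_norm x0 d2).
  apply: filterS (filterI h0 (H3 _ kd)) => n [h1 [_ h]].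
  have := norm_lt_of_sqdist tau0 d2 h => h3.
  have -> : x0 - xi n = (xpart (z n) - xi n) - (xpart (z n) - x0) by rewrite opprB [RHS]addrC addrA subrK.
  by apply: le_lt_trans (ler_normB _ _) _; rewrite [ltRHS]splitr ltrD.
have hphi : phi (xpart (z n)) @[n --> \oo] --> phi x0.
  by apply: cvg_comp hx (C1_continuous (C2_C1 Cphi) (x := x0)).
exists z, xi; split => //.
- by move=> n z' Kz'; have [_ _] := hp n; apply.
- apply/cvgrPdist_le => d d0; pose d' := tau * d / Gb.
  have d'0 : 0 < d' by rewrite divr_gt0// mulr_gt0.
  have [r r0 hr] := C1_strict_diff x0 Cq d'0.
  have h1 : \forall n \near \oo, `|xpart (z n) - x0| < r by exact: hx _ (near_norm x0 r0).
  have h2 : \forall n \near \oo, `|xi n - x0| < r by exact: hxi _ (near_norm x0 r0).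
  apply: filterS (filterI h1 h2) => n [b1 b2]; have en := epos n.
  rewrite sub0r normrN normrZ gtr0_norm ?invr_gt0// ler_pdivrMl//.
  have [_ _ /(_ (z n) (xpart (z n)) (Kz n) (cx n))] := hp n.
  rewrite -/(z n) -/(xi n) lerD2l lerN2 !testerER sqdist0 lerD2l add0r tilt_diag.
  apply: (penalty_bound tau0 Gb0 en d0 (normr_ge0 _) (hGb _ _ en (Kz n)) _ (sqdist_ge _ _ (ltW tau0))).
  by have := hr _ _ b1 b2; rewrite -addrA -opprD.
- apply/cvgrPdist_le => d d0; have d2 : 0 < d / 2 by rewrite divr_gt0.
  have hlow : a n - phi (xpart (w n)) - c n + phi (xpart (z n)) + rho n @[n --> \oo] --> U0.
    have -> : U0 = U0 - phi x0 - 0 + phi x0 + 0 by ring.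
    apply: cvgD => //; apply: cvgD => //; apply: cvgB => //; apply: cvgB => //.
    by apply: cvg_comp hw (C1_continuous (C2_C1 Cphi) (x := x0)).
  have := hlow => /cvgr_gt/(_ (U0 - d)); rewrite gtrDl oppr_lt0 => /(_ d0) h1.
  have := hphi => /cvgr_lt/(_ (phi x0 + d / 2)); rewrite ltrDl => /(_ d2) h2.
  apply: filterS (filterI h1 (filterI h2 (H2 _ d2))) => n [b1 [b2 b3]].
  exact: joint_max_value b1 b2 b3 (sqdist_ge0 _ _ (ltW tau0)) (sqdist_ge0 _ _ (ltW kap0)) (H1 n).
Qed.

End Localization.

(** * Passage to the limit *)

Section Slope.
Context {R : realType}.

(** The sum of the two quantities is (gp - gm) tau > 0, so a correction s of the
    slope in y can be moved between them to make both positive. *)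
Lemma slope_exists (gp gm A kp km lp lm m0 tau : R) : gm < gp -> 0 < tau ->
  m0 = - A + (gp * (lp - kp) + gm * (lm - km)) / (gp - gm) ->
  exists s : R, 0 < gp * (A + kp - lp + (m0 + tau)) + s /\
    0 < gm * (- A + km - lm - (m0 + tau)) - s.
Proof.
move=> lt t0 E.
have h : gp * (A + kp - lp + (m0 + tau)) + gm * (- A + km - lm - (m0 + tau)) = (gp - gm) * tau.
  by rewrite E; field; rewrite subr_eq0 gt_eqF.
have p : 0 < (gp - gm) * tau by rewrite mulr_gt0// subr_gt0.
exists ((gm * (- A + km - lm - (m0 + tau)) - gp * (A + kp - lp + (m0 + tau))) / 2).
move: h p; set a := gp * _; set b := gm * (_ - _); move: a b ((gp - gm) * tau) => a b c h p.
by split; lra.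
Qed.

End Slope.

Section LimitSub.
Context {R : realType} {N : nat}.
Variable P : problem R N.
Hypothesis ad : admissible P.
Local Notation cl := (closure (dom P)).

Definition lim_le := limit_le (dom P) (nrm P) (gup P) (glo P) (eqn P) (ob0 P) (rh0 P) (okp P) (okm P) (rlp P) (rlm P).

(** The two properties by which a half relaxed limit enters the limit procedure:
    it is uniformly an asymptotic upper bound, and it is approximated at
    every point. *)
Record relaxed_sup (U : 'rV[R]_N -> R) : Prop := RelaxedSup {
  relaxed_below : forall theta : 'rV[R]_N -> R, continuous theta -> (forall x, cl x -> U x <= theta x) ->
    forall sg : R, 0 < sg -> \forall r \near 0^'+, forall e u z, 0 < e < r -> sols P e u ->
      thinK P e z -> u z <= theta (xpart z) + sg;
  relaxed_approx : forall x, cl x -> forall eta : R, 0 < eta -> exists e u z,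
    [/\ 0 < e < eta, sols P e u, thinK P e z, `|xpart z - x| < eta & U x - eta < u z] }.

Lemma cvg_diag_perturbation (X : 'M[R]_N) : X + (2 * t)%:M @[t --> (0 : R)^'+] --> X.
Proof.
have h : X + (2 * t)%:M @[t --> (0 : R)^'+] --> X + (2 * 0)%:M.
  apply: cvgD; first exact: cvg_cst.
  by apply: cvg_scalar_mx; apply: cvgMl_tmp; exact: cvg_at_right_filter.
by move: h; rewrite mulr0 raddf0 addr0.
Qed.

Lemma block_perturbation (X : 'M[R]_N) (p x : 'rV[R]_N) (r : R) (m : R -> R)
   (w : R -> 'rV[R]_N) (w0 : 'rV[R]_N) (m0 : R) (y0 : R) : X^T = X -> cl x ->
  w @ 0^'+ --> w0 -> m @ 0^'+ --> m0 ->
  0 < eqn P (bquad_hess X w0 m0) (row_mx p y0%:M) r x 0 ->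
  \forall t \near 0^'+, 0 < eqn P (bquad_hess (X + (2 * t)%:M) (w t) (m t)) (row_mx p y0%:M) r x 0.
Proof.
move=> sX cx hw hm F0; have y00 : -1 <= (0 : R) <= 1 by rewrite lerN10 ler01.
have sXt (t : R) : (X + (2 * t)%:M)^T = X + (2 * t)%:M by exact: sym_addI.
have hX : bquad_hess (X + (2 * t)%:M) (w t) (m t) @[t --> 0^'+] --> bquad_hess X w0 m0.
  apply: cvg_block_mx => //; last exact: cvg_scalar_mx.
    exact: cvg_diag_perturbation.
  exact: cvg_trmx.
have hn : \forall t \near (0 : R)^'+, (bquad_hess (X + (2 * t)%:M) (w t) (m t))^T = bquad_hess (X + (2 * t)%:M) (w t) (m t)
    /\ cl x /\ -1 <= (0 : R) <= 1.
  by apply: nearW => t; split => //; exact: bquad_hess_sym.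
have cc (T : topologicalType) (c : T) : (fun _ : R => c) @ 0^'+ --> c by exact: cvg_cst.
have := eqn_cvg ad _ hX (cc _ (row_mx p y0%:M)) (cc _ r) (cc _ x) (cc _ (0 : R)) (bquad_hess_sym _ _ sX) cx y00 hn.
by move=> /(_ _)/cvgr_gt/(_ _ F0).
Qed.

(** If the limit inequalities failed, so would they for phi + kap |x - x0|^2 and
    for m slightly larger than the lower right entry. Then some slope s
    makes the perturbed test function violate all four alternatives of the
    thin problem at the points given by localization. *)
Lemma relaxed_sup_test (U phi : 'rV[R]_N -> R) (x0 : 'rV[R]_N) : relaxed_sup U ->
  C2 phi -> cl x0 -> (forall x, cl x -> U x - phi x <= U x0 - phi x0) ->
  lim_le (hess phi x0) (grad phi x0) (U x0) x0.
Proof.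
move=> hU Cphi cx0 hmax; apply: contrapT => nle.
have sX : (hess phi x0)^T = hess phi x0 by exact: hess_sym.
have G0 : 0 < lim_G P (hess phi x0) (grad phi x0) (U x0) x0.
  by rewrite ltNge; apply/negP => le; apply: nle; left.
have lat : bdry (dom P) x0 -> 0 < dot (nrm P x0) (grad phi x0).
  by move=> bx; rewrite ltNge; apply/negP => le; apply: nle; right.
(* the maximum becomes strict while the equation still fails *)
have [kap kap0 Gk] : exists2 kap : R, 0 < kap &
    0 < lim_G P (hess phi x0 + (2 * kap)%:M) (grad phi x0) (U x0) x0.
  move: G0; rewrite lim_GE// => G0.
  have hX : hess phi x0 + (2 * t)%:M @[t --> (0 : R)^'+] --> hess phi x0.
    exact: cvg_diag_perturbation.
  have hoX : ob0 P x0 *m (hess phi x0 + (2 * t)%:M) @[t --> (0 : R)^'+] --> ob0 P x0 *m hess phi x0.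
    by apply: cvg_mulmx => //; exact: cvg_cst.
  have hw : limit_xy P (hess phi x0 + (2 * t)%:M) (grad phi x0) x0 @[t --> (0 : R)^'+] -->
      limit_xy P (hess phi x0) (grad phi x0) x0.
    by apply: cvgB => //; exact: cvg_cst.
  have hm : limit_yy P (hess phi x0 + (2 * t)%:M) (grad phi x0) x0 @[t --> (0 : R)^'+] -->
      limit_yy P (hess phi x0) (grad phi x0) x0.
    apply: cvgD; last exact: cvg_cst.
    apply: cvgD; last exact: cvg_cst.
    by apply: cvg_dot => //; exact: cvg_cst.
  have h := block_perturbation sX cx0 hw hm G0.
  have [t [t0 ht]] := filter_ex (filterI (nbhs_right_gt (0 : R)) h).
  by exists t => //; rewrite lim_GE//; exact: sym_addI.
pose phi' x := phi x + sqdist kap x0 x.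
have J := jet2D (jet2_C2 Cphi) (jet2_sqdist kap x0).
have Cphi' : C2 phi' by have [] := J.
have gE : grad phi' x0 = grad phi x0 by have [_ -> _] := J; rewrite subrr scaler0 addr0.
have hE : hess phi' x0 = hess phi x0 + (2 * kap)%:M by have [_ _ ->] := J.
have sX' : (hess phi' x0)^T = hess phi' x0 by exact: hess_sym.
set q := flux (ob0 P) (rh0 P) phi'.
have qE : q x0 = rh0 P x0 - dot (ob0 P x0) (grad phi' x0) by [].
have gqE : grad q x0 = limit_xy P (hess phi' x0) (grad phi' x0) x0.
  exact: flux_grad (ad_ob0 ad) (ad_rh0 ad) Cphi' x0.
pose m0 := limit_yy P (hess phi' x0) (grad phi' x0) x0.
have [tau tau0 Ft] : exists2 tau : R, 0 < tau &
    0 < eqn P (bquad_hess (hess phi' x0 + (2 * tau)%:M) (grad q x0) (m0 + tau))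
      (row_mx (grad phi' x0) (q x0)%:M) (U x0) x0 0.
  have : 0 < lim_G P (hess phi' x0) (grad phi' x0) (U x0) x0 by rewrite hE gE; exact: Gk.
  rewrite lim_GE; last exact: sX'.
  rewrite -gqE -qE => {}Gk.
  have hm : m0 + t @[t --> (0 : R)^'+] --> m0.
    rewrite -[X in _ --> X]addr0; apply: cvgD; first exact: cvg_cst.
    exact: cvg_at_right_filter.
  have hw : (fun=> grad q x0) @ (0 : R)^'+ --> grad q x0 by exact: cvg_cst.
  have h := block_perturbation sX' cx0 hw hm Gk.
  by have [t [t0 ht]] := filter_ex (filterI (nbhs_right_gt (0 : R)) h); exists t.
have m0E := limit_yyE ad (hess phi' x0) (grad phi' x0) cx0; rewrite -gqE in m0E.
have [s [top bot]] := slope_exists (ad_lt ad cx0) tau0 m0E.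
have /boolp.choice[d hd] : forall n : nat, exists d : R * ('rV[R]_(N + 1) -> R) * 'rV[R]_(N + 1),
    [/\ 0 < d.1.1 < n.+1%:R^-1, sols P d.1.1 d.1.2, thinK P d.1.1 d.2,
      `|xpart d.2 - x0| < n.+1%:R^-1 & U x0 - n.+1%:R^-1 < d.1.2 d.2].
  move=> n; have [e [u [z h]]] := relaxed_approx hU cx0 (inv_succ_gt0 n).
  by exists (e, u, z).
pose e n := (d n).1.1; pose u n := (d n).1.2; pose w n := (d n).2.
have e0 n : 0 < e n by have [/andP[]] := hd n.
have he : e @ \oo --> (0 : R).
  apply: cvg_of_dist_real => n; rewrite subr0 gtr0_norm ?e0//.
  by have [/andP[]] := hd n.
have hs n : sols P (e n) (u n) by have [] := hd n.
have Kw n : thinK P (e n) (w n) by have [] := hd n.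
have hw : xpart (w n) @[n --> \oo] --> x0 by apply: cvg_of_dist => n; have [] := hd n.
have haw n : U x0 - n.+1%:R^-1 <= u n (w n) by apply: ltW; have [] := hd n.
have ha : U x0 - n.+1%:R^-1 @[n --> \oo] --> U x0.
  rewrite -[X in _ --> X]subr0; apply: cvgB; [exact: cvg_cst|exact: cvg_inv_succ].
have hub n : exists B, bnd_on (thinK P (e n)) (u n) B by apply/bounded_bnd_on; exact: (hs n).1.1.
have hup (sg : R) : 0 < sg -> \forall n \near \oo, forall z, thinK P (e n) z ->
    u n z <= U x0 - phi' x0 + phi' (xpart z) - sqdist kap x0 (xpart z) + sg.
  move=> sg0; have ct : continuous (fun x => U x0 - phi x0 + phi x).
    by apply: contD; [exact: contC|exact: jet2_continuous (jet2_C2 Cphi)].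
  have := relaxed_below hU ct _ sg0 => /(_ (fun x cx => ltac:(by have := hmax x cx; lra))).
  move=> h; have [r [r0 hr]] := filter_ex (filterI (nbhs_right_gt (0 : R)) h).
  have := he => /cvgr_lt/(_ _ r0); apply: filterS => n en z Kz.
  have := hr (e n) (u n) z _ (hs n) Kz; rewrite e0 en => /(_ isT).
  by rewrite /phi' sqdist0; move: (u n z) (phi x0) (phi _) (sqdist _ _ _) => a1 a2 a3 a4; lra.
have Cq : C1 q by exact: flux_C1 (ad_ob0 ad) (ad_rh0 ad) Cphi'.
have [z [xi [Kz zmax hz hh hv]]] :=
  localization ad Cphi' Cq (m0 + tau) s tau0 kap0 e0 he hub Kw hw haw ha hup.
have lat' : bdry (dom P) x0 -> 0 < dot (nrm P x0) (grad phi' x0) by rewrite gE.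
have nf := tester_fails ad Cphi' _ he (nearW _ e0) (nearW _ Kz) hz cx0 hh hv Ft lat' top bot.
have [n nle'] := filter_ex (nf _ _ _); apply: nle'.
have [Cj gj Hj] := jet2_tester q tau (m0 + tau) s Cphi' (e n) (xi n).
by have := (hs n).1.2 _ (z n) Cj (Kz n) (zmax n); rewrite gj Hj.
Qed.

End LimitSub.

(** * Half relaxed limits *)

Section MonotoneSup.
Context {R : realType}.

(** Monotonicity in r makes the limit an infimum. *)
Lemma sup_limit (V : R -> set (\bar R)) (r0 C : R) :
  0 < r0 -> (forall r r', 0 < r -> r <= r' -> V r `<=` V r') ->
  (forall r, 0 < r -> V r !=set0) ->
  (forall t, V r0 t -> exists2 a : R, t = a%:E & `|a| <= C) ->
  exists U : R, [/\ ereal_sup (V r) @[r --> 0^'+] --> U%:E, `|U| <= C,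
    forall sg : R, 0 < sg -> exists2 r : R, 0 < r & forall a : R, V r a%:E -> a <= U + sg &
    forall r eta : R, 0 < r -> 0 < eta -> exists2 a : R, V r a%:E & U - eta < a].
Proof.
move=> r00 mono ne bd; pose f r := ereal_sup (V r).
have hf : f r @[r --> 0^'+] --> ereal_inf (f @` [set` `]0, +oo[%R]).
  apply: nondecreasing_at_right_cvge => // r r'; rewrite !in_itv /= !andbT => r1 r2 rr.
  by apply: le_ereal_sup; exact: mono.
set L := ereal_inf _ in hf.
have low r : 0 < r -> ((- C)%:E <= f r)%E.
  move=> r1; have m0 : 0 < Num.min r r0 by rewrite lt_min r1 r00.
  have [t Vt] := ne _ m0; have [|a ta aC] := bd t.
    by apply: (mono _ _ m0) Vt; rewrite ge_min lexx orbT.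
  apply: (@le_trans _ _ t).
    by rewrite ta lee_fin; move: aC; rewrite ler_norml => /andP[].
  by apply: ereal_sup_ubound; apply: (mono _ _ m0) Vt; rewrite ge_min lexx.
have up : (f r0 <= C%:E)%E.
  apply: ge_ereal_sup => t /bd[a -> aC]; rewrite lee_fin; exact: le_trans (ler_norm _) aC.
have Lf r : 0 < r -> (L <= f r)%E.
  by move=> r1; apply: ereal_inf_lbound; exists r => //; rewrite /= in_itv /= r1.
have LC : (L <= C%:E)%E by exact: le_trans (Lf _ r00) up.
have CL : ((- C)%:E <= L)%E.
  apply: le_ereal_inf_tmp => _ [r + <-]; rewrite /= in_itv /= andbT; exact: low.
have Lfin : L \is a fin_num.
  rewrite fin_numE; apply/andP; split.
    by rewrite -ltNye; apply: lt_le_trans CL; rewrite ltNyr.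
  by rewrite -ltey; apply: le_lt_trans LC _; rewrite ltry.
exists (fine L); have LE : L = (fine L)%:E by rewrite fineK.
rewrite LE in CL LC; split.
- by rewrite -LE.
- by rewrite ler_norml -!lee_fin CL LC.
- move=> sg sg0; have : (L < (fine L + sg)%:E)%E by rewrite {1}LE lte_fin ltrDl.
  move=> /ereal_inf_lt[_ [r + <-] h]; rewrite /= in_itv /= andbT => r1; exists r => // a Va.
  by rewrite -lee_fin; apply: le_trans (ltW h); exact: ereal_sup_ubound.
- move=> r eta r1 eta0; have m0 : 0 < Num.min r r0 by rewrite lt_min r1 r00.
  have : ((fine L - eta)%:E < f (Num.min r r0))%E.
    by apply: lt_le_trans (Lf _ m0); rewrite [ltRHS]LE lte_fin gtrDl oppr_lt0.
  move=> /ereal_sup_gt[t Vt]; have [|a ta aC] := bd t.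
    by apply: (mono _ _ m0) Vt; rewrite ge_min lexx orbT.
  rewrite ta lte_fin => h; exists a => //; rewrite -ta.
  by apply: (mono _ _ m0) Vt; rewrite ge_min lexx.
Qed.

End MonotoneSup.

Section Relaxed.
Context {R : realType} {N : nat}.
Variable P : problem R N.
Hypothesis ad : admissible P.
Local Notation cl := (closure (dom P)).

Definition values := relaxed_values (dom P) (nrm P) (gup P) (glo P) (eqn P) (obp P) (obm P) (rhp P) (rhm P).
Definition upper := upper_relaxed (dom P) (nrm P) (gup P) (glo P) (eqn P) (obp P) (obm P) (rhp P) (rhm P).
Definition lower := lower_relaxed (dom P) (nrm P) (gup P) (glo P) (eqn P) (obp P) (obm P) (rhp P) (rhm P).

Lemma values_mono x r r' : r <= r' -> values x r `<=` values x r'.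
Proof.
move=> rr t [e [u [z [/andP[e0 er] su Kz zr ->]]]]; exists e, u, z; split => //.
  by rewrite e0 (lt_le_trans er).
exact: lt_le_trans zr rr.
Qed.

Lemma values_nonempty x r : cl x -> 0 < r -> values x r !=set0.
Proof.
move=> cx r0; pose d := r / (N%:R + 1).
have N1 : 0 < N%:R + 1 :> R by rewrite ltr_pwDr.
have d0 : 0 < d by rewrite divr_gt0.
have [x' [Ox' x'd]] := cx _ (near_norm x d0).
have [e [[e0 er] [u su]]] := filter_ex (filterI (filterI (nbhs_right_gt (0 : R)) (nbhs_right_lt r0)) (sols_exist ad)).
pose z := row_mx x' (e * gmean P x')%:M.
exists (u z)%:E, e, u, z; split => //.
- by apply/andP.
- by apply: thin_sub_K; exact: thin_midpoint.
- rewrite xpart_row; apply: le_lt_trans (enorm_le_norm _) _.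
  apply: (@le_lt_trans _ _ (N%:R * d)); first by rewrite ler_wpM2l// ltW.
  by rewrite /d mulrA ltr_pdivrMr// mulrC ltr_pM2l// ltrDl.
Qed.

Lemma upper_limit : exists C : R, forall x, cl x -> exists U : R,
  [/\ ereal_sup (values x r) @[r --> 0^'+] --> U%:E, `|U| <= C,
    forall sg : R, 0 < sg -> exists2 r : R, 0 < r & forall e u z, 0 < e < r -> sols P e u ->
      thinK P e z -> `|xpart z - x| < r -> u z <= U + sg &
    forall eta : R, 0 < eta -> exists e u z, [/\ 0 < e < eta, sols P e u, thinK P e z,
      `|xpart z - x| < eta & U - eta < u z]].
Proof.
have [C hC] := sols_bounded ad; exists C => x cx.
have [r0 [r00 hr0]] : exists r0 : R, 0 < r0 /\ forall e, 0 < e < r0 -> forall u, sols P e u -> bnd_on (thinK P e) u C.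
  move: hC; rewrite /at_right near_withinE => /nbhs_normP[d /= d0 h].
  exists d; split => // e /andP[e0 ed]; apply: (h e) => //=.
  by rewrite sub0r normrN gtr0_norm.
have [|r r' _|r rp|t|U [UE UC R1 R2]] := @sup_limit R (values x) r0 C.
- exact: r00.
- exact: values_mono.
- exact: values_nonempty.
- by move=> [e [u [z [er su Kz _ ->]]]]; exists (u z) => //; exact: (hr0 e).
exists U; split => //.
- move=> sg sg0; have [r rp hr] := R1 sg sg0; pose d := r / (N%:R + 1).
  have N1 : 1 <= N%:R + 1 :> R by rewrite lerDr.
  have N0 : 0 < N%:R + 1 :> R by exact: lt_le_trans ltr01 N1.
  have dr : d <= r by rewrite /d ler_pdivrMr// ler_peMr// ltW.
  exists d; first by rewrite divr_gt0.
  move=> e u z /andP[e0 ed] su Kz zd; apply: hr; exists e, u, z; split => //.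
    by rewrite e0 (lt_le_trans ed).
  apply: le_lt_trans (enorm_le_norm _) _.
  apply: (@le_lt_trans _ _ (N%:R * d)); first by rewrite ler_wpM2l// ltW.
  by rewrite /d mulrA ltr_pdivrMr// mulrC ltr_pM2l// ltrDl.
- move=> eta eta0; have [a [e [u [z [er su Kz zr [->]]]]] h] := R2 eta eta eta0 eta0.
  exists e, u, z; split => //; exact: le_lt_trans (norm_le_enorm _) zr.
Qed.

Lemma upperE x (U : R) : ereal_sup (values x r) @[r --> 0^'+] --> U%:E -> upper x = U%:E.
Proof. by move=> h; apply/cvg_lim. Qed.

Definition upperR x : R := fine (upper x).

(** The asymptotic upper bound is local; compactness of the closure makes it
    uniform in terms of any continuous majorant. The limit is upper
    semicontinuous because the neighbourhoods shrink, so it coincides with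
    its envelope. *)
Lemma upper_relaxed_sup : [/\ forall x, cl x -> upper x \is a fin_num,
  exists C, bnd_on cl upperR C, relaxed_sup P upperR &
  forall x, cl x -> usc_env cl upperR x = upperR x].
Proof.
have [C hC] := upper_limit.
have fin x : cl x -> upper x \is a fin_num by move=> /hC[U [/upperE->]].
have bnd : bnd_on cl upperR C by move=> x /hC[U [/upperE E UC _ _]]; rewrite /upperR E.
have R1 x : cl x -> forall sg : R, 0 < sg -> exists2 r : R, 0 < r & forall e u z, 0 < e < r ->
    sols P e u -> thinK P e z -> `|xpart z - x| < r -> u z <= upperR x + sg.
  by move=> /hC[U [/upperE E _ h _]]; rewrite /upperR E.
have R2 x : cl x -> forall eta : R, 0 < eta -> exists e u z, [/\ 0 < e < eta, sols P e u, thinK P e z,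
      `|xpart z - x| < eta & upperR x - eta < u z].
  by move=> /hC[U [/upperE E _ _ h]]; rewrite /upperR E.
split => //; first by exists C.
- split; last exact: R2.
  move=> theta ct le sg sg0.
  have /near_covering_withinP nK := (compact_near_coveringP cl).1 (cl_compact ad).
  have h : \forall r \near (0 : R)^'+, cl `<=` (fun x => forall e u z, 0 < e < r -> sols P e u ->
      thinK P e z -> xpart z = x -> u z <= theta x + sg).
    apply: (nK _ (0 : R)^'+ (fun r x => forall e u z, 0 < e < r -> sols P e u ->
      thinK P e z -> xpart z = x -> u z <= theta x + sg)) => x cx.
    have sg2 : 0 < sg / 2 by rewrite divr_gt0.
    have [r r0 hr] := R1 x cx _ sg2.
    have lt : theta x - sg / 2 < theta x by rewrite gtrDl oppr_lt0.
    have h1 : \forall x' \near x, theta x - sg / 2 < theta x' by have := ct x => /cvgr_gt/(_ _ lt).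
    exists ([set x' | `|x' - x| < r /\ theta x - sg / 2 < theta x'], [set r' | r' < r]).
      by split => /=; [exact: filterI (near_norm x r0) h1|exact: nbhs_right_lt].
    move=> [x' r'] [/= [xr tx] rr] cx' e u z /andP[e0 er] su Kz zx.
    have := hr e u z; rewrite e0 (lt_trans er rr) zx => /(_ isT su Kz xr).
    have := le x cx; move: tx; move: (theta x) (theta x') (upperR x) (u z) => a b c d; lra.
  apply: filterS h => r hr e u z er su Kz; have /andP[e0 _] := er.
  by apply: (hr _ (thinK_sub ad e0 Kz).1 _ _ _ er su Kz).
- move=> x cx; apply/eqP; rewrite eq_le (env_ge bnd cx) andbT.
  apply/ler_addgt0Pr => d d0; apply: (env_le bnd cx); have d2 : 0 < d / 2 by rewrite divr_gt0.
  have [r r0 hr] := R1 x cx _ d2; have r2 : 0 < r / 2 by rewrite divr_gt0.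
  apply: filterS (near_norm x r2) => w wr cw.
  have m0 : 0 < Num.min (r / 2) (d / 2) by rewrite lt_min r2 d2.
  have [e [u [z [/andP[e0 er] su Kz zw uz]]]] := R2 w cw _ m0.
  move: er zw; rewrite !lt_min => /andP[er _] /andP[zw _].
  have uz' : upperR w - d / 2 < u z.
    by apply: le_lt_trans uz; rewrite lerD2l lerN2 ge_min lexx orbT.
  have zr : `|xpart z - x| < r.
    have -> : xpart z - x = (xpart z - w) + (w - x) by rewrite addrA subrK.
    by apply: le_lt_trans (ler_normD _ _) _; rewrite [ltRHS]splitr ltrD.
  have er' : e < r by apply: lt_trans er _; rewrite ltr_pdivrMr// ltr_pMr// ltr1n.
  have := hr e u z; rewrite e0 er' => /(_ isT su Kz zr); move: uz'.
  by move: (upperR x) (upperR w) (u z) => a b c; lra.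
Qed.

Lemma upper_visc_sub : visc_sub cl (lim_le P) upperR.
Proof.
have [_ [C bnd] hU envE] := upper_relaxed_sup.
split; first by apply/bounded_bnd_on; exists C.
move=> phi x Cphi cx hmax; rewrite envE//; apply: (relaxed_sup_test ad hU Cphi cx) => w cw.
by have := hmax w cw; rewrite !envE.
Qed.

End Relaxed.

Section Flip.
Context {R : realType} {N : nat}.
Variable P : problem R N.
Hypothesis ad : admissible P.
Local Notation cl := (closure (dom P)).

Lemma valuesN x r : values (flip P) x r = [set (- t)%E | t in values P x r].
Proof.
apply/seteqP; split => [t [e [u [z [er su Kz zr ->]]]]|_ [t [e [u [z [er su Kz zr ->]]]] <-]].
  exists (- u z)%:E; last by rewrite -EFinN opprK.
  by exists e, (fun z => - u z), z; split => //; rewrite -[P]flipK; exact: sols_flip.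
by exists e, (fun z => - u z), z; split => //; exact: sols_flip.
Qed.

Lemma lowerE x : lower P x = (- upper (flip P) x)%E.
Proof.
have E : (fun r => ereal_inf (values P x r)) = (fun r => - ereal_sup (values (flip P) x r))%E.
  by apply/funext => r; rewrite valuesN.
have hU : ereal_sup (values (flip P) x r) @[r --> (0 : R)^'+] -->
    ereal_inf ((fun r => ereal_sup (values (flip P) x r)) @` [set` `]0, +oo[%R]).
  apply: nondecreasing_at_right_cvge => // r r' _ _ rr.
  by apply: le_ereal_sup; exact: values_mono.
have -> : upper (flip P) x = ereal_inf ((fun r => ereal_sup (values (flip P) x r)) @` [set` `]0, +oo[%R]).
  by apply/cvg_lim.
by rewrite /lower /lower_relaxed -/(values P) E; apply/cvg_lim => //; exact: cvgeN.
Qed.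

Definition lim_ge := limit_ge (dom P) (nrm P) (gup P) (glo P) (eqn P) (ob0 P) (rh0 P) (okp P) (okm P) (rlp P) (rlm P).

Lemma grad_opp (f : 'rV[R]_N -> R) x : C1 f -> grad (fun y => - f y) x = - grad f x.
Proof.
by move=> [df _]; apply/rowP => i; rewrite gradE pderivN// [RHS]mxE gradE.
Qed.

Lemma limit_A_opp g0 (X : 'M[R]_N) (x : 'rV[R]_N) : limit_A g0 (- X) x = - limit_A g0 X x.
Proof. by rewrite /limit_A opp_block_mx mulNmx mulmxN mulNmx. Qed.

Lemma limit_B_opp gp gm g0 kp km (p x : 'rV[R]_N) :
  limit_B gp gm g0 kp km (- p) x = - limit_B gp gm g0 kp km p x.
Proof.
have E (b : R) : (- b)%:M = - b%:M :> 'M[R]_1 by rewrite raddfN.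
by rewrite /limit_B opp_block_mx oppr0 mulNmx trmxN dotNr E.
Qed.

Lemma limit_C_opp gp gm g0 b0 lp lm (x : 'rV[R]_N) : C1 b0 ->
  limit_C gp gm g0 (fun y => - b0 y) (fun y => - lp y) (fun y => - lm y) x =
  - limit_C gp gm g0 b0 lp lm x.
Proof.
move=> Cb; have E (b : R) : - b%:M = (- b)%:M :> 'M[R]_1 by rewrite raddfN.
rewrite /limit_C opp_block_mx oppr0 (grad_opp x Cb) trmxN E /limit_c (grad_opp x Cb) dotNr.
by rewrite !mulrN -opprD mulNr opprD.
Qed.

Lemma lim_G_flip X p r x : lim_G (flip P) (- X) (- p) (- r) x = - lim_G P X p r x.
Proof.
rewrite /lim_G /limit_G [gup (flip P)]/= [glo (flip P)]/= [ob0 (flip P)]/= [okp (flip P)]/= [okm (flip P)]/=.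
rewrite [rh0 (flip P)]/= [rlp (flip P)]/= [rlm (flip P)]/= limit_A_opp limit_B_opp.
rewrite limit_C_opp; last exact: ad_rh0 ad.
rewrite -!opprD.
have -> : row_mx (- p) (- (rh0 P x + dot (ob0 P x) (- p)))%:M =
    - row_mx p (rh0 P x - dot (ob0 P x) p)%:M :> 'rV[R]_(N + 1).
  by rewrite opp_row_mx dotNr raddfN.
by rewrite /flip /= !opprK.
Qed.

Lemma lim_ge_flip X p r x : lim_ge X p r x <-> lim_le (flip P) (- X) (- p) (- r) x.
Proof.
rewrite /lim_ge /limit_ge /lim_le /limit_le -/(lim_G P) -/(lim_G (flip P)) lim_G_flip dotNr !oppr_le0.
by [].
Qed.

Lemma lower_visc_super : (forall x, cl x -> lower P x \is a fin_num) /\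
  visc_super cl lim_ge (fun x => fine (lower P x)).
Proof.
have [fin _ _ _] := upper_relaxed_sup (admissible_flip ad).
split; first by move=> x cx; rewrite lowerE fin_numN; exact: fin.
have h := upper_visc_sub (admissible_flip ad).
apply: (@visc_super_flip R _ cl lim_ge (lim_le (flip P)) (fun x => fine (lower P x)) lim_ge_flip).2.
have -> // : (fun x => - fine (lower P x)) = upperR (flip P).
by apply/funext => x; rewrite lowerE /upperR fineN opprK.
Qed.

End Flip.

Theorem theorem1 (R : realType) (N : nat) (N_gt0 : (0 < N)%N)
  (Omega : set 'rV[R]_N) (nu : 'rV[R]_N -> 'rV[R]_N)
  (Omega_open : open Omega) (Omega_connected : connected Omega)
  (Omega_nonempty : Omega !=set0) (Omega_bounded : bounded_set Omega)
  (Omega_C1 : C1_boundary Omega) (nu_normal : outward_unit_normal Omega nu)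
  (gp gm : 'rV[R]_N -> R) (gp_C1 : C1 gp) (gm_C1 : C1 gm)
  (g_lt : forall x, closure Omega x -> gm x < gp x)
  (F : 'M[R]_(N + 1) -> 'rV[R]_(N + 1) -> R -> 'rV[R]_N -> R -> R)
  (F_cont : {within
     [set w : 'M[R]_(N + 1) * 'rV[R]_(N + 1) * R * 'rV[R]_N * R |
        let: (X, p, r, x, y) := w in
        [/\ X^T = X, closure Omega x & -1 <= y <= 1]],
     continuous (fun w : 'M[R]_(N + 1) * 'rV[R]_(N + 1) * R * 'rV[R]_N * R =>
        let: (X, p, r, x, y) := w in F X p r x y)})
  (alpha : R) (alpha_gt0 : 0 < alpha)
  (F_mono : forall (p : 'rV[R]_(N + 1)) (x : 'rV[R]_N) (y : R),
     closure Omega x -> -1 <= y <= 1 ->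
     forall (X Y : 'M[R]_(N + 1)) (r s : R),
       X^T = X -> Y^T = Y -> mxge X Y -> r <= s ->
       F X p r x y - alpha * r <= F Y p s x y - alpha * s)
  (g1p g1m : 'rV[R]_N -> R -> 'rV[R]_N) (bp bm : 'rV[R]_N -> R -> R)
  (g1p_cont : {within closure Omega `*` `[-1, 1],
     continuous (fun z : 'rV[R]_N * R => g1p z.1 z.2)})
  (g1m_cont : {within closure Omega `*` `[-1, 1],
     continuous (fun z : 'rV[R]_N * R => g1m z.1 z.2)})
  (bp_cont : {within closure Omega `*` `[-1, 1],
     continuous (fun z : 'rV[R]_N * R => bp z.1 z.2)})
  (bm_cont : {within closure Omega `*` `[-1, 1],
     continuous (fun z : 'rV[R]_N * R => bm z.1 z.2)})
  (g0 : 'rV[R]_N -> 'rV[R]_N) (b0 : 'rV[R]_N -> R)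
  (g0_C1 : C1vec g0) (b0_C1 : C1 b0)
  (g1p0 : forall x, closure Omega x -> g1p x 0 = g0 x)
  (g1m0 : forall x, closure Omega x -> - g1m x 0 = g0 x)
  (bp0 : forall x, closure Omega x -> bp x 0 = b0 x)
  (bm0 : forall x, closure Omega x -> - bm x 0 = b0 x)
  (kp km : 'rV[R]_N -> 'rV[R]_N) (lp lm : 'rV[R]_N -> R)
  (kp_cont : {within closure Omega, continuous kp})
  (km_cont : {within closure Omega, continuous km})
  (lp_cont : {within closure Omega, continuous lp})
  (lm_cont : {within closure Omega, continuous lm})
  (g1p_exp : unif_expansion (closure Omega) g1p g0 kp)
  (g1m_exp : unif_expansion (closure Omega) g1m (fun x => - g0 x) km)
  (bp_exp : unif_expansion (closure Omega) bp b0 lp)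
  (bm_exp : unif_expansion (closure Omega) bm (fun x => - b0 x) lm) :
  let up := upper_relaxed Omega nu gp gm F g1p g1m bp bm in
  let um := lower_relaxed Omega nu gp gm F g1p g1m bp bm in
  [/\ forall x, closure Omega x -> up x \is a fin_num /\ um x \is a fin_num,
      visc_sub (closure Omega)
        (limit_le Omega nu gp gm F g0 b0 kp km lp lm) (fun x => fine (up x)) &
      visc_super (closure Omega)
        (limit_ge Omega nu gp gm F g0 b0 kp km lp lm) (fun x => fine (um x))].

Proof.
pose P := Problem Omega nu gp gm F g1p g1m bp bm g0 b0 kp km lp lm.
have F_co : cont_on (eqn_domain Omega) (uncurry5 F).
  by apply: within_cont_on; exact: F_cont.
have mono : exists2 a : R, 0 < a & proper_decreasing Omega F a by exists alpha.
have ad : admissible P.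
  exact: (@Admissible R N P N_gt0 Omega_open Omega_bounded Omega_nonempty nu_normal
    gp_C1 gm_C1 g_lt F_co mono (within_cont_on g1p_cont) (within_cont_on g1m_cont)
    (within_cont_on bp_cont) (within_cont_on bm_cont) g0_C1 b0_C1
    (within_cont_on kp_cont) (within_cont_on km_cont) (within_cont_on lp_cont)
    (within_cont_on lm_cont) g1p_exp g1m_exp bp_exp bm_exp).
move=> up um.
have [upfin _ _ _] := upper_relaxed_sup ad.
have [umfin umsuper] := lower_visc_super ad.
split; last exact: umsuper.
  by move=> x cx; split; [exact: upfin|exact: umfin].
exact: (upper_visc_sub ad).
Qed.
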